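(* Let $n\in\{2,3\}$, let $T>0$ be fixed and let $K>0$. Let the kernel $J_\eta$, the operator $\mathcal{L}_\eta$, the potential $f$ and the number $R_0\ge1$ be as in the context. Then there exist constants $\varepsilon_0\in(0,1)$ and $c,C>0$, independent of $c_\varepsilon,\varepsilon,\eta$, such that the following holds for all $\varepsilon\in(0,\varepsilon_0)$ and $0<\eta\le c\,\varepsilon^4$: if $c_{0,\varepsilon}\in H^3(\mathbb{T}^n)$ satisfies $|c_{0,\varepsilon}|\le R_0$ and $$\|c_{0,\varepsilon}\|_{H^1(\mathbb{T}^n)}\le\frac{K}{\varepsilon^2},\qquad\|c_{0,\varepsilon}\|_{H^2(\mathbb{T}^n)}\le\frac{K}{\varepsilon^6},\qquad\|c_{0,\varepsilon}\|_{H^3(\mathbb{T}^n)}\le\frac{K}{\varepsilon^{16}},$$ and $c_\varepsilon$ is the solution of $$\partial_tc_\varepsilon+\mathcal{L}_\eta c_\varepsilon+\frac1{\varepsilon^2}f'(c_\varepsilon)=0\ \text{ in }\mathbb{T}^n\times(0,T),\qquad c_\varepsilon|_{t=0}=c_{0,\varepsilon}\ \text{ in }\mathbb{T}^n,$$ then $$\|c_\varepsilon\|_{L^\infty(0,T;H^3(\mathbb{T}^n))}\le\frac{C}{\varepsilon^{16}}.$$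
   Context: $\mathbb{T}^n=\mathbb{R}^n/2\pi\mathbb{Z}^n$ is the $n$-dimensional torus; $H^k=W^{k,2}$; functions on $\mathbb{T}^n$ are identified with $2\pi$-periodic functions on $\mathbb{R}^n$. Kernel. For $\eta>0$, $J_\eta:\mathbb{R}^n\to[0,\infty)$, $J_\eta(x)=\rho_\eta(|x|)/|x|^2$, with $J_\eta\in W^{1,1}(\mathbb{R}^n)$, where $\rho_\eta:\mathbb{R}\to[0,\infty)$, $\rho_\eta\in L^1(\mathbb{R})$, $\rho_\eta(r)=\rho_\eta(-r)$, $\rho_\eta(r)=\eta^{-n}\rho_1(r/\eta)$ for all $r\in\mathbb{R}$, $\int_0^\infty\rho_\eta(r)r^{n-1}\,dr=2/C_n$ for all $\eta>0$ with $C_n:=\int_{\mathbb{S}^{n-1}}|e_1\cdot\sigma|^2\,d\mathcal{H}^{n-1}(\sigma)$, $\lim_{\eta\searrow0}\int_{\kappa}^\infty\rho_\eta(r)r^{n-1}\,dr=0$ for all $\kappa>0$, and $\rho_1$ is compactly supported in $(-\pi,\pi)$. $\tilde J_\eta:\mathbb{T}^n\to[0,\infty)$ is the $2\pi$-periodic extension of $J_\eta$. Nonlocal operator. $\mathcal{L}_\eta\varphi(x):=\int_{\mathbb{T}^n}\tilde J_\eta(x-y)(\varphi(x)-\varphi(y))\,dy=\int_{\mathbb{R}^n}J_\eta(x-y)(\varphi(x)-\varphi(y))\,dy$ for $x\in\mathbb{T}^n$ and integrable $\varphi:\mathbb{T}^n\to\mathbb{R}$. Potential. $f\in C^\infty(\mathbb{R})$,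 $f(\pm1)=f'(\pm1)=0$, $f''(\pm1)>0$, $f>0$ in $(-1,1)$; $R_0\ge1$ is such that $f'<0$ in $(-\infty,-R_0)$ and $f'>0$ in $(R_0,\infty)$; $|f'(r)|\le C(1+|r|^3)$ for all $r\in\mathbb{R}$ and some constant $C$; $f''\ge-\alpha$ for some $\alpha\ge0$. Solution. ''The solution'' is the unique solution with regularity $H^1(0,T;L^2(\mathbb{T}^n))\cap L^\infty(0,T;H^3(\mathbb{T}^n))\cap C^1([0,T],C^0(\mathbb{T}^n))\cap C^0([0,T],H^2(\mathbb{T}^n))$, which exists for initial values in $H^3(\mathbb{T}^n)$ bounded by $R_0$ in absolute value, and is unique even within $H^1(0,T;L^2(\mathbb{T}^n))\cap L^\infty(0,T;H^1(\mathbb{T}^n))$. *)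

(* Defs.v *)
From HB Require Import structures.
From mathcomp Require Import all_boot all_order all_algebra.
From mathcomp Require Import all_classical all_reals all_analysis.
From mathcomp Require Import ess_sup_inf.
Set Implicit Arguments.
Unset Strict Implicit.
Unset Printing Implicit Defensive.
Import Order.TTheory GRing.Theory Num.Theory.
Import numFieldNormedType.Exports.
Local Open Scope classical_set_scope.
Local Open Scope ring_scope.

(* 'rV[R]_n carries the sigma-algebra generated by the coordinates, i.e. the
   Borel sigma-algebra of R^n. *)
Fact rowvector_display : measure_display. Proof. exact: default_measure_display. Qed.

Section rowvector_measurable.
Variables (R : realType) (n : nat).

Let coords : 'I_n -> 'rV[R]_n -> measurableTypeR R := fun i v => v 0 i.

Let rv_set0 : g_sigma_preimage coords set0.
Proof. exact: sigma_algebra0. Qed.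

Let rv_setC A : g_sigma_preimage coords A -> g_sigma_preimage coords (~` A).
Proof. exact: sigma_algebraC. Qed.

Let rv_bigcup (F : (set 'rV[R]_n)^nat) :
  (forall i, g_sigma_preimage coords (F i)) ->
  g_sigma_preimage coords (\bigcup_i (F i)).
Proof. exact: sigma_algebra_bigcup. Qed.

HB.instance Definition _ := @isMeasurable.Build rowvector_display
  'rV[R]_n (g_sigma_preimage coords) rv_set0 rv_setC rv_bigcup.

Lemma measurable_coord (i : 'I_n) :
  measurable_fun [set: 'rV[R]_n] (fun v : 'rV[R]_n => v 0 i : measurableTypeR R).
Proof.
move=> _ Y mY; rewrite setTI; apply: sub_sigma_algebra => /=.
rewrite -bigcup_seq/=; exists i => /=; first by rewrite mem_index_enum.
by exists Y => //; rewrite setTI.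
Qed.

Lemma measurable_rowvector d (T : measurableType d) (f : T -> 'rV[R]_n) :
  (forall i, measurable_fun [set: T] (fun x => f x 0 i : measurableTypeR R)) ->
  measurable_fun [set: T] f.
Proof.
move=> mf _ A mA.
suff H : g_sigma_preimage (fun i => coords i \o f) `<=` measurable.
  by apply: H; rewrite g_sigma_preimage_comp; exists A.
apply: smallest_sub; first exact: sigma_algebra_measurable.
move=> B; rewrite -bigcup_seq => -[i _ [C mC <-]].
exact: mf.
Qed.

End rowvector_measurable.

Section lebesgue_rowvector.
Variable R : realType.

Definition vcons (n : nat) (p : measurableTypeR R * 'rV[R]_n) : 'rV[R]_n.+1 :=
  \row_i oapp (fun j => p.2 0 j) p.1 (unlift ord0 i).

Definition vuncons (n : nat) (v : 'rV[R]_n.+1) : measurableTypeR R * 'rV[R]_n :=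
  (v 0 ord0, \row_j v 0 (lift ord0 j)).

Lemma vconsK n : cancel (@vcons n) (@vuncons n).
Proof.
move=> [x v]; rewrite /vuncons/vcons mxE unlift_none /=; congr pair.
by apply/rowP => j; rewrite !mxE liftK.
Qed.

Lemma measurable_vcons n : measurable_fun setT (@vcons n).
Proof.
apply: measurable_rowvector => i.
under eq_fun do rewrite mxE.
case: unliftP => [j|] _ /=; last exact: measurable_fst.
apply: (@measurableT_comp _ _ _ _ _ _ (fun v : 'rV[R]_n => v 0 j : measurableTypeR R)).
  exact: measurable_coord.
exact: measurable_snd.
Qed.

Lemma measurable_vuncons n : measurable_fun setT (@vuncons n).
Proof.
apply/measurable_fun_pairP; split; first exact: measurable_coord.
apply: measurable_rowvector => i /=.
under eq_fun do rewrite /= mxE.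
exact: measurable_coord.
Qed.


Section lebesgue_step.
Local Open Scope ereal_scope.
Variables (n : nat) (mu : {sigma_finite_measure set 'rV[R]_n -> \bar R}).

Definition leb_step : set 'rV[R]_n.+1 -> \bar R :=
  pushforward (@lebesgue_measure R \x mu) (@vcons n).

Let leb_step0 : leb_step set0 = 0.
Proof. by rewrite /leb_step/pushforward preimage_set0 measure0. Qed.

Let leb_step_ge0 A : 0 <= leb_step A.
Proof. by rewrite /leb_step/pushforward; apply: (measure_ge0 (lebesgue_measure \x mu)). Qed.

Let leb_step_semi_sigma_additive : semi_sigma_additive leb_step.
Proof.
have mp A : measurable A -> measurable (@vcons n @^-1` A).
  by move=> mA; have := @measurable_vcons n measurableT _ mA; rewrite setTI.
move=> F mF tF mUF; rewrite /leb_step/pushforward preimage_bigcup.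
apply: measure_semi_sigma_additive => [i||].
- exact: mp.
- apply/trivIsetP => /= i j _ _ ij; rewrite -preimage_setI.
  by move/trivIsetP : tF => /(_ _ _ _ _ ij) -> //; rewrite preimage_set0.
- by rewrite -preimage_bigcup; exact: mp.
Qed.

HB.instance Definition _ := isMeasure.Build _ _ _ leb_step
  leb_step0 leb_step_ge0 leb_step_semi_sigma_additive.

Let leb_step_sigma_finite : sigma_finite setT leb_step.
Proof.
have mp A : measurable A -> measurable (@vuncons n @^-1` A).
  by move=> mA; have := @measurable_vuncons n measurableT _ mA; rewrite setTI.
have /sigma_finiteP[F [TF ndF Foo]] := sigma_finiteT (@lebesgue_measure R).
have /sigma_finiteP[G [TG ndG Goo]] := sigma_finiteT mu.
exists (fun k => @vuncons n @^-1` (F k `*` G k)).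
  rewrite -preimage_bigcup [X in _ @^-1` X](_ : _ = setT) ?preimage_setT//.
  apply/seteqP; split => // -[x y] _.
  have [i _ Fix] : (\bigcup_i F i) x by rewrite -TF.
  have [j _ Gjy] : (\bigcup_i G i) y by rewrite -TG.
  exists (maxn i j) => //; split => /=.
    by move: Fix; exact/subsetPset/ndF/leq_maxl.
  by move: Gjy; exact/subsetPset/ndG/leq_maxr.
move=> k; have [mF Fk] := Foo k; have [mG Gk] := Goo k; split.
  by apply: mp; exact: measurableX.
rewrite /leb_step/pushforward (_ : _ @^-1` _ = F k `*` G k).
  by rewrite product_measure1E// lte_mul_pinfty// ge0_fin_numE.
by apply/seteqP; split => p; rewrite /preimage /mkset vconsK.
Qed.

HB.instance Definition _ := Measure_isSigmaFinite.Build _ _ _ leb_step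
  leb_step_sigma_finite.

End lebesgue_step.

(* Lebesgue measure on R^n: product of n copies of lebesgue_measure. *)
Fixpoint leb (n : nat) : {sigma_finite_measure set 'rV[R]_n -> \bar R} :=
  match n with
  | 0%N => \d_(0 : 'rV[R]_0)
  | m.+1 => leb_step (leb m)
  end.

End lebesgue_rowvector.

Section torus_functions.
Context {R : realType} {n : nat}.
Implicit Types (u v g : 'rV[R]_n -> R) (a : 'I_n -> nat).

Definition pderiv (i : 'I_n) u : 'rV[R]_n -> R :=
  fun x => 'D_(delta_mx 0 i) u x.

(* Partial derivative of multi-index a. *)
Definition mderiv a u : 'rV[R]_n -> R :=
  foldr (fun i w => iter (a i) (pderiv i) w) u (enum 'I_n).

Definition smooth u := forall s : seq 'I_n,
  let w := foldr pderiv u s in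
  continuous w /\
  forall i x, derivable w x (delta_mx 0 i).

Definition torus_periodic u := forall x i, u (x + (2 * pi) *: delta_mx 0 i) = u x.

(* Fundamental domain of R^n / 2 pi Z^n; integrals over the torus are integrals
   over this set. *)
Definition cell : set 'rV[R]_n := [set x | forall i, x 0 i \in `[- pi, pi[ ].

Definition cell_rep (x : 'rV[R]_n) : 'rV[R]_n :=
  \row_i (x 0 i - 2 * pi * (Num.floor ((x 0 i + pi) / (2 * pi)))%:~R).

Definition periodic_extension u : 'rV[R]_n -> R := fun x => u (cell_rep x).

Definition weak_derivative (D : set 'rV[R]_n) (test : set ('rV[R]_n -> R))
    a u v :=
  forall phi, test phi ->
    \int[leb R n]_(x in D) (u x * mderiv a phi x) =
    (-1) ^+ (\sum_i a i) * \int[leb R n]_(x in D) (v x * phi x).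

Definition test_torus : set ('rV[R]_n -> R) :=
  [set phi | smooth phi /\ torus_periodic phi].

Definition test_space : set ('rV[R]_n -> R) :=
  [set phi | smooth phi /\ compact (closure [set x | phi x != 0])].

Definition W11 u :=
  (leb R n).-integrable setT (EFin \o u) /\
  forall i : 'I_n, exists g, (leb R n).-integrable setT (EFin \o g) /\
    weak_derivative setT test_space (fun j => (j == i) : nat) u g.

Definition L2 u :=
  [/\ torus_periodic u, measurable_fun setT u &
    (leb R n).-integrable cell (fun x => (u x ^+ 2)%:E)].

Definition L2_derivative a u v := L2 v /\ weak_derivative cell test_torus a u v.

Definition Sobolev (k : nat) u := L2 u /\
  forall a, (\sum_i a i <= k)%N -> exists v, L2_derivative a u v.

(* The weak derivative, as a chosen representative. *)
Definition wderiv a u : 'rV[R]_n -> R := xget (fun=> 0) (L2_derivative a u).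

(* The norms below are extended by +oo outside the corresponding space, so that
   N u < +oo is membership in the space. *)
Definition L2norm u : \bar R :=
  if `[< L2 u >] then (Num.sqrt (\int[leb R n]_(x in cell) (u x ^+ 2)))%:E
  else +oo%E.

Definition Hnorm (k : nat) u : \bar R :=
  if `[< Sobolev k u >] then
    (Num.sqrt (\sum_(a : {ffun 'I_n -> 'I_k.+1} | (\sum_i a i <= k)%N)
       \int[leb R n]_(x in cell) (wderiv (fun i => a i) u x ^+ 2)))%:E
  else +oo%E.

Definition Cnorm u : \bar R :=
  if `[< torus_periodic u /\ continuous u >] then
    ereal_sup [set `|u x|%:E | x in setT]
  else +oo%E.

End torus_functions.

(* Functions of time with values in the space normed by N (see L2norm, Hnorm and
   Cnorm); the time interval is ]0, T[ up to null sets, or [0, T]. *)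
Section vector_valued.
Context {R : realType} {n : nat}.
Local Notation V := ('rV[R]_n -> R).
Variables (N : V -> \bar R) (T : R).
Implicit Types (u g : R -> V) (w : V).

Record simple_map := SimpleMap {
  sm_size : nat;
  sm_set : 'I_sm_size -> set R;
  sm_val : 'I_sm_size -> V }.

Definition simple_in (s : simple_map) := forall i : 'I_(sm_size s),
  measurable (sm_set i) /\ (N (sm_val i) < +oo)%E.

Definition sm_fun (s : simple_map) : R -> V :=
  fun t x => \sum_(i < sm_size s) \1_(sm_set i) t * sm_val i x.

Definition sm_integral (s : simple_map) : V := fun x =>
  \sum_(i < sm_size s) fine (lebesgue_measure (sm_set i `&` `]0, T[)) *
    sm_val i x.

Definition time_measure : {measure set (measurableTypeR R) -> \bar R} :=
  mrestr (@lebesgue_measure R) (measurable_itv `]0, T[).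

Definition strongly_measurable u :=
  exists2 s : nat -> simple_map, (forall j, simple_in (s j)) &
    {ae time_measure, forall t,
      (N (fun x => u t x - sm_fun (s j) t x)) @[j --> \oo] --> 0%E}.

Definition Linf_norm u : \bar R := ess_sup time_measure (fun t => N (u t)).

Definition Linf_in u := strongly_measurable u /\ (Linf_norm u < +oo)%E.

Definition L2_in u := strongly_measurable u /\
  (\int[lebesgue_measure]_(t in `]0%R, T[) (N (u t) * N (u t)) < +oo)%E.

Definition bochner_integral u w := exists s : nat -> simple_map,
  [/\ forall j, simple_in (s j),
      (\int[lebesgue_measure]_(t in `]0%R, T[)
        N (fun x => (u t x - sm_fun (s j) t x)%R))%E @[j --> \oo] --> 0%E &
      N (fun x => w x - sm_integral (s j) x) @[j --> \oo] --> 0%E].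

Definition smoothR (phi : R -> R) :=
  forall (m : nat) (t : R), derivable (derive1n m phi) t 1.

Definition time_test (phi : R -> R) :=
  smoothR phi /\ closure [set t | phi t != 0] `<=` `]0, T[.

Definition weak_time_derivative u g := forall phi, time_test phi ->
  exists2 w, bochner_integral (fun t x => derive1 phi t * u t x) w &
             bochner_integral (fun t x => phi t * g t x) (fun x => - w x).

Definition H1_in u := L2_in u /\ exists2 g, L2_in g & weak_time_derivative u g.

Definition C0_in u := forall t, t \in `[0, T] ->
  (N (u t) < +oo)%E /\
  (fun s => N (fun x => u s x - u t x)) @ within `[0, T] (nbhs t) --> 0%E.

Definition C1_in u := C0_in u /\ exists2 g, C0_in g &
  forall t, t \in `[0, T] ->
  (fun s => N (fun x => (u s x - u t x) / (s - t) - g t x))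
    @ within `[0, T] t^' --> 0%E.

End vector_valued.

Section kernel.
Context {R : realType}.

Definition enorm {n} (x : 'rV[R]_n) : R := Num.sqrt (\sum_i x 0 i ^+ 2).

(* [-oo] for the empty set. *)
Definition diameter {n} (A : set 'rV[R]_n) : \bar R :=
  ereal_sup [set (enorm (x - y))%:E | x in A & y in A].

Definition unit_ball_volume (m : nat) : R :=
  fine (leb R m [set x | enorm x <= 1]).

(* For m > 0, the m-dimensional Hausdorff measure, normalized to agree with
   Lebesgue measure on R^m. *)
Definition hausdorff {n} (m : nat) (A : set 'rV[R]_n) : \bar R :=
  ereal_sup [set ereal_inf
    [set (\sum_(0 <= k <oo)
            (unit_ball_volume m * (fine (diameter (U k)) / 2) ^+ m)%:E)%E |
      U in [set U : nat -> set 'rV[R]_n |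
        A `<=` \bigcup_k U k /\ forall k, (diameter (U k) <= d%:E)%E]] |
    d in [set d : R | 0 < d]].

(* Indices start at 0: the first basis vector is the one of index 0. *)
Definition first_unit n : 'rV[R]_n := \row_i ((i : nat) == 0)%:R.

Definition dot {n} (x y : 'rV[R]_n) : R := \sum_i x 0 i * y 0 i.

Definition unit_sphere n : set 'rV[R]_n := [set s | enorm s = 1].

Definition sphere_constant (n : nat) : R :=
  fine (\int[hausdorff n.-1]_(s in @unit_sphere n)
    ((`|dot (first_unit n) s| ^+ 2)%R)%:E)%E.

(* The value at x = 0 is irrelevant: division by zero yields 0 there. *)
Definition kernel_J {n} (rho : R -> R -> R) (eta : R) : 'rV[R]_n -> R :=
  fun x => rho eta (enorm x) / enorm x ^+ 2.

Record kernel_family (n : nat) (rho : R -> R -> R) : Prop := KernelFamily {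
  rho_ge0 : forall eta r, 0 < eta -> 0 <= rho eta r;
  rho_even : forall eta r, 0 < eta -> rho eta (- r) = rho eta r;
  rho_integrable : forall eta, 0 < eta ->
    lebesgue_measure.-integrable setT (EFin \o rho eta);
  rho_scaling : forall eta r, 0 < eta ->
    rho eta r = eta ^- n * rho 1 (r / eta);
  rho_moment : forall eta, 0 < eta ->
    (\int[lebesgue_measure]_(r in `[0%R, +oo[) (rho eta r * r ^+ n.-1)%:E =
     (2 / sphere_constant n)%:E)%E;
  rho_concentration : forall kappa, 0 < kappa ->
    (\int[lebesgue_measure]_(r in `[kappa, +oo[) (rho eta r * r ^+ n.-1)%:E)%E
      @[eta --> 0^'+] --> 0%E;
  rho_support : closure [set r | rho 1 r != 0] `<=` `]- pi, pi[;
  kernel_W11 : forall eta, 0 < eta -> W11 (@kernel_J n rho eta) }.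

(* The kernel is extended periodically from the cell, which contains its support
   as soon as eta <= 1. *)
Definition nonlocal_op {n} (rho : R -> R -> R) (eta : R) (phi : 'rV[R]_n -> R) :
    'rV[R]_n -> R := fun x =>
  \int[leb R n]_(y in cell)
    (periodic_extension (kernel_J rho eta) (x - y) * (phi x - phi y)).

Record potential (f : R -> R) (R0 : R) : Prop := Potential {
  f_smooth : smoothR f;
  f_wells : f 1 = 0 /\ f (-1) = 0;
  f'_wells : derive1 f 1 = 0 /\ derive1 f (-1) = 0;
  f''_wells : 0 < derive1n 2 f 1 /\ 0 < derive1n 2 f (-1);
  f_gt0 : forall r, -1 < r < 1 -> 0 < f r;
  R0_ge1 : 1 <= R0;
  f'_left : forall r, r < - R0 -> derive1 f r < 0;
  f'_right : forall r, R0 < r -> 0 < derive1 f r;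
  f'_growth : exists M, forall r, `|derive1 f r| <= M * (1 + `|r| ^+ 3);
  f''_lower : exists2 alpha, 0 <= alpha & forall r, - alpha <= derive1n 2 f r }.

Record solution {n} (rho : R -> R -> R) (f : R -> R) (T eta eps : R)
    (u0 : 'rV[R]_n -> R) (u : R -> 'rV[R]_n -> R) : Prop := Solution {
  sol_H1_L2 : H1_in L2norm T u;
  sol_Linf_H3 : Linf_in (Hnorm 3) T u;
  sol_C1_C0 : C1_in Cnorm T u;
  sol_C0_H2 : C0_in (Hnorm 2) T u;
  sol_equation : forall t x, 0 < t < T ->
    derive1 (fun s => u s x) t + nonlocal_op rho eta (u t) x
      + derive1 f (u t x) / eps ^+ 2 = 0;
  sol_initial : {ae leb R n, forall x, u 0 x = u0 x} }.

End kernel.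

(* Main.v *)
Require Import Defs.
From HB Require Import structures.
From mathcomp Require Import all_boot all_order all_algebra.
From mathcomp Require Import all_classical all_reals all_analysis.
From mathcomp Require Import zify ring lra.
From mathcomp Require Import ess_sup_inf measurable_realfun.
Set Implicit Arguments.
Unset Strict Implicit.
Unset Printing Implicit Defensive.
Import Order.TTheory GRing.Theory Num.Theory.
Import numFieldNormedType.Exports.
Local Open Scope classical_set_scope.
Local Open Scope ring_scope.

(** The bound follows from an energy estimate for third finite differences, which
replaces differentiating the equation three times: the solution is only known to
be of class C^1 in time with values in the continuous functions, while finite
differences of it make sense without any further regularity.

Fix a direction e_i, a step h > 0, let v = D u(t) be the third difference of the
solution with step h e_i, and X(t) the square of its L^2 norm over the torus. As D
commutes with the nonlocal operator L, the equation yields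
  X' = - 2 <v, L v> - (2 / eps^2) <v, D f'(u)>.
Two estimates control the right-hand side.

First, the maximum principle ([max_principle]) keeps |u| below R0, because L u >= 0
at a maximum point while f' > 0 beyond R0. Then f' may be regarded as bounded
with bounded derivatives, and D f'(u) is bounded by C D u in L^2, with C depending
on f and R0 only ([moser]). This is the discrete form of the Moser estimate: the
chain rule produces the terms (second difference) * (first difference) and (first
difference)^3, which Gagliardo-Nirenberg interpolation with the sup norm, done by
summation by parts and Young's inequality, bounds by the third difference.

Second, <v, L v> is, up to a constant, the sum over frequencies k of m(k) times the
squared Fourier coefficient of v, where m(k) is the integral of J_eta(z)
(1 - cos (k.z)). By scaling, m(k) = eta^-2 M(eta k) with M the symbol for eta = 1. The
function M is bounded below at infinity by the Riemann-Lebesgue lemma and satisfies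
M(2 xi) <= 4 M(xi), hence M(xi) >= c min(1, xi_i^2) for every coordinate i. So m(k) is
at least B / eps^2 for |k_i| > A / eps, because eta is small compared with eps
([symb_coercive], [coercive]). The coercivity fails only on the modes
|k_i| <= A / eps, where the difference operator D multiplies the Fourier coefficients
by at most (h A / eps)^3 ([low_modes]).

Choosing B = 1 + C, these estimates show X' < 0 as soon as X exceeds twice the low
mode contribution, so that X(t) <= X(0) + C h^6 eps^-6 for all t ([energy_bound]).
Moreover X(0) <= h^6 |d_i^3 u_0|^2 <= K^2 h^6 eps^-32. Letting h tend to 0 in the
Parseval identity turns the bounds on third differences in all directions into a
bound on the H^3 norm by C eps^-16 ([Hnorm3_le]).

The lower bound on M needs a kernel that is not almost everywhere zero. It follows
from the moment condition once the constant C_n of the sphere is known to be a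
positive finite number ([sphere_constant_gt0], [kernel_not_null]). As C_n is an
integral against Hausdorff measure, this part develops that measure from scratch:
Borel sets are Caratheodory measurable, the sphere has finite measure because it is
covered by finitely many Lipschitz graphs, and a cap has positive measure because its
projection contains a cube. *)

(** * Lebesgue measure of boxes and of coordinatewise maps *)

Lemma measurable_preimage d d' (T : measurableType d) (U : measurableType d')
    (f : T -> U) (A : set U) :
  measurable_fun setT f -> measurable A -> measurable (f @^-1` A).
Proof. by move=> mf mA; rewrite -[_ @^-1` _]setTI; exact: mf. Qed.

Section change_of_variable.
Local Open Scope ereal_scope.

Lemma ge0_integral_mrestr d (X : measurableType d) (R : realType)
    (mu : {measure set X -> \bar R}) (D : set X)
    (mD : measurable D) (f : X -> \bar R) :
  measurable_fun [set: X] f -> (forall x, 0 <= f x) ->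
  \int[mrestr mu mD]_x f x = \int[mu]_(x in D) f x.
Proof.
move=> mf f0; rewrite (@ge0_negligible_integral _ _ _ _ setT (~` D))//;
  last 2 first.
- exact: measurableC.
- by rewrite [LHS]/(mu (~` D `&` D)) setICl; exact: (measure0 mu).
rewrite setDE setTI setCK; apply: eq_measure_integral => A mA AD.
by rewrite [LHS]/(mu (A `&` D)) setIidl.
Qed.

(** The restriction to [D] and [E] and the factor [c] make this usable both for maps
of the torus (measure preserving on a cell) and for dilations of the whole space. *)
Lemma ge0_change_of_variable d d' (X : measurableType d)
    (Y : measurableType d') (R : realType) (mu : {measure set X -> \bar R})
    (nu : {measure set Y -> \bar R}) (D : set X) (E : set Y) (phi : X -> Y)
    (c : R) (f : Y -> \bar R) :
  (0 <= c)%R -> measurable D -> measurable E -> measurable_fun setT phi ->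
  (forall A, measurable A -> mu (D `&` phi @^-1` A) = c%:E * nu (E `&` A)) ->
  measurable_fun [set: Y] f -> (forall y, 0 <= f y) ->
  \int[mu]_(x in D) f (phi x) = c%:E * \int[nu]_(y in E) f y.
Proof.
move=> c0 mD mE mphi H mf f0.
rewrite -(ge0_integral_mrestr mu mD); last 2 first.
- exact: measurableT_comp.
- by move=> x; exact: f0.
rewrite -(ge0_integral_mrestr nu mE)//.
have -> : \int[mrestr mu mD]_x f (phi x) =
    \int[pushforward (mrestr mu mD) phi]_y f y.
  by rewrite ge0_integral_pushforward// => y _; exact: f0.
rewrite -[X in X%:E * _]/((NngNum c0)%:num) -ge0_integral_mscale//.
apply: eq_measure_integral => A mA _.
have := H _ mA; rewrite setIC (setIC E); exact.
Qed.

End change_of_variable.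

Section coordinatewise.
Context {R : realType}.
Local Notation lam := (@lebesgue_measure R).

Definition boxset n (I : 'I_n -> set R) : set 'rV[R]_n :=
  [set x | forall i, I i (x 0 i)].

Definition coordmap n (phi : 'I_n -> R -> R) (x : 'rV[R]_n) : 'rV[R]_n :=
  \row_i phi i (x 0 i).

Lemma measurable_boxset n (I : 'I_n -> set R) : (forall i, measurable (I i)) ->
  measurable (boxset I).
Proof.
move=> mI; rewrite (_ : boxset I =
    \bigcap_(i in [set: 'I_n]) ((fun x : 'rV[R]_n => x 0 i) @^-1` I i)).
  apply: fin_bigcap_measurable; first exact: finite_finset.
  move=> i _; apply: (@measurable_preimage _ _ _ _ (fun x : 'rV[R]_n => x 0 i : measurableTypeR R)).
    exact: measurable_coord.
  exact: mI.
by apply/seteqP; split => x h i; [move=> _; exact: h|exact: h].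
Qed.

Lemma leb_vcons n (A : set 'rV[R]_n.+1) :
  leb R n.+1 A = (lam \x leb R n)%E (@vcons R n @^-1` A).
Proof. by []. Qed.

Lemma vcons0 n (p : measurableTypeR R * 'rV[R]_n) : vcons p 0 ord0 = p.1.
Proof. by rewrite mxE unlift_none. Qed.

Lemma vconsS n (p : measurableTypeR R * 'rV[R]_n) j :
  vcons p 0 (lift ord0 j) = p.2 0 j.
Proof. by rewrite mxE liftK. Qed.

Lemma leb_boxset n (I : 'I_n -> set R) : (forall i, measurable (I i)) ->
  leb R n (boxset I) = (\prod_(i < n) lam (I i))%E.
Proof.
elim: n I => [|n IH] I mI.
  by rewrite big_ord0 /= diracE mem_set// => -[].
rewrite leb_vcons big_ord_recl -IH; last by move=> i; exact: mI.
rewrite -product_measure1E; [|exact: mI|]; last first.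
  by apply: measurable_boxset => i; exact: mI.
congr (_ _); apply/seteqP; split => [p h|p [h1 h2] i].
  split; first by have := h ord0; rewrite vcons0.
  by move=> i; have := h (lift ord0 i); rewrite vconsS.
by case: (unliftP ord0 i) => [j|] ->; rewrite ?vconsS ?vcons0//; exact: h2.
Qed.

Lemma measurable_coordmap n (phi : 'I_n -> R -> R) :
  (forall i, measurable_fun setT (phi i)) -> measurable_fun setT (coordmap phi).
Proof.
move=> mp; apply: measurable_rowvector => i; under eq_fun do rewrite mxE.
by apply: (measurableT_comp (mp i)); exact: measurable_coord.
Qed.

(** Induction on the dimension: slicing along the first coordinate reduces the claim to
the hypothesis on [phi ord0] and to the induction hypothesis on the slices. *)
Lemma leb_coordmap n (phi : 'I_n -> R -> R) (D : 'I_n -> set R) (c : R) :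
  0 <= c ->
  (forall i, measurable (D i)) -> (forall i, measurable_fun setT (phi i)) ->
  (forall i A, measurable A ->
     lam (D i `&` phi i @^-1` A) = (c%:E * lam (D i `&` A))%E) ->
  forall C, measurable C -> leb R n (boxset D `&` coordmap phi @^-1` C) =
    ((c ^+ n)%:E * leb R n (boxset D `&` C))%E.
Proof.
move=> c0; elim: n phi D => [|n IH] phi D mD mp H C mC.
  rewrite expr0 mul1e; congr (leb R 0 (_ `&` _)); apply/seteqP.
  by split => x; rewrite /preimage/= (_ : coordmap phi x = x)//;
    apply/rowP => -[].
pose phi' i := phi (lift ord0 i); pose D' i := D (lift ord0 i).
pose h (a : R) := leb R n (boxset D' `&` [set y | C (vcons (a, y))]).
have mCC : measurable (@vcons R n @^-1` (boxset D `&` C)).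
  apply: measurable_preimage; first exact: measurable_vcons.
  by apply: measurableI => //; exact: measurable_boxset.
have mC2 : measurable (@vcons R n @^-1` C).
  by apply: measurable_preimage => //; exact: measurable_vcons.
have mh : measurable_fun setT h.
  have mS : measurable ((setT : set (measurableTypeR R)) `*` boxset D' `&` (@vcons R n @^-1` C)).
    apply: measurableI => //; apply: measurableX => //.
    by apply: measurable_boxset => i; exact: mD.
  have := @measurable_fun_xsection _ _ _ _ _ (leb R n) _ mS.
  apply: eq_measurable_fun => a _ /=; congr (leb R n _).
  by apply/seteqP; split => y; rewrite /xsection /= in_setE => -[] //= [].
have pre (F : set 'rV[R]_n.+1) (G : R -> \bar R) : measurable F ->
    (forall a, leb R n (boxset D' `&` [set y | F (vcons (a, y))]) = G a) ->
    leb R n.+1 (boxset D `&` F) = (\int[lam]_(a in D ord0) G a)%E.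
  move=> mF HG; rewrite leb_vcons /product_measure1 [RHS]integral_mkcond.
  apply: eq_integral => a _; rewrite patchE; case: ifPn => Da.
    rewrite -HG; congr (leb R n _); apply/seteqP; split => y /=;
    rewrite /xsection/= in_setE => -[h1 h2]; split => //.
      by move=> i; have := h1 (lift ord0 i); rewrite vconsS.
    move=> i; case: (unliftP ord0 i) => [j|] ->; rewrite ?vconsS ?vcons0//;
    [exact: h1|exact: set_mem].
  rewrite -[RHS](measure0 (leb R n)); congr (leb R n _).
  apply/seteqP; split => y //=; rewrite /xsection/= in_setE => -[h1 h2].
  by have := h1 ord0; rewrite vcons0 => /mem_set; exact/negP.
have Hc a : leb R n (boxset D' `&` [set y | (coordmap phi @^-1` C) (vcons (a, y))])
    = ((c ^+ n)%:E * h (phi ord0 a))%E.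
  rewrite /h -(IH phi' D'); first last.
  - have := @measurable_xsection _ _ _ _ _ (phi ord0 a) mC2.
    by congr (measurable _); apply/seteqP; split => y; rewrite /xsection/= in_setE.
  - by move=> i A mA; exact: H.
  - by move=> i; exact: mp.
  - by move=> i; exact: mD.
  congr (leb R n (_ `&` _)); apply/seteqP.
  have E y : vcons (phi ord0 a, coordmap phi' y) = coordmap phi (vcons (a, y)).
    apply/rowP => i; rewrite [RHS]mxE.
    by case: (unliftP ord0 i) => [j|] ->; rewrite ?vconsS ?vcons0//= mxE.
  by split => y; rewrite /preimage/= E.
have mpre : measurable (coordmap phi @^-1` C).
  by apply: measurable_preimage => //; exact: measurable_coordmap.
rewrite (pre _ _ mpre Hc) (pre _ _ mC (fun _ => erefl)).
have h0 a : (0 <= h a)%E by exact: measure_ge0.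
rewrite ge0_integralZl//; last 2 first.
- by apply: measurable_funTS; apply: (measurableT_comp mh); exact: mp.
- by rewrite lee_fin exprn_ge0.
rewrite exprSr EFinM -muleA; congr (_ * _)%E.
  exact: (@ge0_change_of_variable _ _ _ _ R lam lam (D ord0) (D ord0)
    (phi ord0) c h c0 (mD ord0) (mD ord0) (mp ord0) (H ord0) mh h0).
exact: mD.
Qed.

End coordinatewise.

(** * Rotations and reflections of the circle *)

Section torus_translation.
Context {R : realType}.
Local Notation lam := (@lebesgue_measure R).

Lemma lam_oc (a b : R) :
  lam `]a, b]%classic = (if a < b then b - a else 0)%:E.
Proof. by rewrite lebesgue_measure_itv/= lte_fin; case: ifP. Qed.

(** Both sides are measures that agree on half-open intervals, hence everywhere. *)
Lemma lam_affine (s b : R) (A : set R) : 0 < s -> measurable A ->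
  lam ((fun x => s * x + b) @^-1` A) = ((s^-1)%:E * lam A)%E.
Proof.
move=> s0 mA; set f := fun x => s * x + b.
have mf : measurable_fun setT (f : measurableTypeR R -> measurableTypeR R).
  by apply: measurable_funD => //; exact: measurable_funM.
pose mu : {measure set (measurableTypeR R) -> \bar R} := mscale (NngNum (ltW s0))
  (measure_function_pushforward__canonical__measure_function_Measure lam mf).
have H : forall X, measurable X -> lam X = mu X.
  apply: lebesgue_measure_unique => _ [[u v] _ <-].
  have -> : mu `]u, v]%classic = (s%:E * lam (f @^-1` `]u, v]%classic))%E by [].
  rewrite (_ : _ @^-1` _ = `](u - b) / s, (v - b) / s]%classic); last first.
    apply/seteqP; split => x /=; rewrite !in_itv/=;
    by rewrite ltr_pdivrMr// ler_pdivlMr// mulrC ltrBlDr lerBrDr.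
  rewrite !lam_oc ltr_pM2r ?invr_gt0// ltrD2r -EFinM; congr EFin.
  by rewrite /=; case: ifP => _; rewrite ?mulr0//; field; rewrite gt_eqF.
rewrite (H A mA) (_ : mu A = (s%:E * lam (f @^-1` A))%E)//.
by rewrite muleA -EFinM mulVf ?gt_eqF// mul1e.
Qed.

Lemma lam_translate (b : R) (A : set R) : measurable A ->
  lam ((fun x => x + b) @^-1` A) = lam A.
Proof.
move=> mA; have := lam_affine b (ltr01 : 0 < 1 :> R) mA.
rewrite invr1 mul1e => <-; congr (lam _).
by apply/seteqP; split => x; rewrite /preimage/= mul1r.
Qed.

(** The representative in [-pi, pi[ of a real number modulo 2 pi. *)
Definition wrap (y : R) : R := y - 2 * pi * (Num.floor ((y + pi) / (2 * pi)))%:~R.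

Let pi2 : 0 < 2 * pi :> R.
Proof. by rewrite mulr_gt0// pi_gt0. Qed.

Lemma wrapE (y : R) (k : int) : - pi <= y + 2 * pi * k%:~R < pi ->
  wrap y = y + 2 * pi * k%:~R.
Proof.
move=> /andP[h1 h2]; rewrite /wrap (@floor_def _ _ (- k)).
  by rewrite rmorphN/= mulrN opprK.
rewrite ler_pdivlMr// ltr_pdivrMr// rmorphD rmorphN/=.
by apply/andP; split; lra.
Qed.

Lemma wrap_itv (y : R) : - pi <= wrap y < pi.
Proof.
rewrite /wrap; set k := Num.floor _.
have /andP[] := floor_itv ((y + pi) / (2 * pi)).
rewrite ler_pdivlMr// ltr_pdivrMr// -/k => h1 h2.
by apply/andP; split; lra.
Qed.

Lemma wrap_shift (y : R) (k : int) : wrap (y + 2 * pi * k%:~R) = wrap y.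
Proof.
have := wrap_itv y; rewrite {1 2}/wrap; set m := Num.floor _ => h.
rewrite (@wrapE _ (- m - k)); first by rewrite rmorphB rmorphN/= /wrap -/m; ring.
by rewrite (_ : _ + _ = y - 2 * pi * m%:~R)// rmorphB rmorphN/=; ring.
Qed.

Lemma measurable_wrap : measurable_fun setT (wrap : measurableTypeR R -> measurableTypeR R).
Proof.
apply: measurable_funB => //; apply: measurable_funM => //.
apply: nondecreasing_measurable => // x y xy.
by rewrite ler_int; apply: le_floor; rewrite ler_pM2r ?invr_gt0// lerD2r.
Qed.

Definition cell1 : set R := `[- pi, pi[%classic.

Lemma measurable_cell1 : measurable cell1.
Proof. exact: measurable_itv. Qed.

(** Up to an integer multiple of 2 pi the rotation is by some c in [0, 2 pi[, and it
exchanges two intervals by translations. *)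
Lemma lam_wrapD (b : R) (A : set R) : measurable A ->
  lam (cell1 `&` (fun y => wrap (b + y)) @^-1` A) = lam (cell1 `&` A).
Proof.
move=> mA; pose k := Num.floor (b / (2 * pi)).
pose c := b - 2 * pi * k%:~R.
have /andP[c0 c1] : 0 <= c < 2 * pi.
  have /andP[] := floor_itv (b / (2 * pi)).
  rewrite ler_pdivlMr// ltr_pdivrMr// -/k rmorphD/= => h1 h2.
  by rewrite /c; apply/andP; split; lra.
pose I1 : set R := `[- pi + c, pi[%classic.
pose I2 : set R := `[- pi, - pi + c[%classic.
have mI1 : measurable I1 by exact: measurable_itv.
have mI2 : measurable I2 by exact: measurable_itv.
have wE y : wrap (b + y) = wrap (c + y).
  by rewrite -(wrap_shift (c + y) k); congr wrap; rewrite /c; ring.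
have -> : cell1 `&` (fun y => wrap (b + y)) @^-1` A =
    ((fun y => y + c) @^-1` (I1 `&` A)) `|`
    ((fun y => y + (c - 2 * pi)) @^-1` (I2 `&` A)).
  apply/seteqP; split => y.
    rewrite /cell1/I1/I2/preimage/= !in_itv/= wE => -[/andP[y1 y2] yA].
    have [h|h] := ltP (y + c) pi.
      left; split; first by apply/andP; split; lra.
      by move: yA; rewrite (@wrapE _ 0) mulr0 addr0 addrC//; apply/andP; split; lra.
    right; split; first by apply/andP; split; lra.
    move: yA; rewrite (@wrapE _ (-1)).
      by congr (A _); rewrite rmorphN/=; ring.
    by rewrite rmorphN/=; apply/andP; split; lra.
  rewrite /cell1/I1/I2/preimage/= !in_itv/= wE.
  move=> [[/andP[y1 y2] yA]|[/andP[y1 y2] yA]]; split.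
  - by apply/andP; split; lra.
  - by rewrite (@wrapE _ 0) mulr0 addr0 addrC//; apply/andP; split; lra.
  - by apply/andP; split; lra.
  - rewrite (@wrapE _ (-1)).
      by move: yA; congr (A _); rewrite rmorphN/=; ring.
    by rewrite rmorphN/=; apply/andP; split; lra.
have mIA1 : measurable (I1 `&` A) by exact: measurableI.
have mIA2 : measurable (I2 `&` A) by exact: measurableI.
have mt (d : R) (B : set R) : measurable B -> measurable ((fun y => y + d) @^-1` B).
  move=> mB; apply: (@measurable_preimage _ _ (measurableTypeR R) (measurableTypeR R) (fun y => y + d)) => //.
  exact: measurable_funD.
rewrite measureU; [|exact: mt|exact: mt|]; last first.
  apply/seteqP; split => y //; rewrite /I1/I2/preimage/= !in_itv/=.
  by move=> [[/andP[y1 y2] _] [/andP[y3 y4] _]]; lra.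
transitivity (lam (I1 `&` A) + lam (I2 `&` A))%E.
  by congr (_ + _)%E; exact: lam_translate.
rewrite -measureU//; last first.
  apply/seteqP; split => y //; rewrite /I1/I2/preimage/= !in_itv/=.
  by move=> [[/andP[y1 y2] _] [/andP[y3 y4] _]]; lra.
congr (lam _); rewrite -setIUl; congr (_ `&` _).
rewrite /I1/I2/cell1; apply/seteqP; split => y; rewrite /= !in_itv/=.
  by move=> [/andP[y1 y2]|/andP[y1 y2]]; apply/andP; split; lra.
move=> /andP[y1 y2]; have [h|h] := ltP y (- pi + c); [right|left];
  by apply/andP; split; lra.
Qed.

(** A rotation composed with the reflection y -> - y; the reflection preserves the
cell except for its two end points, a null set. *)
Lemma lam_wrapB (b : R) (A : set R) : measurable A ->
  lam (cell1 `&` (fun y => wrap (b - y)) @^-1` A) = lam (cell1 `&` A).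
Proof.
move=> mA.
have mW : measurable ((fun y => wrap (b + y)) @^-1` A).
  apply: (@measurable_preimage _ _ (measurableTypeR R) (measurableTypeR R) (fun y => wrap (b + y))) => //.
  by apply: (measurableT_comp measurable_wrap); exact: measurable_funD.
rewrite -(lam_wrapD b mA).
pose B := `]- pi, pi]%classic `&` (fun y => wrap (b + y)) @^-1` A.
have mB : measurable B by apply: measurableI => //; exact: measurable_itv.
transitivity (lam B).
  rewrite -(lebesgue_measureN mB) /pushforward; congr (lam _).
  apply/seteqP; split => y; rewrite /cell1/B/preimage/= !in_itv/= => -[/andP[y1 y2] yA];
    by split => //; apply/andP; split; lra.
pose W := (fun y => wrap (b + y)) @^-1` A.
pose O : set R := `]- pi, pi[%classic `&` W.
have mO : measurable O by apply: measurableI => //; exact: measurable_itv.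
have add a : lam (O `|` ([set a] `&` W)) = lam O.
  have ma : measurable ([set a] `&` W) by exact: measurableI.
  rewrite measureU0//; apply/eqP; rewrite eq_le measure_ge0 andbT.
  rewrite -(lebesgue_measure_set1 a); apply: le_measure; rewrite ?inE//.
transitivity (lam O).
  rewrite -(add pi); congr (lam _); rewrite -setIUl; congr (_ `&` _).
  apply/seteqP; split => y; rewrite /= !in_itv/=.
    move=> /andP[y1 y2]; have [h|h] := ltP (y : R) pi; first by left; apply/andP; split.
    by right; apply/eqP; rewrite eq_le; apply/andP; split.
  move=> [/andP[y1 y2]|->]; first by rewrite y1 ltW.
  by rewrite lexx andbT; have := pi_gt0 R; lra.
rewrite -(add (- pi)); congr (lam _); rewrite -setIUl; congr (_ `&` _).
rewrite /cell1; apply/seteqP; split => y; rewrite /= !in_itv/=.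
  move=> [/andP[y1 y2]|->]; first by rewrite ltW.
  by rewrite lexx/=; have := pi_gt0 R; lra.
move=> /andP[y1 y2]; have [h|h] := ltP (- pi) (y : R); first by left; apply/andP; split.
by right; apply/eqP; rewrite eq_le; apply/andP; split.
Qed.

End torus_translation.

(** * Integrals over the torus *)

(** The measurable sets are generated by the coordinates, so openness says nothing about
them directly: the function is a pointwise limit of its compositions with the
rounding to a grid of mesh 1 / (j + 1), each of which takes countably many values on
boxes. *)
Lemma measurable_continuous (R : realType) n (f : 'rV[R]_n -> R) :
  continuous f -> measurable_fun setT f.
Proof.
move=> cf.
pose p (j : nat) (x : 'rV[R]_n) : {ffun 'I_n -> int} :=
  [ffun i => Num.floor (j.+1%:R * x 0 i)].
pose q (j : nat) (k : {ffun 'I_n -> int}) : 'rV[R]_n :=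
  \row_i ((k i)%:~R / j.+1%:R).
apply: (@measurable_fun_cvg _ _ _ _ (fun j x => f (q j (p j x)))) => [j|x _].
  move=> _ Y mY; rewrite setTI.
  rewrite (_ : _ @^-1` _ = \bigcup_(k in [set k | Y (f (q j k))])
      boxset (fun i => (fun r : R => Num.floor (j.+1%:R * r)) @^-1` [set k i])).
    pose B k := boxset (fun i : 'I_n =>
      (fun r : R => Num.floor (j.+1%:R * r)) @^-1` [set k i]).
    rewrite (_ : bigcup _ _ = \bigcup_m (if @unpickle {ffun 'I_n -> int} m is Some k
        then (if `[< Y (f (q j k)) >] then B k else set0) else set0)); last first.
      apply/seteqP; split => [x [k /= Yk Bk]|x [m _]].
        by exists (pickle k) => //; rewrite pickleK; case: asboolP.
      by case: unpickle => // k; case: asboolP => // Yk Bk; exists k.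
    apply: bigcup_measurable => m _; case: unpickle => // k; case: asboolP => // _.
    apply: measurable_boxset => i.
    rewrite (_ : _ @^-1` _ = `[(k i)%:~R / j.+1%:R, ((k i) + 1)%:~R / j.+1%:R[%classic).
      exact: measurable_itv.
    apply/seteqP; split => r /=; rewrite in_itv/= ler_pdivrMr// ltr_pdivlMr// mulrC.
      by move=> <-; exact: floor_itv.
    exact: floor_def.
  apply/seteqP; split => x /=.
    by move=> Yx; exists (p j x) => // i; rewrite /preimage/= ffunE.
  move=> [k /= Yk h]; rewrite (_ : p j x = k)//.
  by apply/ffunP => i; rewrite ffunE; exact: h.
suff H : (fun j => q j (p j x)) @ \oo --> (x : 'rV[R]_n) by exact: cvg_comp H (cf x).
apply/cvg_ballP => e e0; near=> j.
split => // a b; rewrite [a]ord1 mxE ffunE /ball/= /ball_/=.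
set k := Num.floor _; have /andP[k1 k2] := floor_itv (j.+1%:R * x 0 b).
rewrite -/k rmorphD/= in k1 k2.
have j0 : 0 < j.+1%:R :> R by [].
have je : j.+1%:R^-1 < e by near: j; exact: (near_infty_natSinv_lt (PosNum e0)).
apply: lt_trans je; rewrite -[x 0 b](mulKf (lt0r_neq0 j0)) [_^-1 * _]mulrC -mulrBl.
rewrite normrM [X in _ * X]ger0_norm ?invr_ge0 ?ltW//.
rewrite -[ltRHS]mul1r ltr_pM2r ?invr_gt0//.
by rewrite ger0_norm; lra.
Unshelve. all: by end_near.
Qed.

Section torus_integral.
Context {R : realType} {n : nat}.
Local Notation lebn := (leb R n).
Local Notation V := 'rV[R]_n.

Lemma cellE : @cell R n = boxset (fun _ => cell1).
Proof. by []. Qed.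

Lemma cell_repE : @cell_rep R n = coordmap (fun _ => wrap).
Proof. by []. Qed.

Lemma measurable_cell : measurable (@cell R n).
Proof. by rewrite cellE; apply: measurable_boxset => i; exact: measurable_cell1. Qed.

Lemma leb_cell : lebn cell = ((2 * pi) ^+ n)%:E.
Proof.
rewrite cellE leb_boxset; last by move=> i; exact: measurable_cell1.
rewrite (eq_bigr (fun=> (2 * pi)%:E)) => [|i _].
  by rewrite prodEFin prodr_const card_ord.
rewrite /cell1 lebesgue_measure_itv/= lte_fin ifT; last by have := pi_gt0 R; lra.
by rewrite -EFinB; congr EFin; ring.
Qed.

Lemma leb_cell_lty : (lebn cell < +oo)%E.
Proof. by rewrite leb_cell ltry. Qed.

Lemma cell_rep_cell (x : V) : cell (cell_rep x).
Proof. by move=> i; rewrite mxE in_itv/=; exact: wrap_itv. Qed.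

Lemma cell_rep_id (x : V) : cell x -> cell_rep x = x.
Proof.
move=> cx; rewrite cell_repE; apply/rowP => i; rewrite mxE.
rewrite (@wrapE _ _ 0) ?mulr0 ?addr0//.
by have := cx i; rewrite in_itv.
Qed.

Lemma measurable_cell_rep : measurable_fun setT (@cell_rep R n).
Proof. by rewrite cell_repE; apply: measurable_coordmap => i; exact: measurable_wrap. Qed.

Lemma periodic_lattice (u : V -> R) (k : 'I_n -> int) : torus_periodic u ->
  forall x, u (x + \row_i (2 * pi * (k i)%:~R)) = u x.
Proof.
move=> pu.
have pn i (m : nat) z : u (z + (2 * pi * m%:R) *: delta_mx 0 i) = u z.
  elim: m z => [|m IH] z; first by rewrite mulr0 scale0r addr0.
  by rewrite -(natr1 m) mulrDr mulr1 scalerDl addrA pu IH.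
have pk i (m : int) z : u (z + (2 * pi * m%:~R) *: delta_mx 0 i) = u z.
  case: m => m; first exact: pn.
  rewrite -[LHS](pn i m.+1) -addrA -scalerDl NegzE rmorphN/=.
  by rewrite mulrN addNr scale0r addr0.
rewrite (row_sum_delta (\row_i _)).
apply: (big_ind (fun v => forall x, u (x + v) = u x)) => [x|v w hv hw x|i _ x].
- by rewrite addr0.
- by rewrite addrA hw hv.
- by rewrite mxE pk.
Qed.

Lemma periodic_cell_rep (u : V -> R) : torus_periodic u ->
  forall x, u (cell_rep x) = u x.
Proof.
move=> pu x.
rewrite -[RHS](@periodic_lattice _ (fun i => - Num.floor ((x 0 i + pi) / (2 * pi))) pu).
by congr u; apply/rowP => i; rewrite !mxE rmorphN/= mulrN.
Qed.

(** The hypothesis on [phi] says that each coordinate preserves the measure of the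
circle. *)
Lemma ge0_integral_torus (phi : 'I_n -> R -> R) (F : V -> \bar R) :
  (forall i, measurable_fun setT (phi i)) ->
  (forall i A, measurable A ->
    lebesgue_measure (cell1 `&` (fun y => wrap (phi i y)) @^-1` A) =
    lebesgue_measure (cell1 `&` A)) ->
  measurable_fun setT F -> (forall y, 0 <= F y)%E ->
  (forall y, F (cell_rep y) = F y) ->
  (\int[lebn]_(y in cell) F (coordmap phi y) = \int[lebn]_(y in cell) F y)%E.
Proof.
move=> mphi H mF F0 pF.
have mw : forall i, measurable_fun setT (wrap \o phi i : R -> R).
  by move=> i; exact: (measurableT_comp measurable_wrap (mphi i)).
have mc := measurable_cell.
transitivity (\int[lebn]_(y in cell) F (coordmap (fun i => wrap \o phi i) y))%E.
  apply: eq_integral => y _; rewrite -pF cell_repE; congr F.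
  by apply/rowP => i; rewrite !mxE.
rewrite -[RHS]mul1e.
apply: (@ge0_change_of_variable _ _ _ _ _ lebn lebn) => //.
  exact: measurable_coordmap.
move=> A mA; rewrite cellE.
have := @leb_coordmap R n (fun i => wrap \o phi i) (fun=> cell1) 1 ler01.
rewrite expr1n; apply => //.
- by move=> i; exact: measurable_cell1.
- by move=> i B mB; rewrite mul1e; exact: H.
Qed.

Lemma integral_torus (phi : 'I_n -> R -> R) (F : V -> R) :
  (forall i, measurable_fun setT (phi i)) ->
  (forall i A, measurable A ->
    lebesgue_measure (cell1 `&` (fun y => wrap (phi i y)) @^-1` A) =
    lebesgue_measure (cell1 `&` A)) ->
  measurable_fun setT F -> (forall y, F (cell_rep y) = F y) ->
  \int[lebn]_(y in cell) F (coordmap phi y) = \int[lebn]_(y in cell) F y.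
Proof.
move=> mphi H mF pF; congr fine.
have mEF : measurable_fun [set: V] (EFin \o F) by exact/measurable_EFinP.
rewrite integralE [RHS]integralE; congr (_ - _)%E.
  rewrite -[X in (\int[_]_(x in _) X^\+ x)%E]/((EFin \o F) \o coordmap phi) funepos_comp.
  apply: (@ge0_integral_torus phi ((EFin \o F)^\+)%E) => //; first exact: measurable_funepos.
  by move=> y; rewrite !funeposE /= pF.
rewrite -[X in (\int[_]_(x in _) X^\- x)%E]/((EFin \o F) \o coordmap phi) funeneg_comp.
apply: (@ge0_integral_torus phi ((EFin \o F)^\-)%E) => //; first exact: measurable_funeneg.
by move=> y; rewrite !funenegE /= pF.
Qed.

Lemma integral_torusD (b : V) (F : V -> R) :
  measurable_fun setT F -> torus_periodic F ->
  \int[lebn]_(y in cell) F (y + b) = \int[lebn]_(y in cell) F y.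
Proof.
move=> mF /periodic_cell_rep pF.
rewrite -(@integral_torus (fun i y => b 0 i + y) F)//.
- by apply: eq_Rintegral => y _; congr F; apply/rowP => i; rewrite !mxE addrC.
- by move=> i; exact: measurable_funD.
- by move=> i A mA; exact: lam_wrapD.
Qed.

Lemma integral_torusB (b : V) (F : V -> R) :
  measurable_fun setT F -> torus_periodic F ->
  \int[lebn]_(y in cell) F (b - y) = \int[lebn]_(y in cell) F y.
Proof.
move=> mF /periodic_cell_rep pF.
rewrite -(@integral_torus (fun i y => b 0 i - y) F)//.
- by apply: eq_Rintegral => y _; congr F; apply/rowP => i; rewrite !mxE.
- by move=> i; exact: measurable_funB.
- by move=> i A mA; exact: lam_wrapB.
Qed.

Lemma ge0_integral_scale (s : R) (F : V -> \bar R) : 0 < s ->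
  measurable_fun setT F -> (forall y, 0 <= F y)%E ->
  (\int[lebn]_x F (s *: x) = ((s^-1) ^+ n)%:E * \int[lebn]_y F y)%E.
Proof.
move=> s0 mF F0.
rewrite (_ : (fun x => F (s *: x)) = (fun x => F (coordmap (fun _ y => s * y + 0) x))); last first.
  by apply/funext => x; congr F; apply/rowP => i; rewrite !mxE addr0.
have ms : forall i : 'I_n, measurable_fun setT (fun y : R => s * y + 0).
  by move=> i; apply: measurable_funD => //; exact: measurable_funM.
have s0' : 0 <= s^-1 by rewrite invr_ge0 ltW.
apply: (@ge0_change_of_variable _ _ _ _ _ lebn lebn) => //.
- by rewrite exprn_ge0.
- exact: measurable_coordmap.
- move=> A mA.
  have := @leb_coordmap R n (fun=> (fun y => s * y + 0)) (fun=> setT) _ s0'.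
  rewrite (_ : boxset _ = setT); last by apply/seteqP; split.
  apply => // i B mB; rewrite !setTI; exact: lam_affine.
Qed.

End torus_integral.

(** * Integrable and square integrable functions on the torus *)

Section cell_integrals.
Context {R : realType} {n : nat}.
Local Notation T := 'rV[R]_n.
Local Notation mu := (leb R n).
Local Notation D := (@cell R n).
Let mD : measurable D := measurable_cell.
Let fD : (mu D < +oo)%E := leb_cell_lty.

Definition cell_integrable (f : T -> R) := mu.-integrable D (EFin \o f).
Implicit Types f g : T -> R.
Local Notation II f := (\int[mu]_(x in D) f x).

Definition square_integrable (f : T -> R) :=
  measurable_fun setT f /\ cell_integrable (fun x => f x ^+ 2).

Definition bounded_measurable (f : T -> R) :=
  measurable_fun setT f /\ exists B, forall x, `|f x| <= B.

Lemma ic_bnd f : bounded_measurable f -> cell_integrable f.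
Proof.
move=> [mf [B hB]]; apply: measurable_bounded_integrable => //.
  exact: measurable_funTS.
by exists B; split; [exact: num_real|move=> M BM x Dx; rewrite /= (le_trans (hB x))// ltW].
Qed.

Lemma ic_ext f g : {in D, f =1 g} -> cell_integrable f -> cell_integrable g.
Proof. by move=> fg; apply: eq_integrable => // x xD /=; rewrite fg. Qed.

Lemma icD f g : cell_integrable f -> cell_integrable g -> cell_integrable (fun x => f x + g x).
Proof. by move=> cf cg; have := integrableD mD cf cg; exact: eq_integrable. Qed.

Lemma icB f g : cell_integrable f -> cell_integrable g -> cell_integrable (fun x => f x - g x).
Proof. by move=> cf cg; have := integrableB mD cf cg; exact: eq_integrable. Qed.

Lemma icZ c f : cell_integrable f -> cell_integrable (fun x => c * f x).
Proof. by move=> cf; have := integrableZl mD c cf; exact: eq_integrable. Qed.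

Lemma ic_sum I (s : seq I) (f : I -> T -> R) : (forall i, cell_integrable (f i)) ->
  cell_integrable (fun x => \sum_(i <- s) f i x).
Proof.
move=> cf; elim: s => [|i s IH].
  by apply: (ic_ext (f := fun=> 0)); [move=> x _; rewrite big_nil|exact: integrable0].
by apply: (ic_ext (f := fun x => f i x + \sum_(i <- s) f i x));
  [move=> x _; rewrite big_cons|exact: icD].
Qed.

Lemma ic_le f g : measurable_fun setT f -> cell_integrable g -> (forall x, D x -> `|f x| <= g x) -> cell_integrable f.
Proof.
move=> mf cg fg; apply: (le_integrable mD _ _ cg).
  by apply/measurable_EFinP; exact: measurable_funTS.
move=> x Dx; rewrite /= lee_fin (le_trans (fg _ Dx))// ler_norm//.
Qed.

Lemma sqi_ic f g : square_integrable f -> square_integrable g -> cell_integrable (fun x => f x * g x).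
Proof.
move=> [mf cf] [mg cg]; apply: (ic_le _ (icD cf cg)); first exact: measurable_funM.
by move=> x _; rewrite ler_norml; apply/andP; split; nra.
Qed.

Lemma sqi_bnd f : bounded_measurable f -> square_integrable f.
Proof.
move=> [mf [B hB]]; split => //; apply: ic_bnd; split; first exact: measurable_funX.
exists (B ^+ 2) => x; rewrite normrX; apply: lerXn2r => //; rewrite ?nnegrE//.
exact: le_trans (hB x).
Qed.

Lemma sqiZ c f : square_integrable f -> square_integrable (fun x => c * f x).
Proof.
move=> [mf cf]; split; first exact: measurable_funM.
by apply: ic_ext (icZ (c ^+ 2) cf) => x _; rewrite exprMn.
Qed.

Lemma sqiD f g : square_integrable f -> square_integrable g -> square_integrable (fun x => f x + g x).
Proof.
move=> [mf cf] [mg cg]; split; first exact: measurable_funD.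
apply: (ic_le _ (icZ 2 (icD cf cg))); first by apply: measurable_funX; exact: measurable_funD.
by move=> x _; rewrite ger0_norm ?sqr_ge0//; have := sqr_ge0 (f x - g x); nra.
Qed.

Lemma sqiB f g : square_integrable f -> square_integrable g -> square_integrable (fun x => f x - g x).
Proof.
move=> sf sg; have := sqiD sf (sqiZ (-1) sg).
by rewrite (_ : (fun x => f x + -1 * g x) = (fun x => f x - g x))//;
  apply/funext => x; rewrite mulN1r.
Qed.

Lemma sqi_shift (b : T) f : torus_periodic f -> square_integrable f -> square_integrable (fun x => f (x + b)).
Proof.
move=> pf [mf cf].
have ms : measurable_fun setT (fun x : T => x + b).
  apply: measurable_rowvector => i; under eq_fun do rewrite mxE.
  by apply: measurable_funD => //; exact: measurable_coord.
split; first exact: measurableT_comp.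
apply/integrableP; split.
  by apply/measurable_EFinP; apply: measurable_funTS; apply: measurable_funX; exact: measurableT_comp.
move/integrableP : cf => [_]; apply: le_lt_trans; rewrite le_eqVlt; apply/orP; left; apply/eqP.
have := @ge0_integral_torus R n (fun i y => b 0 i + y) (fun x => (`|f x ^+ 2|)%:E).
move=> <- //.
- by apply: eq_integral => x _ /=; congr ((`|f _ ^+ 2|)%:E); apply/rowP => i; rewrite !mxE addrC.
- by move=> i; exact: measurable_funD.
- by move=> i A mA; exact: lam_wrapD.
- by apply/measurable_EFinP; apply: measurableT_comp => //; exact: measurable_funX.
- by move=> y; rewrite periodic_cell_rep.
Qed.

Lemma sqi_measurable f : square_integrable f -> measurable_fun setT f.
Proof. by case. Qed.

Lemma sqi_sum I (s : seq I) (f : I -> T -> R) : (forall i, square_integrable (f i)) ->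
  square_integrable (fun x => \sum_(i <- s) f i x).
Proof.
move=> cf; elim: s => [|i s IH].
  rewrite (_ : (fun=> _) = fun=> 0); last by apply/funext => x; rewrite big_nil.
  by apply: sqi_bnd; split => //; exists 0 => x; rewrite normr0.
rewrite (_ : (fun=> _) = fun x => f i x + \sum_(i <- s) f i x); first exact: sqiD.
by apply/funext => x; rewrite big_cons.
Qed.

Lemma IID f g : cell_integrable f -> cell_integrable g -> II (fun x => f x + g x) = II f + II g.
Proof. exact: RintegralD. Qed.

Lemma IIB f g : cell_integrable f -> cell_integrable g -> II (fun x => f x - g x) = II f - II g.
Proof. exact: RintegralB. Qed.

Lemma IIZ c f : cell_integrable f -> II (fun x => c * f x) = c * II f.
Proof. exact: RintegralZl. Qed.

Lemma II_sum I (s : seq I) (f : I -> T -> R) : (forall i, cell_integrable (f i)) ->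
  II (fun x => \sum_(i <- s) f i x) = \sum_(i <- s) II (f i).
Proof.
move=> cf; elim: s => [|i s IH].
  rewrite (_ : (fun=> _) = fun=> 0); last by apply/funext => x; rewrite big_nil.
  by rewrite big_nil Rintegral_cst// mul0r.
rewrite big_cons -IH -IID//; last exact: ic_sum.
by apply: eq_Rintegral => x _; rewrite big_cons.
Qed.

Lemma II_le f g : cell_integrable f -> cell_integrable g -> (forall x, D x -> f x <= g x) -> II f <= II g.
Proof. exact: le_Rintegral. Qed.

Lemma II_ge0 f : (forall x, D x -> 0 <= f x) -> 0 <= II f.
Proof. exact: Rintegral_ge0. Qed.

Lemma II_dct (f : nat -> T -> R) (g : T -> R) :
  (forall j, measurable_fun setT (f j)) -> cell_integrable g ->
  (forall j x, D x -> `|f j x| <= g x) ->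
  (forall x, D x -> (f ^~ x) @ \oo --> 0) ->
  (fun j => II (f j)) @ \oo --> 0.
Proof.
move=> mf cg fg f0.
have [||||_ _ h] := @dominated_convergence _ _ _ mu D mD (fun j => EFin \o f j)
  (fun=> 0%E) (EFin \o g) _ _ _ cg.
- by move=> j; apply/measurable_EFinP; exact: measurable_funTS.
- by [].
- by apply: aeW => x Dx; apply: cvg_EFin; [exact: nearW|exact: f0].
- by apply: aeW => x j Dx; rewrite lee_fin fg.
rewrite integral0 in h; move/fine_cvgP : h => [_]; exact.
Qed.

End cell_integrals.

(** * Real phases cos (k.x + t) *)

(** Stated for filters on an arbitrary type, so that it serves for sequences as well as for
continuity. *)
Lemma cvg_bigsum (R : realType) (T I : Type) (F : set_system T) {FF : Filter F}
    (s : seq I) (f : I -> T -> R) (l : I -> R) :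
  (forall i, f i @ F --> l i) ->
  (fun x => \sum_(i <- s) f i x) @ F --> \sum_(i <- s) l i.
Proof.
move=> fl; elim: s => [|i s IH].
  under eq_fun do rewrite big_nil.
  by rewrite big_nil; exact: cvg_cst.
under eq_fun do rewrite big_cons.
by rewrite big_cons; apply: cvgD.
Qed.

Section phases.
Context {R : realType} {n : nat}.
Local Notation V := 'rV[R]_n.
Local Notation lattice := {ffun 'I_n -> int}.
Implicit Types (k l : lattice) (x y : V) (t : R).

Definition lattice_dot k x : R := \sum_i (k i)%:~R * x 0 i.

(** Working with real cosines of all phases [t] avoids complex numbers: sines are the
phase - pi / 2, and translating the variable amounts to changing the phase. *)
Definition phase k t x : R := cos (lattice_dot k x + t).

Lemma ldotDl k l x : lattice_dot (k + l) x = lattice_dot k x + lattice_dot l x.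
Proof.
rewrite /lattice_dot -big_split; apply: eq_bigr => i _ /=.
by rewrite ffunE rmorphD mulrDl.
Qed.

Lemma ldotNl k x : lattice_dot (- k) x = - lattice_dot k x.
Proof.
rewrite /lattice_dot -sumrN; apply: eq_bigr => i _ /=.
by rewrite ffunE rmorphN mulNr.
Qed.

Lemma ldotDr k x y : lattice_dot k (x + y) = lattice_dot k x + lattice_dot k y.
Proof.
by rewrite /lattice_dot -big_split; apply: eq_bigr => i _ /=; rewrite mxE mulrDr.
Qed.

Lemma ldotZr k t x : lattice_dot k (t *: x) = t * lattice_dot k x.
Proof. by rewrite /lattice_dot mulr_sumr; apply: eq_bigr => i _; rewrite mxE mulrCA. Qed.

Lemma ldotNr k x : lattice_dot k (- x) = - lattice_dot k x.
Proof. by rewrite -scaleN1r ldotZr mulN1r. Qed.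

Lemma ldot_delta k i : lattice_dot k (delta_mx 0 i) = (k i)%:~R.
Proof.
rewrite /lattice_dot (bigD1 i)//= mxE !eqxx mulr1 big1 ?addr0// => j /negPf ji.
by rewrite mxE ji andbF mulr0.
Qed.

Lemma phD k t x y : phase k t (x + y) = phase k (t + lattice_dot k y) x.
Proof. by rewrite /phase ldotDr -addrA (addrC (lattice_dot k y)). Qed.

Lemma ph_opp k t x : phase (- k) t x = phase k (- t) x.
Proof. by rewrite /phase ldotNl -cosN opprD opprK. Qed.

Lemma ph_split k t x : phase k t x = cos t * phase k 0 x + sin t * phase k (pi / 2) x.
Proof. by rewrite /phase addr0 cosDpihalf cosD; ring. Qed.

Lemma ph_mul k l s t x : phase k s x * phase l t x =
  2^-1 * (phase (k - l) (s - t) x + phase (k + l) (s + t) x).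
Proof.
rewrite /phase !ldotDl ldotNl.
rewrite (_ : lattice_dot k x - lattice_dot l x + (s - t) = (lattice_dot k x + s) - (lattice_dot l x + t)); last by ring.
rewrite (_ : lattice_dot k x + lattice_dot l x + (s + t) = (lattice_dot k x + s) + (lattice_dot l x + t)); last by ring.
set a := lattice_dot k x + s; set b := lattice_dot l x + t.
by rewrite (cosD a (- b)) (cosD a b) cosN sinN; field.
Qed.

Lemma ph_le1 k t x : `|phase k t x| <= 1.
Proof. by rewrite ler_norml cos_le1 cos_geN1. Qed.

Lemma measurable_ph k t : measurable_fun setT (phase k t).
Proof.
apply: (measurableT_comp (continuous_measurable_fun (@continuous_cos R))).
apply: measurable_funD => //.
rewrite /lattice_dot; apply: measurable_sum => i; apply: measurable_funM => //.
exact: measurable_coord.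
Qed.

Lemma bndd_ph k t : bounded_measurable (phase k t).
Proof. by split; [exact: measurable_ph|exists 1 => x; exact: ph_le1]. Qed.

Lemma cosD2pi_int (a : R) (m : int) : cos (a + 2 * pi * m%:~R) = cos a.
Proof.
have H (p : nat) (b : R) : cos (b + 2 * pi * p%:R) = cos b.
  by rewrite -(periodicn (@cosD2pi R) p b); congr (cos (_ + _)); rewrite -mulr_natr -(mulr_natr _ 2); ring.
case: m => p; first exact: H.
rewrite NegzE -[LHS](H p.+1); congr cos.
by rewrite rmorphN/= -!pmulrn; ring.
Qed.

Lemma ph_periodic k t : torus_periodic (phase k t).
Proof.
move=> x i; rewrite phD ldotZr ldot_delta /phase addrA cosD2pi_int//.
Qed.

Lemma is_derive_ph k t i x :
  is_derive x (delta_mx 0 i : V) (phase k t) ((k i)%:~R * phase k (t + pi / 2) x).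
Proof.
pose G (h : R) := cos ((lattice_dot k x + t) + (k i)%:~R * h).
have dG : is_derive (0 : R) 1 G ((k i)%:~R * phase k (t + pi / 2) x).
  have h1 : is_derive (0 : R) 1 (fun h => (lattice_dot k x + t) + (k i)%:~R * h) ((k i)%:~R).
    by apply: is_derive_eq; rewrite ?add0r ?scaler1 ?scaler0; exact: mul1r.
  rewrite /G; apply: is_derive_eq; rewrite mulr0 addr0 /phase addrA cosDpihalf.
  by rewrite mulrC.
have E : (fun h : R => h^-1 *: ((phase k t \o shift x) (h *: delta_mx 0 i) - phase k t x))
   = (fun h : R => h^-1 *: ((G \o shift 0) (h *: 1) - G 0)).
  apply/funext => h /=; congr (_ *: (_ - _)).
    rewrite /phase /G; congr cos; rewrite ldotDr ldotZr ldot_delta /shift/= addr0 [h *: 1]mulr1; ring.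
  by rewrite /G mulr0 addr0.
case: dG => dG eG; split; first by rewrite /derivable E.
by rewrite -eG /derive E.
Qed.

Lemma pderiv_ph k t i c : pderiv i (fun x => c * phase k t x) =
  fun x => (c * (k i)%:~R) * phase k (t + pi / 2) x.
Proof.
apply/funext => x; rewrite /pderiv.
have d := is_derive_ph k t i x.
have := @is_deriveZ R V _ (phase k t) c x (delta_mx 0 i) _ d.
by move=> [_]; rewrite /= => ->; rewrite -[LHS]/(c * _) mulrA.
Qed.

Lemma derivable_ph k t i c x : derivable (fun x => c * phase k t x) x (delta_mx 0 i : V).
Proof.
have d := is_derive_ph k t i x.
by case: (@is_deriveZ R V _ (phase k t) c x (delta_mx 0 i) _ d).
Qed.

Lemma continuous_ldot k : continuous (lattice_dot k).
Proof.
move=> x.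
apply: (@cvg_bigsum R V 'I_n (nbhs (x : V)) _ _
  (fun i y => (k i)%:~R * y 0 i) (fun i => (k i)%:~R * (x : V) 0 i)) => i.
apply: (@cvgM _ V (nbhs (x : V)) _ (fun=> (k i)%:~R) (fun y => y 0 i)).
  exact: cvg_cst.
exact: coord_continuous.
Qed.

Lemma continuous_ph k t : continuous (phase k t).
Proof.
move=> x; apply: (@continuous_comp _ _ _ (fun x => lattice_dot k x + t) cos); last exact: continuous_cos.
apply: (@cvgD _ _ V (nbhs (x : V)) _ (lattice_dot k) (fun=> t)).
  exact: continuous_ldot.
exact: cvg_cst.
Qed.

Lemma foldr_pderiv_ph (s : seq 'I_n) k t : exists c t',
  foldr pderiv (phase k t) s = fun x => c * phase k t' x.
Proof.
elim: s => [|i s [c [t' IH]]].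
  by exists 1, t; apply/funext => x; rewrite mul1r.
by exists (c * (k i)%:~R), (t' + pi / 2); rewrite /= IH pderiv_ph.
Qed.

Lemma test_torus_ph k t : test_torus (phase k t).
Proof.
split; last exact: ph_periodic.
move=> s /=; have [c [t' ->]] := foldr_pderiv_ph s k t; split.
  move=> x; apply: (@cvgM _ V (nbhs (x : V)) _ (fun=> c) (phase k t')).
    exact: cvg_cst.
  exact: continuous_ph.
by move=> i x; exact: derivable_ph.
Qed.

Lemma mderiv_ph (a : 'I_n -> nat) k t : mderiv a (phase k t) =
  fun x => (\prod_i (k i)%:~R ^+ a i) * phase k (t + (\sum_i a i)%:R * (pi / 2)) x.
Proof.
have iterE i m c u : iter m (pderiv i) (fun x => c * phase k u x) =
    fun x => (c * (k i)%:~R ^+ m) * phase k (u + m%:R * (pi / 2)) x.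
  elim: m => [|m IH] /=; first by rewrite expr0 mulr1 mul0r addr0.
  rewrite IH pderiv_ph; apply/funext => x.
  rewrite exprSr -(natr1 m) -!mulrA; congr (_ * (_ * (_ * phase _ _ _))).
  by ring.
have E s : foldr (fun i => iter (a i) (pderiv i)) (phase k t) s =
    fun x => (\prod_(i <- s) (k i)%:~R ^+ a i) *
      phase k (t + (\sum_(i <- s) a i)%:R * (pi / 2)) x.
  elim: s => [|i s IH] /=.
    by rewrite !big_nil mul0r addr0; apply/funext => x; rewrite mul1r.
  rewrite IH iterE; apply/funext => x; rewrite !big_cons natrD.
  congr (_ * phase _ _ _); first by rewrite mulrC.
  by ring.
by rewrite /mderiv E !big_enum.
Qed.

End phases.

(** * Fourier coefficients and partial sums *)

Section fourier.
Context {R : realType} {n : nat}.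
Local Notation V := 'rV[R]_n.
Local Notation lattice := {ffun 'I_n -> int}.
Implicit Types (k l : lattice) (x y z : V) (t : R) (v w p q : V -> R).
Local Notation II f := (\int[leb R n]_(x in cell) f x).

Definition torus_volume : R := (2 * pi) ^+ n.

Lemma vol_gt0 : 0 < torus_volume.
Proof. by rewrite exprn_gt0// mulr_gt0// pi_gt0. Qed.

Lemma sqi_ph k t : square_integrable (phase k t : V -> R).
Proof. exact/sqi_bnd/bndd_ph. Qed.

Lemma II_cst t : II (fun=> t) = t * torus_volume.
Proof.
have [mc lc] := (@measurable_cell R n, @leb_cell R n).
have := @Rintegral_cst _ V R (leb R n) cell mc t.
by move=> ->; congr (_ * _); exact: (congr1 fine lc).
Qed.

Lemma II_ph k t : II (phase k t) = if k == 0 then torus_volume * cos t else 0.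
Proof.
case: eqP => [->|/eqP k0].
  rewrite mulrC -II_cst; apply: eq_Rintegral => x _.
  rewrite /phase /lattice_dot big1 ?add0r// => i _; by rewrite ffunE mul0r.
have [i ki] : exists i, k i != 0.
  apply/existsP; apply: contraNT k0 => /existsPn h.
  by apply/eqP/ffunP => i; rewrite ffunE; apply/eqP; rewrite -[_ == _]negbK h.
have ki0 : (k i)%:~R != 0 :> R by rewrite intr_eq0.
have := @integral_torusD R n ((pi / (k i)%:~R) *: delta_mx 0 i) (phase k t)
  (measurable_ph k t) (ph_periodic k t).
rewrite (_ : (fun y => _) = fun y => -1 * phase k t y); last first.
  apply/funext => y; rewrite phD ldotZr ldot_delta divfK// /phase addrA cosDpi.
  by rewrite mulN1r.
by rewrite IIZ; [lra|exact/ic_bnd/bndd_ph].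
Qed.

Definition fourier_coef k t v : R := II (fun x => v x * phase k t x).

Lemma coefD k t v w : square_integrable v -> square_integrable w ->
  fourier_coef k t (fun x => v x + w x) = fourier_coef k t v + fourier_coef k t w.
Proof.
move=> sv sw; rewrite /fourier_coef -IID; [|exact/sqi_ic/sqi_ph|exact/sqi_ic/sqi_ph].
by apply: eq_Rintegral => x _; rewrite mulrDl.
Qed.

Lemma coefZ k t c v : square_integrable v -> fourier_coef k t (fun x => c * v x) = c * fourier_coef k t v.
Proof.
move=> sv; rewrite /fourier_coef -IIZ; last exact/sqi_ic/sqi_ph.
by apply: eq_Rintegral => x _; rewrite mulrA.
Qed.

Lemma coefB k t v w : square_integrable v -> square_integrable w ->
  fourier_coef k t (fun x => v x - w x) = fourier_coef k t v - fourier_coef k t w.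
Proof.
move=> sv sw; rewrite /fourier_coef -IIB; [|exact/sqi_ic/sqi_ph|exact/sqi_ic/sqi_ph].
by apply: eq_Rintegral => x _; rewrite mulrBl.
Qed.

Lemma coef_split k t v : square_integrable v ->
  fourier_coef k t v = cos t * fourier_coef k 0 v + sin t * fourier_coef k (pi / 2) v.
Proof.
move=> sv; have c0 := sqi_ic sv (sqi_ph k 0); have c1 := sqi_ic sv (sqi_ph k (pi / 2)).
rewrite /fourier_coef -!IIZ// -IID; [|exact: icZ|exact: icZ].
by apply: eq_Rintegral => x _; rewrite ph_split; ring.
Qed.

Lemma coef_opp k t v : fourier_coef (- k) t v = fourier_coef k (- t) v.
Proof. by apply: eq_Rintegral => x _; rewrite ph_opp. Qed.

Lemma coef_ph k l s t : fourier_coef l t (phase k s) =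
  torus_volume / 2 * ((k == l)%:R * cos (s - t) + (k == - l)%:R * cos (s + t)).
Proof.
rewrite /fourier_coef; under eq_Rintegral => x _ do rewrite ph_mul.
rewrite IIZ; last by apply: icD; exact/ic_bnd/bndd_ph.
rewrite IID; [|exact/ic_bnd/bndd_ph|exact/ic_bnd/bndd_ph].
rewrite !II_ph subr_eq0 addr_eq0.
by case: eqP => _; case: eqP => _; rewrite ?mul0r ?mul1r ?addr0 ?add0r ?mulr0//; field.
Qed.

(** The squared modulus of the integral of v e^(i k.x). *)
Definition fourier_power k v : R := fourier_coef k 0 v ^+ 2 + fourier_coef k (pi / 2) v ^+ 2.

Lemma pw_ge0 k v : 0 <= fourier_power k v.
Proof. by rewrite addr_ge0// sqr_ge0. Qed.

Lemma pw_phase k t v : square_integrable v ->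
  fourier_coef k t v ^+ 2 + fourier_coef k (t + pi / 2) v ^+ 2 = fourier_power k v.
Proof.
move=> sv; rewrite (coef_split _ t)// (coef_split _ (t + _))// /fourier_power.
rewrite cosDpihalf sinDpihalf.
set a := fourier_coef k 0 v; set b := fourier_coef k _ v.
rewrite (_ : _ + _ = (cos t ^+ 2 + sin t ^+ 2) * (a ^+ 2 + b ^+ 2)); last by ring.
by rewrite cos2Dsin2 mul1r.
Qed.

Lemma coef_shift k t z v : square_integrable v -> torus_periodic v ->
  fourier_coef k t (fun x => v (x + z)) = fourier_coef k (t - lattice_dot k z) v.
Proof.
move=> sv pv; rewrite /fourier_coef.
have mf : measurable_fun setT (fun x => v x * phase k (t - lattice_dot k z) x).
  by apply: measurable_funM; [exact: sqi_measurable|exact: measurable_ph].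
rewrite -(integral_torusD z mf).
  by apply: eq_Rintegral => x _; rewrite phD subrK.
by move=> x i; rewrite pv ph_periodic.
Qed.

(** A list rather than a set, because the frequencies range over an infinite type. *)
Definition cube N : seq lattice := undup
  (map (fun j : {ffun 'I_n -> 'I_(N.*2.+1)} => [ffun i => (j i : nat)%:Z - N%:Z])
    (enum {: {ffun 'I_n -> 'I_(N.*2.+1)}})).

Lemma cube_uniq N : uniq (cube N).
Proof. exact: undup_uniq. Qed.

Lemma mem_cube N k : (k \in cube N) = [forall i, `|k i| <= N%:Z].
Proof.
rewrite mem_undup; apply/mapP/forallP => [[j _ ->] i|h].
  rewrite ffunE ler_norml; move: (nat_of_ord (j i)) (ltn_ord (j i)) => m; lia.
have hk i : (absz (k i + N%:Z)%R < N.*2.+1)%N.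
  have := h i; rewrite ler_norml; lia.
exists [ffun i => Ordinal (hk i)]; first by rewrite mem_enum.
apply/ffunP => i; rewrite !ffunE /=; have := h i; rewrite ler_norml; lia.
Qed.

Lemma cube_opp N k : (- k \in cube N) = (k \in cube N).
Proof. by rewrite !mem_cube; apply: eq_forallb => i; rewrite ffunE normrN. Qed.

Lemma cube_le N M : (N <= M)%N -> {subset cube N <= cube M}.
Proof.
move=> NM k; rewrite !mem_cube => /forallP h; apply/forallP => i.
by rewrite (le_trans (h i))// lez_nat.
Qed.

Lemma cubeD N M k l : k \in cube N -> l \in cube M -> k + l \in cube (N + M).
Proof.
rewrite !mem_cube => /forallP h /forallP g; apply/forallP => i; rewrite ffunE.
by rewrite (le_trans (ler_normD _ _))// PoszD lerD.
Qed.

(** The sum runs over k and - k, hence the factor 1 / vol instead of 2 / vol. *)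
Definition partial_sum N v x : R := torus_volume^-1 *
  \sum_(k <- cube N) (fourier_coef k 0 v * phase k 0 x + fourier_coef k (pi / 2) v * phase k (pi / 2) x).

Lemma sqi_psum N v : square_integrable (partial_sum N v).
Proof.
apply: sqiZ; apply: sqi_sum => k.
by apply: sqiD; apply: sqiZ; exact: sqi_ph.
Qed.

Lemma coef_sum I (s : seq I) (f : I -> V -> R) k t : (forall i, square_integrable (f i)) ->
  fourier_coef k t (fun x => \sum_(i <- s) f i x) = \sum_(i <- s) fourier_coef k t (f i).
Proof.
move=> sf; rewrite /fourier_coef -II_sum; last by move=> i; exact/sqi_ic/sqi_ph.
by apply: eq_Rintegral => x _; rewrite mulr_suml.
Qed.

Lemma coef_psum N v l t : square_integrable v -> l \in cube N -> fourier_coef l t (partial_sum N v) = fourier_coef l t v.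
Proof.
move=> sv lN; have v0 := lt0r_neq0 vol_gt0.
have sk k : square_integrable (fun x => fourier_coef k 0 v * phase k 0 x + fourier_coef k (pi / 2) v * phase k (pi / 2) x).
  by apply: sqiD; apply: sqiZ; exact: sqi_ph.
rewrite /partial_sum coefZ; last exact: sqi_sum.
rewrite coef_sum//.
pose c k := 2^-1 * (fourier_coef k 0 v * cos t + fourier_coef k (pi / 2) v * sin t).
pose d k := 2^-1 * (fourier_coef k 0 v * cos t - fourier_coef k (pi / 2) v * sin t).
rewrite (eq_bigr (fun k => torus_volume * ((k == l)%:R * c k + (k == - l)%:R * d k))); last first.
  move=> k _; rewrite coefD; [|exact/sqiZ/sqi_ph|exact/sqiZ/sqi_ph].
  rewrite !coefZ; [|exact: sqi_ph|exact: sqi_ph].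
  rewrite !coef_ph /c /d sub0r add0r cosN !(addrC (pi / 2)) !cosDpihalf sinN.
  by field.
rewrite -mulr_sumr mulKf// big_split/=.
have pick (e : lattice -> R) m : m \in cube N -> \sum_(k <- cube N) (k == m)%:R * e k = e m.
  move=> mN; rewrite (bigD1_seq m)//= ?cube_uniq// eqxx mul1r big1 ?addr0//.
  by move=> k /negPf ->; rewrite mul0r.
rewrite !pick ?cube_opp// /c /d !coef_opp oppr0 [in RHS]coef_split//.
by rewrite (coef_split l (- (pi / 2)))// cosN sinN cos_pihalf sin_pihalf; field.
Qed.

Inductive trigpoly N : (V -> R) -> Prop :=
| tspan_ph c k t : k \in cube N -> trigpoly N (fun x => c * phase k t x)
| tspanD p q : trigpoly N p -> trigpoly N q -> trigpoly N (fun x => p x + q x).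

Lemma sqi_tspan N p : trigpoly N p -> square_integrable p.
Proof.
elim=> [c k t _|q r _ sq _ sr]; [exact/sqiZ/sqi_ph|exact: sqiD].
Qed.

Lemma tspan_ortho N v q : square_integrable v -> trigpoly N q ->
  II (fun x => (v x - partial_sum N v x) * q x) = 0.
Proof.
move=> sv; have sr := sqiB sv (sqi_psum N v).
elim=> [c k t kN|p r tp hp tr hr].
  rewrite (_ : (fun _ => _) = fun x => c * ((v x - partial_sum N v x) * phase k t x)).
    rewrite IIZ; last exact/sqi_ic/sqi_ph.
    have := coefB k t sv (sqi_psum N v).
    by rewrite coef_psum// subrr /fourier_coef => ->; rewrite mulr0.
  by apply/funext => x; rewrite mulrCA.
rewrite (_ : (fun _ => _) = fun x => (v x - partial_sum N v x) * p x + (v x - partial_sum N v x) * r x).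
  have [sp sq] := (sqi_tspan tp, sqi_tspan tr).
  by rewrite IID ?hp ?hr ?addr0//; exact: sqi_ic.
by apply/funext => x; rewrite mulrDr.
Qed.

Lemma tspanZ N c p : trigpoly N p -> trigpoly N (fun x => c * p x).
Proof.
elim=> [d k t kN|q r _ sq _ sr].
  rewrite (_ : (fun _ => _) = fun x => (c * d) * phase k t x); first exact: tspan_ph.
  by apply/funext => x; rewrite mulrA.
rewrite (_ : (fun _ => _) = fun x => c * q x + c * r x); first exact: tspanD.
by apply/funext => x; rewrite mulrDr.
Qed.

Lemma cube0 N : 0 \in cube N.
Proof. by rewrite mem_cube; apply/forallP => i; rewrite ffunE normr0. Qed.

Lemma tspan_cst N c : trigpoly N (fun=> c).
Proof.
rewrite (_ : (fun=> c) = fun x => c * phase 0 0 x); first exact/tspan_ph/cube0.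
apply/funext => x; rewrite /phase /lattice_dot big1 ?add0r ?cos0 ?mulr1// => i _.
by rewrite ffunE mul0r.
Qed.

Lemma tspan_sum N (s : seq lattice) (f : lattice -> V -> R) :
  (forall k, k \in s -> trigpoly N (f k)) -> trigpoly N (fun x => \sum_(k <- s) f k x).
Proof.
elim: s => [_|k s IH h].
  rewrite (_ : (fun _ => _) = fun=> 0); first exact: tspan_cst.
  by apply/funext => x; rewrite big_nil.
rewrite (_ : (fun _ => _) = fun x => f k x + \sum_(k <- s) f k x).
  apply: tspanD; first by apply: h; rewrite mem_head.
  by apply: IH => l ls; apply: h; rewrite in_cons ls orbT.
by apply/funext => x; rewrite big_cons.
Qed.

Lemma tspan_psum N v : trigpoly N (partial_sum N v).
Proof.
apply: tspanZ; apply: tspan_sum => k kN.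
by apply: tspanD; exact: tspan_ph.
Qed.

Definition sqnorm v : R := II (fun x => v x ^+ 2).

Lemma nrm2_ge0 v : 0 <= sqnorm v.
Proof. by apply: II_ge0 => x _; exact: sqr_ge0. Qed.

Lemma nrm2D v w : square_integrable v -> square_integrable w -> sqnorm (fun x => v x + w x) =
  sqnorm v + 2 * II (fun x => v x * w x) + sqnorm w.
Proof.
move=> sv sw; have c := sqi_ic sv sw; have [_ cv] := sv; have [_ cw] := sw.
rewrite /sqnorm -IIZ// -IID//; last exact: icZ.
rewrite -IID//; last by apply: icD => //; exact: icZ.
by apply: eq_Rintegral => x _; ring.
Qed.

Definition partial_power N v : R := torus_volume^-1 * \sum_(k <- cube N) fourier_power k v.

Lemma psum_inner N v : square_integrable v -> II (fun x => v x * partial_sum N v x) = partial_power N v.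
Proof.
move=> sv.
have s2 k : square_integrable (fun x => fourier_coef k 0 v * phase k 0 x + fourier_coef k (pi / 2) v * phase k (pi / 2) x).
  by apply: sqiD; apply: sqiZ; exact: sqi_ph.
rewrite (_ : (fun _ => _) = fun x => torus_volume^-1 * \sum_(k <- cube N)
  v x * (fourier_coef k 0 v * phase k 0 x + fourier_coef k (pi / 2) v * phase k (pi / 2) x)); last first.
  by apply/funext => x; rewrite /partial_sum mulrCA mulr_sumr.
rewrite IIZ; last by apply: ic_sum => k; exact: sqi_ic.
rewrite II_sum; last by move=> k; exact: sqi_ic.
congr (_ * _); apply: eq_bigr => k _.
have c0 := sqi_ic sv (sqi_ph k 0); have c1 := sqi_ic sv (sqi_ph k (pi / 2)).
transitivity (fourier_coef k 0 v * II (fun x => v x * phase k 0 x) +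
    fourier_coef k (pi / 2) v * II (fun x => v x * phase k (pi / 2) x)); last by rewrite /fourier_power !expr2.
rewrite -!IIZ// -IID//; [|exact: icZ|exact: icZ].
by apply: eq_Rintegral => x _; ring.
Qed.

Lemma psum_dist N v : square_integrable v -> sqnorm (fun x => v x - partial_sum N v x) = sqnorm v - partial_power N v.
Proof.
move=> sv; have sp := sqi_psum N v; have sr := sqiB sv sp.
have o := tspan_ortho sv (tspan_psum N v).
have [_ cv] := sv.
rewrite -psum_inner// /sqnorm -IIB//; last exact: sqi_ic.
rewrite -[RHS]subr0 -o -IIB; [|by apply: icB => //; exact: sqi_ic|exact: sqi_ic].
by apply: eq_Rintegral => x _; ring.
Qed.

Lemma bessel N v : square_integrable v -> partial_power N v <= sqnorm v.
Proof. by move=> sv; rewrite -subr_ge0 -psum_dist// nrm2_ge0. Qed.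

(** The partial sum is the orthogonal projection, hence the closest point of the span. *)
Lemma psq_best N v p : square_integrable v -> trigpoly N p ->
  sqnorm v <= partial_power N v + sqnorm (fun x => v x - p x).
Proof.
move=> sv tp; rewrite -lerBlDl -psum_dist//.
have sr := sqiB sv (sqi_psum N v); have sq := sqiB (sqi_psum N v) (sqi_tspan tp).
have tq : trigpoly N (fun x => partial_sum N v x - p x).
  rewrite (_ : (fun _ => _) = fun x => partial_sum N v x + -1 * p x).
    by apply: tspanD; [exact: tspan_psum|exact: tspanZ].
  by apply/funext => x; rewrite mulN1r.
have -> : (fun x => v x - p x) = (fun x => (v x - partial_sum N v x) + (partial_sum N v x - p x)).
  by apply/funext => x; ring.
have o := tspan_ortho sv tq.
by rewrite (nrm2D sr sq)/= o mulr0 addr0 lerDl nrm2_ge0.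
Qed.

Lemma psq_mono N M v : (N <= M)%N -> partial_power N v <= partial_power M v.
Proof.
move=> NM; rewrite ler_pM2l ?invr_gt0 ?vol_gt0//.
rewrite [leRHS](bigID (mem (cube N)))/= -[leLHS]addr0 lerD//; last first.
  by apply: sumr_ge0 => k _; exact: pw_ge0.
rewrite -[leRHS]big_filter le_eqVlt; apply/orP; left; apply/eqP.
apply: perm_big; apply: uniq_perm; rewrite ?filter_uniq ?cube_uniq//.
move=> k; rewrite mem_filter; case kN : (k \in cube N) => //=.
by rewrite (cube_le NM kN).
Qed.

Lemma tspan_le N M p : (N <= M)%N -> trigpoly N p -> trigpoly M p.
Proof.
move=> NM; elim=> [c k t kN|q r _ tq _ tr]; last exact: tspanD.
by apply: tspan_ph; exact: cube_le kN.
Qed.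

Lemma tspanM N M p q : trigpoly N p -> trigpoly M q ->
  trigpoly (N + M) (fun x => p x * q x).
Proof.
move=> tp tq; elim: tp => [c k s kN|p1 p2 _ t1 _ t2]; last first.
  rewrite (_ : (fun _ => _) = fun x => p1 x * q x + p2 x * q x); first exact: tspanD.
  by apply/funext => x; rewrite mulrDl.
elim: tq => [d l t lM|q1 q2 _ t1 _ t2]; last first.
  rewrite (_ : (fun _ => _) = fun x => c * phase k s x * q1 x + c * phase k s x * q2 x); first exact: tspanD.
  by apply/funext => x; rewrite mulrDr.
rewrite (_ : (fun _ => _) = fun x => (c * d / 2) * phase (k - l) (s - t) x +
    (c * d / 2) * phase (k + l) (s + t) x).
  apply: tspanD; apply: tspan_ph; apply: cubeD => //; by rewrite cube_opp.
by apply/funext => x; rewrite mulrACA ph_mul; field.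
Qed.

End fourier.

(** * Density of trigonometric polynomials and the Parseval identity *)

Section density.
Context {R : realType} {n : nat}.
Local Notation V := 'rV[R]_n.
Local Notation lattice := {ffun 'I_n -> int}.
Implicit Types (k l : lattice) (x y z : V) (t : R) (v w p q f g : V -> R).
Local Notation II f := (\int[leb R n]_(x in cell) f x).

Lemma nrm2_ext v w : {in cell, v =1 w} -> sqnorm v = sqnorm w.
Proof. by move=> h; apply: eq_Rintegral => x xc; rewrite h. Qed.

Lemma nrm2_triangle v w : square_integrable v -> square_integrable w ->
  sqnorm (fun x => v x + w x) <= 2 * sqnorm v + 2 * sqnorm w.
Proof.
move=> sv sw; have [_ cv] := sv; have [_ cw] := sw.
rewrite /sqnorm -!IIZ// -IID; [|exact: icZ|exact: icZ].
apply: II_le; first by have [] := sqiD sv sw.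
- by apply: icD; exact: icZ.
- by move=> x _; have := sqr_ge0 (v x - w x); nra.
Qed.

Lemma nrm2_dist v w u : square_integrable v -> square_integrable w -> square_integrable u ->
  sqnorm (fun x => v x - u x) <=
  2 * sqnorm (fun x => v x - w x) + 2 * sqnorm (fun x => w x - u x).
Proof.
move=> sv sw su; have := nrm2_triangle (sqiB sv sw) (sqiB sw su).
by apply: le_trans; rewrite le_eqVlt; apply/orP; left; apply/eqP;
  apply: nrm2_ext => x _ /=; ring.
Qed.

(** Approximation in the mean square sense on the cell. *)
Definition trig_approx f := forall e, 0 < e ->
  exists N p, trigpoly N p /\ sqnorm (fun x => f x - p x) <= e.

Lemma apx_lim f : square_integrable f ->
  (forall e, 0 < e -> exists g, [/\ square_integrable g, trig_approx g & sqnorm (fun x => f x - g x) <= e]) ->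
  trig_approx f.
Proof.
move=> sf h e e0; have e4 : 0 < e / 4 by rewrite divr_gt0.
have [g [sg ag fg]] := h _ e4; have [N [p [tp gp]]] := ag _ e4.
exists N, p; split => //.
have := nrm2_dist sf sg (sqi_tspan tp); lra.
Qed.

Lemma apxD f g : square_integrable f -> square_integrable g -> trig_approx f -> trig_approx g -> trig_approx (fun x => f x + g x).
Proof.
move=> sf sg af ag e e0; have e4 : 0 < e / 4 by rewrite divr_gt0.
have [N [p [tp fp]]] := af _ e4; have [M [q [tq gq]]] := ag _ e4.
exists (maxn N M), (fun x => p x + q x); split.
  by apply: tspanD; [apply: tspan_le tp; exact: leq_maxl|apply: tspan_le tq; exact: leq_maxr].
have := nrm2_triangle (sqiB sf (sqi_tspan tp)) (sqiB sg (sqi_tspan tq)).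
rewrite (nrm2_ext (w := fun x => f x + g x - (p x + q x))); first lra.
by move=> x _ /=; ring.
Qed.

Lemma nrm2Z c v : square_integrable v -> sqnorm (fun x => c * v x) = c ^+ 2 * sqnorm v.
Proof.
move=> [_ cv]; rewrite /sqnorm -IIZ//.
by apply: eq_Rintegral => x _; rewrite exprMn.
Qed.

Lemma apx_tspan N p : trigpoly N p -> trig_approx p.
Proof.
move=> tp e e0; exists N, p; split => //.
rewrite (nrm2_ext (w := fun=> 0)); last by move=> x _; rewrite subrr.
by rewrite /sqnorm expr0n/= II_cst mul0r ltW.
Qed.

Lemma bnddD f g : bounded_measurable f -> bounded_measurable g -> bounded_measurable (fun x => f x + g x).
Proof.
move=> [mf [A hA]] [mg [B hB]]; split; first exact: measurable_funD.
by exists (A + B) => x; rewrite (le_trans (ler_normD _ _))// lerD.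
Qed.

Lemma bnddM f g : bounded_measurable f -> bounded_measurable g -> bounded_measurable (fun x => f x * g x).
Proof.
move=> [mf [A hA]] [mg [B hB]]; split; first exact: measurable_funM.
by exists (A * B) => x; rewrite normrM ler_pM.
Qed.

Lemma bndd_cst c : bounded_measurable (fun _ : V => c).
Proof. by split => //; exists `|c|. Qed.

Lemma bndd_tspan N p : trigpoly N p -> bounded_measurable p.
Proof.
elim=> [c k t _|q r _ bq _ br]; last exact: bnddD.
by apply: bnddM; [exact: bndd_cst|exact: bndd_ph].
Qed.

Lemma nrm2M_bnd f g B : bounded_measurable f -> square_integrable g -> (forall x, `|f x| <= B) ->
  sqnorm (fun x => f x * g x) <= B ^+ 2 * sqnorm g.
Proof.
move=> bf sg fB; have [mg cg] := sg; have [mf _] := bf.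
have i1 : cell_integrable (fun x => B ^+ 2 * g x ^+ 2) by exact: icZ.
rewrite /sqnorm -IIZ//; apply: II_le => //.
  apply: (ic_le _ i1) => [|x _]; first by apply: measurable_funX; exact: measurable_funM.
  rewrite ger0_norm ?sqr_ge0// exprMn ler_wpM2r ?sqr_ge0// -real_normK ?num_real//.
  by rewrite lerXn2r ?nnegrE//; exact: le_trans (fB x).
move=> x _; rewrite exprMn ler_wpM2r ?sqr_ge0// -real_normK ?num_real//.
by rewrite lerXn2r ?nnegrE//; exact: le_trans (fB x).
Qed.

(** Boundedness makes this class of functions closed under products. *)
Definition bounded_approx f := bounded_measurable f /\ trig_approx f.

Lemma bounded_approx_tspan N p : trigpoly N p -> bounded_approx p.
Proof. by move=> tp; split; [exact: bndd_tspan tp|exact: apx_tspan tp]. Qed.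

Lemma bounded_approx_cst c : bounded_approx (fun=> c).
Proof. exact: bounded_approx_tspan (tspan_cst 0 c). Qed.

Lemma bounded_approxD f g : bounded_approx f -> bounded_approx g -> bounded_approx (fun x => f x + g x).
Proof.
move=> [bf af] [bg ag]; split; first exact: bnddD.
by apply: apxD => //; exact: sqi_bnd.
Qed.

Lemma bounded_approxM f g : bounded_approx f -> bounded_approx g -> bounded_approx (fun x => f x * g x).
Proof.
move=> [bf af] [bg ag]; have bfg := bnddM bf bg; split => //.
have [sf sg] := (sqi_bnd bf, sqi_bnd bg).
have [mf [A hA]] := bf.
apply: apx_lim; first exact: sqi_bnd.
move=> e e0.
have d0 : 0 < e / (1 + A ^+ 2) by rewrite divr_gt0// ltr_pwDl// sqr_ge0.
have [M [q [tq gq]]] := ag _ d0; have bq := bndd_tspan tq.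
have sq := sqi_tspan tq.
exists (fun x => f x * q x); split; first exact/sqi_bnd/bnddM.
  move=> d d1; have [mq [B hB]] := bq.
  have e1 : 0 < d / (1 + B ^+ 2) by rewrite divr_gt0// ltr_pwDl// sqr_ge0.
  have [N [p [tp fp]]] := af _ e1; have sp := sqi_tspan tp.
  exists (N + M)%N, (fun x => p x * q x); split; first exact: tspanM.
  rewrite (nrm2_ext (w := fun x => q x * (f x - p x))); last by move=> x _ /=; ring.
  rewrite (le_trans (nrm2M_bnd bq (sqiB sf sp) hB))//.
  rewrite (le_trans (ler_wpM2l (sqr_ge0 _) fp))// mulrA ler_pdivrMr.
    by rewrite mulrC ler_pM2l// lerDr.
  by rewrite ltr_pwDl// sqr_ge0.
rewrite (nrm2_ext (w := fun x => f x * (g x - q x))); last by move=> x _ /=; ring.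
rewrite (le_trans (nrm2M_bnd bf (sqiB sg sq) hA))//.
rewrite (le_trans (ler_wpM2l (sqr_ge0 _) gq))// mulrA ler_pdivrMr.
  by rewrite mulrC ler_pM2l// lerDr.
by rewrite ltr_pwDl// sqr_ge0.
Qed.

Lemma bounded_approxZ c f : bounded_approx f -> bounded_approx (fun x => c * f x).
Proof. by move=> hf; apply: bounded_approxM => //; exact: bounded_approx_cst. Qed.

Lemma apx_cvg (fs : nat -> V -> R) f g : square_integrable f -> square_integrable g ->
  (forall j, square_integrable (fs j)) -> (forall j, trig_approx (fs j)) ->
  (forall j x, cell x -> `|f x - fs j x| <= g x) ->
  (forall x, cell x -> (fs ^~ x) @ \oo --> f x) -> trig_approx f.
Proof.
move=> sf sg sfs afs hb hc; apply: apx_lim => // e e0.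
have : (fun j => sqnorm (fun x => f x - fs j x)) @ \oo --> 0.
  apply: (II_dct (g := fun x => g x ^+ 2)).
  - by move=> j; have [] := sqiB sf (sfs j); move=> mm _; exact: measurable_funX.
  - by case: sg.
  - move=> j x cx; rewrite normrX lerXn2r ?nnegrE//; last exact: hb.
    by rewrite (le_trans _ (hb j x cx)).
  - move=> x cx.
    have c : (fun j => f x - fs j x) @ \oo --> f x - f x.
      by apply: cvgB; [exact: cvg_cst|exact: hc].
    rewrite subrr in c.
    rewrite (_ : (fun j => _) = fun j => (f x - fs j x) * (f x - fs j x)).
      by rewrite -[X in _ --> X](mulr0 0); apply: (cvgM c c).
    by apply/funext => j; rewrite expr2.
move=> /cvgrPdist_le/(_ _ e0)[N _ /(_ N (leqnn N))]/=.
rewrite sub0r normrN ger0_norm ?nrm2_ge0// => h.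
by exists (fs N).
Qed.

Lemma bounded_approx_cvg (fs : nat -> V -> R) f B : bounded_measurable f ->
  (forall j, bounded_approx (fs j)) -> (forall j x, `|fs j x| <= B) ->
  (forall x, cell x -> (fs ^~ x) @ \oo --> f x) -> bounded_approx f.
Proof.
move=> bf hfs hB hc; split => //; have [mf [A hA]] := bf.
apply: (apx_cvg (g := fun=> A + B) (fs := fs)) => //.
- exact: sqi_bnd.
- exact/sqi_bnd/bndd_cst.
- by move=> j; have [bj _] := hfs j; exact: sqi_bnd.
- by move=> j; have [] := hfs j.
- by move=> j x _; rewrite (le_trans (ler_normB _ _))// lerD.
Qed.

Lemma bounded_approx_ext f g : bounded_measurable g -> {in cell, f =1 g} -> bounded_approx f -> bounded_approx g.
Proof.
move=> bg fg [bf af]; split => // e e0; have [N [p [tp fp]]] := af _ e0.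
exists N, p; split => //; rewrite (nrm2_ext (w := fun x => f x - p x))// => x xc.
by rewrite /= fg.
Qed.

(** Iterating this odd cubic polynomial from a point of [-1, 1] converges to the sign of
the point. This turns closure under products and bounded limits into closure under
sign, hence provides indicator functions of level sets. *)
Definition sgstep t : R := (3 * t - t ^+ 3) / 2.

Lemma sgstep_itv t : -1 <= t <= 1 -> -1 <= sgstep t <= 1.
Proof.
rewrite /sgstep => /andP[h1 h2].
have p1 : 0 <= (1 - t) ^+ 2 * (2 + t) by rewrite mulr_ge0 ?sqr_ge0//; lra.
have p2 : 0 <= (1 + t) ^+ 2 * (2 - t) by rewrite mulr_ge0 ?sqr_ge0//; lra.
by apply/andP; split; lra.
Qed.

Lemma cvg_sgstep_pos t : 0 < t <= 1 -> (fun j => iter j sgstep t) @ \oo --> (1 : R).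
Proof.
move=> /andP[t0 t1].
have h j : t <= iter j sgstep t <= 1 /\ 1 - iter j sgstep t <= (1 - t / 2) ^+ j.
  elim: j => [|j [/andP[h1 h2] h3]] /=; first by rewrite lexx t1 expr0; split => //; lra.
  set s := iter j sgstep t in h1 h2 h3 *.
  have q : 1 - sgstep s <= (1 - s) * (1 - t / 2).
    have p1 : 0 <= (1 - s) * (s - t) by rewrite mulr_ge0; lra.
    have p2 : 0 <= (1 - s) * s ^+ 2 by rewrite mulr_ge0 ?sqr_ge0//; lra.
    by rewrite /sgstep; lra.
  have p3 : 0 <= s * (1 - s) * (1 + s) by rewrite !mulr_ge0; lra.
  have /andP[_ p4] : -1 <= sgstep s <= 1 by apply: sgstep_itv; apply/andP; split; lra.
  split; first by apply/andP; split => //; rewrite /sgstep; lra.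
  by rewrite (le_trans q)// exprSr ler_wpM2r//; lra.
apply/cvgrPdist_le => e e0.
have t2 : `|1 - t / 2| < 1 by rewrite ger0_norm; lra.
have /cvgrPdist_le/(_ e e0)[N _ hN] := cvg_expr t2; exists N => // j Nj /=.
have [/andP[h1 h2] h3] := h j; rewrite ger0_norm; last by rewrite subr_ge0.
rewrite (le_trans h3)//.
by have := hN j Nj; rewrite /= sub0r normrN ger0_norm// exprn_ge0//; lra.
Qed.

Lemma sgstepN t : sgstep (- t) = - sgstep t.
Proof. by rewrite /sgstep; field. Qed.

Lemma cvg_sgstep t : -1 <= t <= 1 -> (fun j => iter j sgstep t) @ \oo --> Num.sg t.
Proof.
move=> /andP[h1 h2]; have [t0|t0|->] := ltgtP t 0.
- have -> : (fun j => iter j sgstep t) = (fun j => - iter j sgstep (- t)).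
    apply/funext; elim=> [|j IH] /=; first by rewrite opprK.
    by rewrite IH sgstepN.
  rewrite ltr0_sg//; apply: cvgN; apply: cvg_sgstep_pos; apply/andP; split; lra.
- by rewrite gtr0_sg//; apply: cvg_sgstep_pos; rewrite t0.
- rewrite sgr0 (_ : (fun j => _) = fun=> 0); first exact: cvg_cst.
  by apply/funext; elim=> //= j ->; rewrite /sgstep; field.
Qed.

(** The sign of [f] is the limit of the iterates of [sgstep] at f / (1 + |B|), which are
polynomials in [f]. *)
Lemma bounded_approx_sg f B : bounded_approx f -> (forall x, `|f x| <= B) -> bounded_approx (fun x => Num.sg (f x)).
Proof.
move=> hf hB; pose c := (1 + `|B|)^-1.
have B0 : 0 < 1 + `|B| by rewrite ltr_pwDl.
have hcf x : -1 <= c * f x <= 1.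
  rewrite -ler_norml normrM gtr0_norm ?invr_gt0// ler_pdivrMl// mulr1.
  by rewrite (le_trans (hB x))// (le_trans (ler_norm _))// lerDr.
have sgc x : Num.sg (c * f x) = Num.sg (f x).
  by rewrite sgrM gtr0_sg ?mul1r// invr_gt0.
have [[mf _] _] := hf.
apply: (@bounded_approx_cvg (fun j x => iter j sgstep (c * f x)) _ 1).
- split; last first.
    by exists 1 => x; case: (sgrP (f x)) => _; rewrite ?normr0 ?normrN ?normr1.
  rewrite (_ : (fun x => _) = fun x => \1_[set x | 0 < f x] x - \1_[set x | f x < 0] x).
    apply: measurable_funB; apply: measurable_indic.
      rewrite (_ : mkset _ = f @^-1` `]0, +oo[); last first.
        by apply/seteqP; split => x /=; rewrite in_itv/= andbT.
      by apply: measurable_preimage => //; exact: measurable_itv.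
    rewrite (_ : mkset _ = f @^-1` `]-oo, 0[); last first.
      by apply/seteqP; split => x /=; rewrite in_itv/=.
    by apply: measurable_preimage => //; exact: measurable_itv.
  have ib (P : V -> bool) x : (\1_[set x | P x] x : R) = (P x)%:R.
    rewrite indicE; congr (_%:R); congr nat_of_bool.
    by apply/idP/idP => [/set_mem//|h]; exact/mem_set.
  apply/funext => x; rewrite !ib.
  by case: (ltgtP (f x) 0) => [h|h|->]; rewrite ?(ltr0_sg h) ?(gtr0_sg h) ?sgr0/=; lra.
- elim=> [|j IH] /=; first exact: bounded_approxZ.
  rewrite (_ : (fun x => _) = fun x => 3 / 2 * iter j sgstep (c * f x) +
    - 2^-1 * (iter j sgstep (c * f x) * (iter j sgstep (c * f x) * iter j sgstep (c * f x)))).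
    by apply: bounded_approxD; [exact: bounded_approxZ|apply: bounded_approxZ; apply: bounded_approxM => //; exact: bounded_approxM].
  by apply/funext => x; rewrite [LHS]/sgstep; field.
- move=> j x; rewrite ler_norml; elim: j => [|j IH] /=; first exact: hcf.
  exact: sgstep_itv.
- by move=> x _; rewrite -sgc; exact: cvg_sgstep.
Qed.

Definition approx_set (A : set V) := measurable A /\ bounded_approx (\1_A).

Lemma bndd_indic (A : set V) : measurable A -> bounded_measurable (\1_A : V -> R).
Proof.
move=> mA; split; first exact: measurable_indic.
by exists 1 => x; rewrite indicE; case: (_ \in _); rewrite ?normr0 ?normr1.
Qed.

Lemma approx_set_gt f b B : bounded_approx f -> (forall x, `|f x| <= B) -> approx_set [set x | b < f x].
Proof.
move=> hf hB; have [[mf _] _] := hf.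
have m : measurable [set x | b < f x].
  rewrite (_ : mkset _ = f @^-1` `]b, +oo[); last first.
    by apply/seteqP; split => x /=; rewrite in_itv/= andbT.
  by apply: measurable_preimage => //; exact: measurable_itv.
split => //.
have hg := bounded_approxD hf (bounded_approx_cst (- b)).
have hs := bounded_approx_sg hg (fun x => le_trans (ler_normD _ _) (lerD (hB x) (lexx `|- b|))).
have h2 := bounded_approxD (bounded_approxZ (2^-1) hs) (bounded_approxZ (2^-1) (bounded_approxM hs hs)).
apply: (bounded_approx_ext (bndd_indic m) _ h2) => x _ /=.
rewrite indicE.
have [h|h] := ltP b (f x).
  by rewrite mem_set//= gtr0_sg ?subr_gt0//; field.
rewrite memNset/=; last by rewrite ltNge h.
move: h; rewrite le_eqVlt => /predU1P[->|h]; first by rewrite subrr sgr0; field.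
by rewrite ltr0_sg ?subr_lt0//; field.
Qed.

Lemma approx_set_ext (A B : set V) : measurable B -> A `&` cell = B `&` cell ->
  approx_set A -> approx_set B.
Proof.
move=> mB AB [mA hA]; split => //.
apply: bounded_approx_ext hA; first exact: bndd_indic.
move=> x /set_mem cx; rewrite !indicE; congr (_%:R).
have : (A `&` cell) x = (B `&` cell) x by rewrite AB.
move=> /propeqP[h1 h2]; congr nat_of_bool; apply/idP/idP => /set_mem h; apply/mem_set.
  by case: h1.
by case: h2.
Qed.

Lemma approx_setT : approx_set setT.
Proof.
split => //; rewrite (_ : \1__ = fun=> 1); first exact: bounded_approx_cst.
by apply/funext => x; rewrite indicE in_setT.
Qed.

Lemma approx_setC (A : set V) : approx_set A -> approx_set (~` A).
Proof.
move=> [mA hA]; split; first exact: measurableC.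
rewrite (_ : \1__ = fun x => 1 + -1 * \1_A x); first exact: (bounded_approxD (bounded_approx_cst 1) (bounded_approxZ _ hA)).
by apply/funext => x; rewrite !indicE in_setC; case: (_ \in A); rewrite /=; lra.
Qed.

Lemma approx_setI (A B : set V) : approx_set A -> approx_set B -> approx_set (A `&` B).
Proof.
move=> [mA hA] [mB hB]; split; first exact: measurableI.
rewrite (_ : \1__ = fun x => \1_A x * \1_B x); first exact: bounded_approxM.
by apply/funext => x; rewrite indicI.
Qed.

Lemma approx_setU (A B : set V) : approx_set A -> approx_set B -> approx_set (A `|` B).
Proof.
by move=> hA hB; rewrite -[_ `|` _]setCK setCU; apply: approx_setC; apply: approx_setI; exact: approx_setC.
Qed.

Lemma approx_set0 : approx_set set0.
Proof. by rewrite -setCT; apply: approx_setC; exact: approx_setT. Qed.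

Lemma approx_set_bigcup (F : (set V)^nat) : (forall j, approx_set (F j)) -> approx_set (\bigcup_j F j).
Proof.
move=> hF; have mU : measurable (\bigcup_j F j).
  by apply: bigcup_measurable => j _; have [] := hF j.
split => //.
have hG N : approx_set (\big[setU/set0]_(j < N) F j).
  elim: N => [|N IH]; first by rewrite big_ord0; exact: approx_set0.
  by rewrite big_ord_recr/=; exact: approx_setU.
apply: (@bounded_approx_cvg (fun N => \1_(\big[setU/set0]_(j < N) F j)) _ 1).
- exact: bndd_indic.
- by move=> N; have [] := hG N.
- by move=> N x; rewrite indicE; case: (_ \in _); rewrite ?normr0 ?normr1.
- move=> x _; apply/cvgrPdist_le => e e0.
  have [[j _ Fjx]|h] := pselect ((\bigcup_j F j) x).
    exists j.+1 => // N /= jN; rewrite !indicE !mem_set ?subrr ?normr0 ?ltW//.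
      by rewrite -bigcup_mkord; exists j.
    by exists j.
  exists 0%N => // N _ /=; rewrite !indicE !memNset ?subrr ?normr0 ?ltW//.
  by rewrite -bigcup_mkord => -[j _ ?]; apply: h; exists j.
Qed.

Lemma approx_set_sigma : sigma_algebra setT approx_set.
Proof.
split; [exact: approx_set0|by move=> A hA; rewrite setTD; exact: approx_setC|].
exact: approx_set_bigcup.
Qed.

Lemma cos_ltE (a b : R) : 0 <= a <= pi -> 0 <= b <= pi -> (cos b < cos a) = (a < b).
Proof. by move=> ha hb; rewrite ltr_cos// in_itv. Qed.

(** Within the cell, x_i < b is equivalent to a condition on trigonometric functions
of x_i: the half circle where the sine is negative is one level set, and on each half
circle the cosine is monotone. *)
Lemma approx_set_ray (i : 'I_n) (b : R) : approx_set [set x : V | x 0 i < b].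
Proof.
have mray : measurable [set x : V | x 0 i < b].
  rewrite (_ : mkset _ = (fun x : V => x 0 i : measurableTypeR R) @^-1` `]-oo, b[%classic).
    by apply: measurable_preimage; [exact: measurable_coord|exact: measurable_itv].
  by apply/seteqP; split => x; rewrite /preimage/= in_itv.
pose k : lattice := [ffun j => (j == i)%:Z].
have kE x : lattice_dot k x = x 0 i.
  rewrite /lattice_dot (bigD1 i)//= ffunE eqxx mul1r big1 ?addr0// => j /negPf ji.
  by rewrite ffunE ji mul0r.
have k1 : k \in cube 1.
  by rewrite mem_cube; apply/forallP => j; rewrite ffunE; case: eqP.
have hc a c t : approx_set [set x : V | a < c * cos (x 0 i + t)].
  have -> : [set x : V | a < c * cos (x 0 i + t)] = [set x | a < c * phase k t x].
    by apply/seteqP; split => x; rewrite /= /phase kE.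
  apply: (@approx_set_gt _ _ `|c|); first exact/bounded_approx_tspan/tspan_ph/k1.
  by move=> x; rewrite normrM ler_piMr// ph_le1.
have sE (y : R) : cos (y + - (pi / 2)) = sin y by exact: cosBpihalf.
pose S1 := [set x : V | 0 < 1 * cos (x 0 i + - (pi / 2))].
pose S2 := [set x : V | 0 < -1 * cos (x 0 i + - (pi / 2))].
pose C1 := [set x : V | -1 < 1 * cos (x 0 i + 0)].
pose Cb := [set x : V | - cos b < -1 * cos (x 0 i + 0)].
pose Cb' := [set x : V | cos b < 1 * cos (x 0 i + 0)].
have pi0 := pi_gt0 R.
have sinneg (y : R) : - pi < y < 0 -> sin y < 0.
  by move=> /andP[y1 y2]; rewrite -oppr_gt0 -sinN; apply: sin_gt0_pi; apply/andP; split; lra.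
have cosgt (y : R) : - pi < y < pi -> -1 < cos y.
  move=> /andP[y1 y2]; rewrite -(@cospi R); have [y0|y0] := leP 0 y.
    by rewrite cos_ltE//; apply/andP; split; lra.
  by rewrite -(cosN y) cos_ltE; [lra| |]; apply/andP; split; lra.
have [b1|b1] := leP b (- pi).
  apply: approx_set_ext approx_set0 => //; apply/seteqP; split => x [] //= xb.
  by move=> /(_ i); rewrite in_itv/= => /andP[]; lra.
have [b2|b2] := leP pi b.
  apply: approx_set_ext approx_setT => //; apply/seteqP; split => x [_ cx]; split => //=.
  by have := cx i; rewrite in_itv/= => /andP[]; lra.
have [b0|b0] := leP b 0.
  apply: (approx_set_ext mray _ (approx_setI (approx_setU (hc _ _ _ : approx_set S2) (approx_setC (hc _ _ _ : approx_set C1)))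
    (hc _ _ _ : approx_set Cb))).
  apply/seteqP; split => x [h cx]; split => //; have := cx i; rewrite in_itv/= => /andP[x1 x2];
    move: h; rewrite /S2/C1/Cb/= sE !addr0 !mulN1r !mul1r ltrN2 oppr_gt0.
    case=> [[xs|xc] xb].
      have x0 : x 0 i < 0.
        rewrite ltNge; apply/negP => x0; have := sin_ge0_pi (x := x 0 i).
        by rewrite x0 ltW// => /(_ isT); lra.
      move: xb; rewrite -(cosN b) -(cosN (x 0 i)) cos_ltE; [lra| |];
        by apply/andP; split; lra.
    have [->|x3] := eqVneq (x 0 i) (- pi); first by lra.
    exfalso; apply: xc; apply: cosgt; rewrite x2 andbT lt_neqAle x1 andbT eq_sym//.
  move=> xb; split; last first.
    by rewrite -(cosN b) -(cosN (x 0 i)) cos_ltE; [lra| |]; apply/andP; split; lra.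
  have [->|x3] := eqVneq (x 0 i) (- pi); first by right; rewrite cosN cospi ltxx.
  by left; apply: sinneg; rewrite lt_neqAle x1 andbT eq_sym x3/=; lra.
apply: (approx_set_ext mray _ (approx_setC (approx_setI (hc _ _ _ : approx_set S1) (approx_setC (hc _ _ _ : approx_set Cb'))))).
apply/seteqP; split => x [h cx]; split => //; have := cx i; rewrite in_itv/= => /andP[x1 x2];
  move: h; rewrite /S1/Cb'/= sE !addr0 !mul1r.
  move=> h; rewrite ltNge; apply/negP => xb; apply: h; split.
    by apply: sin_gt0_pi; apply/andP; split; lra.
  by rewrite cos_ltE; [lra| |]; apply/andP; split; lra.
move=> xb [xs]; rewrite cos_ltE.
- by apply.
- apply/andP; split; last lra.
  rewrite leNgt; apply/negP => x0.
  have [x3|x3] := eqVneq (x 0 i) (- pi); first by move: xs; rewrite x3 sinN sinpi oppr0 ltxx.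
  have := sinneg (x 0 i); rewrite x0 lt_neqAle x1 andbT eq_sym x3 => /(_ isT); lra.
- by apply/andP; split; lra.
Qed.

Lemma approx_set_measurable (A : set V) : measurable A -> approx_set A.
Proof.
suff H : @measurable _ V `<=` approx_set by exact: H.
have ss := approx_set_sigma.
apply: smallest_sub => // B; rewrite -bigcup_seq => -[i _ [C mC <-]]; rewrite setTI.
suff H : measurable `<=` [set C : set (measurableTypeR R) | approx_set ((fun v : V => v 0 i) @^-1` C)] by exact: H.
rewrite [X in X `<=` _](@RGenInftyO.measurableE R).
apply: smallest_sub.
  split.
  - by rewrite /= preimage_set0; exact: approx_set0.
  - by move=> D hD; rewrite /= setTD preimage_setC; exact: approx_setC.
  - by move=> F hF; rewrite /= preimage_bigcup; exact: approx_set_bigcup.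
move=> D [x ->] /=.
have := approx_set_ray i x; congr approx_set; apply/seteqP; split => y; rewrite /preimage/= in_itv//.
Qed.

Import HBNNSimple.

Lemma bounded_approx_nnsfun (g : {nnsfun V >-> R}) : bounded_approx g.
Proof.
suff H (s : seq R) m : bounded_approx (fun x => \sum_(i < m) (s`_i * \1_(g @^-1` [set s`_i]) x)).
  by rewrite (funext (fimfunEord g)); exact: H.
elim: m => [|m IH].
  rewrite (_ : (fun _ => _) = fun=> 0); first exact: bounded_approx_cst.
  by apply/funext => x; rewrite big_ord0.
rewrite (_ : (fun _ => _) = fun x => \sum_(i < m) (s`_i * \1_(g @^-1` [set s`_i]) x) +
   s`_m * \1_(g @^-1` [set s`_m]) x).
  apply: bounded_approxD => //; apply: bounded_approxZ.
  by have [] : approx_set (g @^-1` [set s`_m]) by apply: approx_set_measurable.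
by apply/funext => x; rewrite big_ord_recr.
Qed.

Lemma apx_ge0 f : square_integrable f -> (forall x, 0 <= f x) -> trig_approx f.
Proof.
move=> sf f0; have [mf _] := sf.
have mE : measurable_fun [set: V] (EFin \o f) by exact/measurable_EFinP.
have fE0 x : [set: V] x -> (0 <= (EFin \o f) x)%E by move=> _; rewrite lee_fin.
pose g := nnsfun_approx measurableT mE.
have cg x : (fun j => g j x) @ \oo --> f x.
  have := cvg_nnsfun_approx measurableT mE fE0 (I : [set: V] x).
  by move=> /fine_cvgP[_]; exact.
have gf j x : g j x <= f x.
  rewrite -(cvg_lim _ (cg x))//; apply: nondecreasing_cvgn_le; last by apply/cvg_ex; eexists; exact: cg.
  by move=> a b ab; have /lefP := nd_nnsfun_approx measurableT mE ab.
apply: (apx_cvg (fs := g) (g := f)) => //.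
- by move=> j; apply: sqi_bnd; have [] := bounded_approx_nnsfun (g j).
- by move=> j; have [] := bounded_approx_nnsfun (g j).
- by move=> j x _; rewrite ger0_norm ?subr_ge0// gerBl; exact: fun_ge0.
Qed.

Lemma apx_sqi f : square_integrable f -> trig_approx f.
Proof.
move=> sf; have [mf cf] := sf.
have sp (h : V -> R) : square_integrable h -> square_integrable (fun x => Num.max (h x) 0).
  move=> [mh ch]; have mm : measurable_fun setT (fun x => Num.max (h x) 0).
    by apply: measurable_maxr.
  split => //; apply: (ic_le _ ch) => [|x _]; first exact: measurable_funX.
  rewrite ger0_norm ?sqr_ge0//; case: (leP (h x) 0) => _ //.
  by rewrite expr0n sqr_ge0.
have sm := sqiZ (-1) (sp _ (sqiZ (-1) sf)).
have := @apxD (fun x => Num.max (f x) 0) (fun x => -1 * Num.max (-1 * f x) 0) (sp _ sf) sm.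
rewrite (_ : (fun x => Num.max (f x) 0 + _) = f); last first.
  apply/funext => x; rewrite !mulN1r.
  case: (leP (f x) 0) => h; case: (leP (- f x) 0) => h'; lra.
apply=> //.
  by apply: apx_ge0; [exact: sp|move=> x; rewrite le_max lexx orbT].
have a' : trig_approx (fun x => Num.max (-1 * f x) 0).
  by apply: apx_ge0; [exact/sp/sqiZ|move=> x; rewrite le_max lexx orbT].
move=> e e0; have [N [p [tp fp]]] := a' _ e0.
exists N, (fun x => -1 * p x); split; first exact: tspanZ.
have s' := sqiB (sp _ (sqiZ (-1) sf)) (sqi_tspan tp).
have := nrm2Z (-1) s'; rewrite sqrrN expr1n mul1r => h.
rewrite (nrm2_ext (w := fun x => -1 * (Num.max (-1 * f x) 0 - p x))) ?h//.
by move=> x _ /=; ring.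
Qed.

(** The partial power is at least the squared norm minus the squared distance to any
trigonometric polynomial of the same degree. *)
Lemma parseval v e : square_integrable v -> 0 < e ->
  exists N, forall M, (N <= M)%N -> sqnorm v <= partial_power M v + e.
Proof.
move=> sv e0; have [N [p [tp vp]]] := apx_sqi sv e0.
exists N => M NM; apply: (le_trans (psq_best sv tp)).
by rewrite lerD// psq_mono.
Qed.

End density.

(** * Finite differences and their Fourier coefficients *)

Section calculus.
Context {R : realType}.
Implicit Types (f g : R -> R) (a b x y t : R).

Lemma le_of_derive_ge0 f f' a b : a <= b ->
  (forall x, a <= x <= b -> is_derive x 1 f (f' x)) ->
  (forall x, a <= x <= b -> 0 <= f' x) -> f a <= f b.
Proof.
move=> ab df f0.
have cf : {within `[a, b], continuous f}.
  apply: derivable_within_continuous => x; rewrite in_itv/= => h.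
  by case: (df _ h).
have [c cab ->] : exists2 c, c \in `[a, b] & f b = f a + f' c * (b - a).
  have := @MVT_segment R f f' a b ab.
  case => [x h|//|c cab e]; last by exists c => //; rewrite -e; ring.
  by apply: df; move: h; rewrite in_itv/= => /andP[h1 h2]; rewrite !ltW.
by rewrite lerDl mulr_ge0 ?subr_ge0// f0//; move: cab; rewrite in_itv.
Qed.

Lemma sin_le_id x : 0 <= x -> sin x <= x.
Proof.
move=> x0; pose f y : R := y - sin y.
suff : f 0 <= f x by rewrite /f sin0 subr0 subr_ge0.
apply: (@le_of_derive_ge0 _ (fun y => 1 - cos y)) => // y _.
Qed.

Lemma cos_ge_quad x : 1 - cos x <= x ^+ 2 / 2.
Proof.
wlog x0 : x / 0 <= x => [h|].
  by have [/h//|/ltW x0] := leP 0 x; have := h (- x); rewrite oppr_ge0 cosN sqrrN; apply.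
pose f y : R := 2^-1 * y ^+ 2 + cos y.
suff : f 0 <= f x by rewrite /f cos0 expr0n mulr0 add0r; lra.
apply: (@le_of_derive_ge0 _ (fun y => y - sin y)) => // y /andP[y0 _].
  by apply: is_derive_eq; rewrite -[_ *: _]/(_ * _) -[_ *: _]/(_ * _); lra.
by rewrite subr_ge0 sin_le_id.
Qed.

Lemma cos_le_quad x : `|x| <= 1 -> x ^+ 2 / 4 <= 1 - cos x.
Proof.
wlog x0 : x / 0 <= x => [h|].
  by have [/h//|/ltW x0] := leP 0 x; have := h (- x); rewrite oppr_ge0 cosN sqrrN normrN; apply.
rewrite ger0_norm// => x1.
have sinb y : 0 <= y <= 1 -> y / 2 <= sin y.
  move=> /andP[y0 y1]; pose f y : R := sin y - 2^-1 * y.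
  suff : f 0 <= f y by rewrite /f sin0 mulr0 subr0; lra.
  apply: (@le_of_derive_ge0 _ (fun y => cos y - 2^-1)) => // z /andP[z0 z1].
    by apply: is_derive_eq; rewrite -[_ *: _]/(_ * _); lra.
  by have := cos_ge_quad z; nra.
pose f y : R := - cos y - 4^-1 * y ^+ 2.
suff : f 0 <= f x by rewrite /f cos0 expr0n mulr0 subr0; lra.
apply: (@le_of_derive_ge0 _ (fun y => sin y - y / 2)) => // y /andP[y0 y1].
  by apply: is_derive_eq; rewrite -[_ *: _]/(_ * _) -[_ *: _]/(_ * _); lra.
by rewrite subr_ge0 sinb// y0/=; lra.
Qed.

End calculus.

Section differences.
Context {R : realType} {n : nat}.
Local Notation V := 'rV[R]_n.
Local Notation lattice := {ffun 'I_n -> int}.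
Implicit Types (k l : lattice) (x y z : V) (t : R) (u v w : V -> R).
Local Notation II f := (\int[leb R n]_(x in cell) f x).

Lemma L2_sqi u : L2 u -> square_integrable u.
Proof. by case. Qed.

(** Tested against a phase, the weak derivative multiplies the coefficient by the
monomial in k and turns the phase by multiples of pi / 2, which the power ignores. *)
Lemma pw_weak_derivative (a : 'I_n -> nat) u v k : L2 u -> L2_derivative a u v ->
  fourier_power k v = (\prod_i (k i)%:~R ^+ a i) ^+ 2 * fourier_power k u.
Proof.
move=> Lu [Lv wd]; have [su sv] := (L2_sqi Lu, L2_sqi Lv).
pose s := (\sum_i a i)%N; pose P : R := \prod_i (k i)%:~R ^+ a i.
have E t : fourier_coef k t v = (-1) ^+ s * P * fourier_coef k (t + s%:R * (pi / 2)) u.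
  have := wd _ (test_torus_ph k t); rewrite mderiv_ph -/P -/s.
  have -> : II (fun x => u x * (P * phase k (t + s%:R * (pi / 2)) x)) =
      P * fourier_coef k (t + s%:R * (pi / 2)) u.
    rewrite /fourier_coef -IIZ; last exact/sqi_ic/sqi_ph.
    by apply: eq_Rintegral => x _; rewrite mulrCA.
  by rewrite -mulrA => ->; rewrite mulrA -exprD addnn -signr_odd odd_double expr0 mul1r.
rewrite {1}/fourier_power !E add0r (addrC (pi / 2)) -(pw_phase k (s%:R * (pi / 2)) su).
by rewrite !exprMn -exprM mulnC exprM sqrrN expr1n expr1n mul1r -mulrDr.
Qed.

Definition fdiff z v x : R := v (x + z) - v x.

Lemma dif_periodic z v : torus_periodic v -> torus_periodic (fdiff z v).
Proof. by move=> pv x i; rewrite /fdiff pv addrAC pv. Qed.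

Lemma sqi_dif z v : torus_periodic v -> square_integrable v -> square_integrable (fdiff z v).
Proof. by move=> pv sv; apply: sqiB => //; exact: sqi_shift. Qed.

Lemma pw_dif k z v : torus_periodic v -> square_integrable v ->
  fourier_power k (fdiff z v) = 2 * (1 - cos (lattice_dot k z)) * fourier_power k v.
Proof.
move=> pv sv; have ss := sqi_shift z pv sv.
have E t : fourier_coef k t (fdiff z v) = fourier_coef k (t - lattice_dot k z) v - fourier_coef k t v.
  by rewrite /fdiff coefB// coef_shift.
rewrite /fourier_power !E !(coef_split k (_ - _))// cosB sinB cosB sinB.
rewrite cos0 sin0 cos_pihalf sin_pihalf.
have := cos2Dsin2 (lattice_dot k z); set c := cos _; set s := sin _ => cs.
set a := fourier_coef k 0 v; set b := fourier_coef k _ v.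
rewrite (_ : _ + _ = (c ^+ 2 + s ^+ 2 + 1 - 2 * c) * (a ^+ 2 + b ^+ 2)); last by ring.
by rewrite cs; congr (_ * _); ring.
Qed.

Definition fdiff3 z v := fdiff z (fdiff z (fdiff z v)).

Lemma sqi_dif3 z v : torus_periodic v -> square_integrable v -> square_integrable (fdiff3 z v).
Proof.
move=> pv sv; apply: sqi_dif; first by do 2 apply: dif_periodic.
by apply: sqi_dif; [exact: dif_periodic|exact: sqi_dif].
Qed.

Lemma pw_dif3 k z v : torus_periodic v -> square_integrable v ->
  fourier_power k (fdiff3 z v) = (2 * (1 - cos (lattice_dot k z))) ^+ 3 * fourier_power k v.
Proof.
move=> pv sv; have p1 := dif_periodic z pv; have s1 := sqi_dif z pv sv.
have p2 := dif_periodic z p1; have s2 := sqi_dif z p1 s1.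
by rewrite /fdiff3 !pw_dif// !mulrA; congr (_ * _); ring.
Qed.

Lemma pw_dif3_le k i h v : torus_periodic v -> square_integrable v ->
  fourier_power k (fdiff3 (h *: delta_mx 0 i) v) <= (h * (k i)%:~R) ^+ 6 * fourier_power k v.
Proof.
move=> pv sv; rewrite pw_dif3// ler_wpM2r ?pw_ge0//.
rewrite ldotZr ldot_delta (exprM _ 2 3) lerXn2r ?nnegrE ?sqr_ge0//.
by have := cos_ge_quad (h * (k i)%:~R); lra.
Qed.

Lemma pw_dif3_ge k i h v : torus_periodic v -> square_integrable v -> `|h * (k i)%:~R| <= 1 ->
  (h * (k i)%:~R) ^+ 6 * fourier_power k v <= 8 * fourier_power k (fdiff3 (h *: delta_mx 0 i) v).
Proof.
move=> pv sv hk; rewrite pw_dif3// mulrA ler_wpM2r ?pw_ge0//.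
rewrite ldotZr ldot_delta (exprM _ 2 3) (_ : 8 = 2 ^+ 3); last by ring.
rewrite -exprMn lerXn2r ?nnegrE ?sqr_ge0//.
by have := cos_le_quad hk; lra.
Qed.

(** Mode by mode, the third difference multiplies a coefficient by at most |h k_i|^3,
which is the factor of the weak derivative times h^3. *)
Lemma dif3_le_weak i h u v : L2 u -> L2_derivative (fun j => if j == i then 3%N else 0%N) u v ->
  sqnorm (fdiff3 (h *: delta_mx 0 i) u) <= h ^+ 6 * sqnorm v.
Proof.
move=> Lu Dv; have [pu mu iu] := Lu; have [Lv _] := Dv.
have su := L2_sqi Lu; have sv := L2_sqi Lv.
apply/ler_addgt0Pr => e e0.
have [N hN] := parseval (sqi_dif3 (h *: delta_mx 0 i) pu su) e0.
apply: (le_trans (hN N (leqnn N))); rewrite lerD2r.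
apply: (@le_trans _ _ (h ^+ 6 * partial_power N v)); last first.
  by rewrite ler_wpM2l ?bessel// (exprM _ 2 3) exprn_ge0// sqr_ge0.
rewrite /partial_power mulrCA ler_pM2l ?invr_gt0 ?vol_gt0// mulr_sumr ler_sum// => k _.
apply: (le_trans (pw_dif3_le _ _ _ pu su)).
rewrite (pw_weak_derivative k Lu Dv) (bigD1 i)//= eqxx big1 ?mulr1; last first.
  by move=> j /negPf ->; rewrite expr0.
by rewrite le_eqVlt; apply/orP; left; apply/eqP; ring.
Qed.

End differences.

(** * Third differences control the third order Sobolev norm *)

Section sobolev_norm.
Context {R : realType} {n : nat}.
Local Notation V := 'rV[R]_n.
Local Notation lattice := {ffun 'I_n -> int}.
Implicit Types (k l : lattice) (x y z : V) (t : R) (u v w : V -> R).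
Local Notation II f := (\int[leb R n]_(x in cell) f x).

Local Notation torus_volume := (@torus_volume R n).

Lemma wderivP m (a : 'I_n -> nat) u : Sobolev m u -> (\sum_i a i <= m)%N ->
  L2_derivative a u (wderiv a u).
Proof. by move=> [_ h] am; apply: xgetPex; exact: h. Qed.

Lemma Hnorm_Sobolev m u : (Hnorm m u < +oo)%E -> Sobolev m u.
Proof. by rewrite /Hnorm; case: asboolP. Qed.

Lemma Hnorm_component m (a : {ffun 'I_n -> 'I_m.+1}) u B : 0 <= B ->
  Sobolev m u -> (\sum_i a i <= m)%N -> (Hnorm m u <= B%:E)%E ->
  sqnorm (wderiv (fun i => a i) u) <= B ^+ 2.
Proof.
move=> B0 Su am; rewrite /Hnorm asboolT// lee_fin.
set S := \sum_(a | _) _ => h.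
have S0 : 0 <= S by apply: sumr_ge0 => b _; exact: nrm2_ge0.
have hS : S <= B ^+ 2.
  by rewrite -(sqr_sqrtr S0) lerXn2r ?nnegrE ?sqrtr_ge0.
apply: le_trans hS; rewrite /S (bigD1 a)//= lerDl.
by apply: sumr_ge0 => b _; exact: nrm2_ge0.
Qed.

(** Each |k_i| is at most the sixth root of the right-hand side, and at most three factors
occur. *)
Lemma mono_le_sum6 (a : 'I_n -> nat) k : (\sum_i a i <= 3)%N ->
  (\prod_i (k i)%:~R ^+ a i) ^+ 2 <= 1 + \sum_i (k i)%:~R ^+ 6 :> R.
Proof.
move=> a3; set S : R := 1 + _.
have p6 i : 0 <= (k i)%:~R ^+ 6 :> R by rewrite (exprM _ 2 3) exprn_ge0// sqr_ge0.
have S1 : 1 <= S by rewrite lerDl sumr_ge0.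
have S0 : 0 <= S by exact: le_trans S1.
rewrite -(@ler_pXn2r _ 3)// ?nnegrE ?sqr_ge0//.
rewrite -exprM -prodrXl.
apply: (@le_trans _ _ (\prod_i S ^+ a i)).
  apply: ler_prod => i _; rewrite -exprM mulnC exprM.
  rewrite (_ : (2 * 3)%N = 6%N)// exprn_ge0//= lerXn2r ?nnegrE//.
  by rewrite /S (bigD1 i)//= addrCA lerDl addr_ge0// sumr_ge0.
rewrite prodrXr; exact: ler_weXn2l.
Qed.

Lemma nrm2_le_psq v B : square_integrable v -> (forall N, partial_power N v <= B) -> sqnorm v <= B.
Proof.
move=> sv h; apply/ler_addgt0Pr => e e0.
have [N hN] := parseval sv e0.
by rewrite (le_trans (hN N (leqnn N)))// lerD2r.
Qed.

(** For |h k_i| <= 1 a third difference sees at least a fixed fraction of |h k_i|^6 times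
the power of the mode, so taking h = 1 / N bounds the sum of k_i^6 times the power over
the cube of size N uniformly in N. The factor 4^n counts the multi-indices. *)
Lemma Hnorm3_le u B0 B : Sobolev 3 u -> 0 <= B -> sqnorm u <= B0 ->
  (forall i h, 0 < h -> sqnorm (fdiff3 (h *: delta_mx 0 i) u) <= h ^+ 6 * B) ->
  (Hnorm 3 u <= (Num.sqrt (4 ^+ n * (B0 + 8 * n%:R * B)))%:E)%E.
Proof.
move=> Su B0' hB0 hB; have [Lu _] := Su; have su := L2_sqi Lu; have [pu _ _] := Lu.
rewrite /Hnorm asboolT// lee_fin ler_wsqrtr//.
have H (a : 'I_n -> nat) : (\sum_i a i <= 3)%N ->
    sqnorm (wderiv a u) <= B0 + 8 * n%:R * B.
  move=> a3; have Da := wderivP Su a3; have [La _] := Da.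
  apply: (nrm2_le_psq (L2_sqi La)) => N.
  have k6 i : torus_volume^-1 * \sum_(k <- cube N) (k i)%:~R ^+ 6 * fourier_power k u <= 8 * B.
    pose h : R := N.+1%:R^-1.
    have h0 : 0 < h by rewrite invr_gt0.
    rewrite -(ler_pM2l (exprn_gt0 6 h0)) [leRHS]mulrCA.
    apply: (@le_trans _ _ (8 * partial_power N (fdiff3 (h *: delta_mx 0 i) u))); last first.
      rewrite ler_pM2l//; apply: (le_trans _ (hB i h h0)); apply: bessel.
      exact: sqi_dif3.
    rewrite /partial_power mulrCA [leRHS]mulrCA ler_pM2l ?invr_gt0 ?vol_gt0//.
    rewrite !mulr_sumr big_seq [leRHS]big_seq ler_sum// => k.
    rewrite mem_cube => /forallP/(_ i) kN; rewrite mulrA -exprMn.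
    apply: pw_dif3_ge => //; rewrite normrM gtr0_norm// ler_pdivrMl// mulr1.
    by rewrite -intr_norm (le_trans (_ : _ <= N%:~R))// ?ler_int// -pmulrn ler_nat.
  rewrite /partial_power; under eq_bigr => k _ do rewrite (pw_weak_derivative k Lu Da).
  apply: (@le_trans _ _ (torus_volume^-1 * \sum_(k <- cube N)
     (fourier_power k u + \sum_i (k i)%:~R ^+ 6 * fourier_power k u))).
    rewrite ler_pM2l ?invr_gt0 ?vol_gt0// ler_sum// => k _.
    rewrite -mulr_suml -{2}[fourier_power k u]mul1r -mulrDl ler_wpM2r ?pw_ge0//.
    exact: mono_le_sum6.
  rewrite big_split/= mulrDr lerD//; first exact: le_trans (bessel N su) hB0.
  rewrite exchange_big/= mulr_sumr.
  apply: (le_trans (ler_sum _ (fun i _ => k6 i))).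
  by rewrite sumr_const card_ord -[(8 * B) *+ n]mulr_natr [leRHS]mulrAC.
apply: (@le_trans _ _ (\sum_(a : {ffun 'I_n -> 'I_4} | (\sum_i a i <= 3)%N)
    (B0 + 8 * n%:R * B))); first by apply: ler_sum => a; exact: H.
have q0 : 0 <= B0 + 8 * n%:R * B.
  by rewrite addr_ge0 ?(le_trans _ hB0) ?nrm2_ge0// !mulr_ge0.
rewrite big_mkcond; set c := B0 + _ in q0 *.
apply: (@le_trans _ _ (\sum_(a : {ffun 'I_n -> 'I_4}) c)).
  by apply: ler_sum => a _; case: ifP.
by rewrite sumr_const card_ffun !card_ord -[c *+ _]mulr_natl natrX.
Qed.

End sobolev_norm.

(** * Pointwise chain rule for third differences *)

Section taylor.
Context {R : realType}.
Implicit Types (a b c e x y B G M p q r s t : R).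

Lemma mvt_between (h h' : R -> R) a y : (forall x, is_derive x 1 h (h' x)) ->
  exists2 xi, `|xi - a| <= `|y - a| & h y - h a = h' xi * (y - a) /\ (Num.min a y <= xi <= Num.max a y).
Proof.
move=> dh.
have cf u v : {within `[u, v], continuous h}.
  by apply: derivable_within_continuous => x _; case: (dh x).
have [ay|/ltW ya] := leP a y.
  have [xi + e] := MVT_segment ay (fun x _ => dh x) (cf a y).
  rewrite in_itv/= => /andP[x1 x2]; exists xi; last by rewrite x1 x2.
  by rewrite !ger0_norm ?subr_ge0// lerD2r.
have [xi + e] := MVT_segment ya (fun x _ => dh x) (cf y a).
rewrite in_itv/= => /andP[x1 x2]; exists xi.
  by rewrite !ler0_norm ?subr_le0// lerN2 lerD2r.
by rewrite x1 x2; split => //; rewrite -[LHS]opprB e; ring.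
Qed.

(** The mean value theorem; applied to a remainder three times, from the third derivative
down, it replaces an iterated integral in the Taylor formula. *)
Lemma growth_step (h h' : R -> R) a y B (k : nat) : h a = 0 ->
  (forall x, is_derive x 1 h (h' x)) ->
  (forall x, Num.min a y <= x <= Num.max a y -> `|h' x| <= B * `|x - a| ^+ k) -> 0 <= B ->
  `|h y| <= B * `|y - a| ^+ k.+1.
Proof.
move=> h0 dh hb B0; have [xi x1 [e x2]] := mvt_between a y dh.
rewrite -[h y]subr0 -h0 e normrM exprSr mulrA ler_wpM2r//.
by rewrite (le_trans (hb _ x2))// ler_wpM2l// lerXn2r ?nnegrE.
Qed.

Lemma between_itv a y x M : `|a| <= M -> `|y| <= M ->
  Num.min a y <= x <= Num.max a y -> `|x| <= M.
Proof.
rewrite !ler_norml => /andP[a1 a2] /andP[y1 y2].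
by case: (leP a y) => ay /andP[x1 x2]; apply/andP; split; lra.
Qed.

Lemma taylor3 (g g1 g2 g3 : R -> R) M G :
  (forall x, is_derive x 1 g (g1 x)) -> (forall x, is_derive x 1 g1 (g2 x)) ->
  (forall x, is_derive x 1 g2 (g3 x)) ->
  (forall x, `|x| <= M -> `|g3 x| <= G) -> 0 <= G ->
  forall a y, `|a| <= M -> `|y| <= M ->
  `|g y - g a - g1 a * (y - a) - g2 a / 2 * (y - a) ^+ 2| <= G * `|y - a| ^+ 3.
Proof.
move=> d0 d1 d2 hG G0 a y aM yM.
have bt x z : `|z| <= M -> Num.min a z <= x <= Num.max a z -> `|x| <= M.
  by move=> zM; exact: between_itv.
have s2 z : `|z| <= M -> `|g2 z - g2 a| <= G * `|z - a| ^+ 1.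
  move=> zM; apply: (@growth_step (fun x => g2 x - g2 a) g3) => //; rewrite ?subrr//.
    by move=> x; apply: is_derive_eq; rewrite subr0.
  by move=> x /(bt _ _ zM) xM; rewrite expr0 mulr1 hG.
have s1 z : `|z| <= M -> `|g1 z - g1 a - g2 a * (z - a)| <= G * `|z - a| ^+ 2.
  move=> zM; apply: (@growth_step (fun x => g1 x - g1 a - g2 a * (x - a)) (fun x => g2 x - g2 a)) => //.
  - by rewrite !subrr mulr0 subrr.
  - by move=> x; apply: is_derive_eq; rewrite -[_ *: _]/(_ * _); ring.
  - by move=> x /(bt _ _ zM) xM; exact: s2.
apply: (@growth_step (fun x => g x - g a - g1 a * (x - a) - g2 a / 2 * (x - a) ^+ 2)
  (fun x => g1 x - g1 a - g2 a * (x - a))) => //.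
- by rewrite !subrr mulr0 expr0n mulr0 !subrr.
- by move=> x; apply: is_derive_eq; rewrite -![_ *: _]/(_ * _); field.
- by move=> x /(bt _ _ yM) xM; exact: s1.
Qed.

Lemma continuous_bounded_itv (g : R -> R) M : continuous g ->
  exists G, 0 <= G /\ forall x, `|x| <= M -> `|g x| <= G.
Proof.
move=> cg; have [M0|M0] := leP 0 M; last first.
  by exists 0; split => // x xM; have := normr_ge0 x; lra.
have : compact ((fun x => `|g x|) @` `[- M, M]).
  apply: continuous_compact; last exact: segment_compact.
  apply: continuous_subspaceT => x; apply: cvg_norm; exact: cg.
move=> /compact_bounded[G [_ hG]]; exists (`|G| + 1); split; first by rewrite addr_ge0.
move=> x; rewrite ler_norml => xM.
have := hG (`|G| + 1); rewrite (le_lt_trans (ler_norm G)) ?ltrDl// => /(_ isT (`|g x|)).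
by rewrite /= normr_id; apply; exists x => //; rewrite /= in_itv.
Qed.

End taylor.

Section pointwise.
Context {R : realType}.
Implicit Types (a b c e x y B G M p q r s t X Y : R).

Lemma young21 X Y : 0 <= X -> 0 <= Y -> X ^+ 2 * Y <= X ^+ 3 / 4 + 16 * Y ^+ 3.
Proof.
move=> X0 Y0; have [h|h] := leP (4 * Y) X.
  have p1 : 0 <= X ^+ 2 * (X - 4 * Y) by rewrite mulr_ge0 ?sqr_ge0//; lra.
  have p2 : 0 <= Y ^+ 3 by exact: exprn_ge0.
  by move: p1; rewrite !exprS !expr0 in p2 *; lra.
have p1 : 0 <= Y * (4 * Y - X) * (4 * Y + X) by rewrite !mulr_ge0//; lra.
have p2 : 0 <= X ^+ 3 by exact: exprn_ge0.
by move: p1; rewrite !exprS !expr0 in p2 *; lra.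
Qed.

Lemma young_cube X Y : 0 <= X -> 0 <= Y -> X ^+ 2 * Y <= X ^+ 3 + Y ^+ 3.
Proof.
move=> X0 Y0; have [h|h] := leP Y X.
  have p1 : 0 <= X ^+ 2 * (X - Y) by rewrite mulr_ge0 ?sqr_ge0//; lra.
  have p2 : 0 <= Y ^+ 3 by exact: exprn_ge0.
  by move: p1; rewrite !exprS !expr0 in p2 *; lra.
have p1 : 0 <= Y * (Y - X) * (Y + X) by rewrite !mulr_ge0//; lra.
have p2 : 0 <= X ^+ 3 by exact: exprn_ge0.
by move: p1; rewrite !exprS !expr0 in p2 *; lra.
Qed.

Lemma pow5_diff a b : `|a ^+ 5 - b ^+ 5| <= 5 / 2 * (a ^+ 4 + b ^+ 4) * `|a - b|.
Proof.
rewrite (_ : a ^+ 5 - b ^+ 5 = (a ^+ 4 + a ^+ 3 * b + a ^+ 2 * b ^+ 2 + a * b ^+ 3 + b ^+ 4) * (a - b)); last by ring.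
rewrite normrM ler_wpM2r// ler_norml; apply/andP.
have e1 : 0 <= (a - b) ^+ 2 * (a ^+ 2 + a * b + b ^+ 2).
  by rewrite mulr_ge0 ?sqr_ge0//; have := sqr_ge0 (a + b); have := sqr_ge0 a; have := sqr_ge0 b; lra.
have e2 : 0 <= (a + b) ^+ 2 * (a ^+ 2 - a * b + b ^+ 2).
  by rewrite mulr_ge0 ?sqr_ge0//; have := sqr_ge0 (a - b); have := sqr_ge0 a; have := sqr_ge0 b; lra.
have e3 : 0 <= (a ^+ 2 - b ^+ 2) ^+ 2 by exact: sqr_ge0.
have e4 : 0 <= (a ^+ 2 + b ^+ 2) ^+ 2 by exact: sqr_ge0.
have e5 : 0 <= (a ^+ 2) ^+ 2 by exact: sqr_ge0.
have e6 : 0 <= (b ^+ 2) ^+ 2 by exact: sqr_ge0.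
by split; lra.
Qed.

Lemma absq_diff a b : `|(`|a| * a - `|b| * b)| <= (`|a| + `|b|) * `|a - b|.
Proof.
wlog ab : a b / b <= a => [h|].
  have [/h//|/ltW/h] := leP b a; rewrite -normrN opprB (distrC b a) (addrC `|b|); exact.
rewrite (ger0_norm (_ : 0 <= a - b)) ?subr_ge0// ler_norml.
have [a0|a0] := leP 0 a; have [b0|b0] := leP 0 b;
  rewrite ?(ger0_norm a0) ?(ltr0_norm a0) ?(ger0_norm b0) ?(ltr0_norm b0).
- by apply/andP; split; nra.
- by apply/andP; split; nra.
- by lra.
- by apply/andP; split; nra.
Qed.

End pointwise.

Section chain_rule.
Context {R : realType}.
Implicit Types (a b c e x y B G M p q r s t X Y : R).

Lemma sum4_sq a b c d : (a + b + c + d) ^+ 2 <= 4 * (a ^+ 2 + b ^+ 2 + c ^+ 2 + d ^+ 2) :> R.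
Proof.
have := sqr_ge0 (a - b); have := sqr_ge0 (a - c); have := sqr_ge0 (a - d).
have := sqr_ge0 (b - c); have := sqr_ge0 (b - d); have := sqr_ge0 (c - d); lra.
Qed.

Lemma cube_sum2 a b : 0 <= a -> 0 <= b -> (a + b) ^+ 3 <= 4 * (a ^+ 3 + b ^+ 3).
Proof.
move=> a0 b0; have : 0 <= (a - b) ^+ 2 * (a + b) by rewrite mulr_ge0 ?sqr_ge0 ?addr_ge0.
by rewrite !exprS !expr0; lra.
Qed.

(** Apart from g'(c0) r, the third difference of g along four points is made of products
p q and of cubes in p, q, r. The right-hand side is what interpolation can absorb, and
bounded quantities are traded for lower powers through |p|, |q|, |r| <= 8 M. *)
Lemma third_difference_chain (g : R -> R) M G (g1 g2 : R -> R) : 1 <= M -> 0 <= G ->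
  (forall x, `|x| <= M -> `|g1 x| <= G) -> (forall x, `|x| <= M -> `|g2 x| <= G) ->
  (forall a y, `|a| <= M -> `|y| <= M ->
    `|g y - g a - g1 a * (y - a) - g2 a / 2 * (y - a) ^+ 2| <= G * `|y - a| ^+ 3) ->
  forall c0 c1 c2 c3 : R, `|c0| <= M -> `|c1| <= M -> `|c2| <= M -> `|c3| <= M ->
  forall p q r, p = c1 - c0 -> q = (c2 - c1) - (c1 - c0) ->
  r = (c3 - c2 - (c2 - c1)) - (c2 - c1 - (c1 - c0)) ->
  (g c3 - g c2 - (g c2 - g c1) - (g c2 - g c1 - (g c1 - g c0))) ^+ 2 <=
  20 * (G * (2000 * M ^+ 2)) ^+ 2 * M * (r ^+ 2 + `|q| ^+ 3 + p ^+ 6).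
Proof.
move=> M1 G0 h1 h2 tay c0 c1 c2 c3 m0 m1 m2 m3 p q r pE qE rE.
have M0 : 0 <= M by lra.
pose a := `|p|; pose b := `|q|; pose e := `|r|.
have a0 : 0 <= a by exact: normr_ge0.
have b0 : 0 <= b by exact: normr_ge0.
have e0 : 0 <= e by exact: normr_ge0.
have aM : a <= 2 * M by rewrite /a pE (le_trans (ler_normB _ _))//; lra.
have bM : b <= 4 * M.
  rewrite /b qE (le_trans (ler_normB _ _))// (le_trans (lerD (ler_normB _ _) (ler_normB _ _)))//; lra.
have eM : e <= 8 * M.
  rewrite /e rE (le_trans (ler_normB _ _))//.
  rewrite (le_trans (lerD (ler_normB _ _) (ler_normB _ _)))//.
  rewrite (le_trans (lerD (lerD (ler_normB _ _) (ler_normB _ _)) (lerD (ler_normB _ _) (ler_normB _ _))))//; lra.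
pose E c := g c - g c0 - g1 c0 * (c - c0) - g2 c0 / 2 * (c - c0) ^+ 2.
have E1 : `|E c1| <= G * a ^+ 3 by rewrite /a pE; exact: tay.
have E2 : `|E c2| <= G * (4 * (8 * a ^+ 3 + b ^+ 3)).
  apply: (le_trans (tay _ _ m0 m2)); rewrite ler_wpM2l//.
  apply: (@le_trans _ _ ((2 * a + b) ^+ 3)).
    rewrite lerXn2r ?nnegrE ?addr_ge0// ?mulr_ge0//.
    rewrite (_ : c2 - c0 = 2 * p + q); last by rewrite qE pE; ring.
    by rewrite (le_trans (ler_normD _ _))// normrM gtr0_norm.
  by rewrite (le_trans (cube_sum2 _ _))// ?mulr_ge0// exprMn; lra.
have E3 : `|E c3| <= G * (16 * (27 * a ^+ 3 + 27 * b ^+ 3 + e ^+ 3)).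
  apply: (le_trans (tay _ _ m0 m3)); rewrite ler_wpM2l//.
  apply: (@le_trans _ _ ((3 * a + (3 * b + e)) ^+ 3)).
    rewrite lerXn2r ?nnegrE ?addr_ge0// ?mulr_ge0//.
    rewrite (_ : c3 - c0 = 3 * p + (3 * q + r)); last by rewrite rE qE pE; ring.
    rewrite (le_trans (ler_normD _ _))// normrM gtr0_norm// lerD2l.
    by rewrite (le_trans (ler_normD _ _))// normrM gtr0_norm.
  have b3 : 0 <= 3 * b by rewrite mulr_ge0.
  have a3 : 0 <= 3 * a by rewrite mulr_ge0.
  have := cube_sum2 a3 (addr_ge0 b3 e0); have := cube_sum2 b3 e0.
  have := exprn_ge0 3 a0.
  by rewrite (exprMn 3 3 b) (exprMn 3 3 a); lra.
have D : g c3 - g c2 - (g c2 - g c1) - (g c2 - g c1 - (g c1 - g c0)) =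
   g1 c0 * r + g2 c0 / 2 * (6 * q ^+ 2 + r ^+ 2 + 6 * p * q + 6 * p * r + 6 * q * r) +
   (E c3 - 3 * E c2 + 3 * E c1).
  by rewrite /E rE qE pE; field.
have k : `|g c3 - g c2 - (g c2 - g c1) - (g c2 - g c1 - (g c1 - g c0))| <=
    G * (2000 * M ^+ 2 * (e + a * b + b ^+ 2 + a ^+ 3)).
  rewrite D (le_trans (ler_normD _ _))//.
  have t1 : `|g1 c0 * r + g2 c0 / 2 * (6 * q ^+ 2 + r ^+ 2 + 6 * p * q + 6 * p * r + 6 * q * r)| <=
      G * (e + 2^-1 * (6 * b ^+ 2 + e ^+ 2 + 6 * (a * b) + 6 * (a * e) + 6 * (b * e))).
    rewrite (le_trans (ler_normD _ _))// [leRHS]mulrDr lerD//.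
      by rewrite normrM ler_wpM2r// h1.
    rewrite -[g2 c0 / 2 * _]mulrA normrM ler_pM//; first by rewrite h2.
    rewrite normrM gtr0_norm ?invr_gt0// ler_pM2l ?invr_gt0//.
    have n2 x y : - (`|x| * `|y|) <= x * y <= `|x| * `|y| by rewrite -ler_norml normrM.
    have := n2 p q; have := n2 p r; have := n2 q r; rewrite -/a -/b -/e.
    have -> : b ^+ 2 = q ^+ 2 by rewrite real_normK ?num_real.
    have -> : e ^+ 2 = r ^+ 2 by rewrite real_normK ?num_real.
    have := sqr_ge0 q; have := sqr_ge0 r.
    move=> s1 s2 /andP[u1 u2] /andP[u3 u4] /andP[u5 u6].
    rewrite ler_norml; apply/andP; split; lra.
  have t2 : `|E c3 - 3 * E c2 + 3 * E c1| <= G * (16 * (27 * a ^+ 3 + 27 * b ^+ 3 + e ^+ 3) +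
      3 * (4 * (8 * a ^+ 3 + b ^+ 3)) + 3 * a ^+ 3).
    have n3 z : `|3 * z| = 3 * `|z| :> R by rewrite normrM gtr0_norm.
    have := ler_normB (E c3) (3 * E c2); have := ler_normD (E c3 - 3 * E c2) (3 * E c1).
    rewrite !n3; move: E1 E2 E3; move: (E c1) (E c2) (E c3) => x1 x2 x3; lra.
  rewrite (le_trans (lerD t1 t2))// -mulrDr ler_wpM2l//.
  have q1 : e ^+ 2 <= 8 * M * e by rewrite expr2 ler_wpM2r.
  have q2 : a * e <= 2 * M * e by rewrite ler_wpM2r.
  have q3 : b * e <= 4 * M * e by rewrite ler_wpM2r.
  have q4 : b ^+ 3 <= 4 * M * b ^+ 2 by rewrite exprS ler_wpM2r// sqr_ge0.
  have q5 : e ^+ 3 <= 64 * M ^+ 2 * e.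
    rewrite exprS mulrC ler_wpM2r// (_ : 64 * M ^+ 2 = (8 * M) ^+ 2); last by ring.
    by rewrite lerXn2r ?nnegrE// mulr_ge0.
  have MM : M <= M ^+ 2 by rewrite expr2 ler_peMl.
  have q6 : M * e <= M ^+ 2 * e by rewrite ler_wpM2r.
  have q7 : e <= M ^+ 2 * e by rewrite ler_peMl//; lra.
  have q8 : b ^+ 2 <= M ^+ 2 * b ^+ 2 by rewrite ler_peMl ?sqr_ge0//; lra.
  have q9 : M * b ^+ 2 <= M ^+ 2 * b ^+ 2 by rewrite ler_wpM2r ?sqr_ge0.
  have qa : a * b <= M ^+ 2 * (a * b) by rewrite ler_peMl ?mulr_ge0//; lra.
  have qb : a ^+ 3 <= M ^+ 2 * a ^+ 3 by rewrite ler_peMl ?exprn_ge0//; lra.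
  have qc : 0 <= a ^+ 3 by exact: exprn_ge0.
  have qd : 0 <= a * b by exact: mulr_ge0.
  have qe : 0 <= M ^+ 2 * b ^+ 2 by rewrite mulr_ge0// sqr_ge0.
  have qf : 0 <= M ^+ 2 * e by rewrite mulr_ge0// sqr_ge0.
  lra.
rewrite -real_normK ?num_real//.
pose K := G * (2000 * M ^+ 2); pose W := e + a * b + b ^+ 2 + a ^+ 3.
have K0 : 0 <= K := mulr_ge0 G0 (mulr_ge0 (ler0n _ _) (sqr_ge0 M)).
have W0 : 0 <= W.
  exact: (addr_ge0 (addr_ge0 (addr_ge0 e0 (mulr_ge0 a0 b0)) (sqr_ge0 b)) (exprn_ge0 3 a0)).
have kW : G * (2000 * M ^+ 2 * W) = K * W by rewrite /K mulrA.
rewrite -/W kW in k; rewrite -/K.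
apply: (@le_trans _ _ ((K * W) ^+ 2)).
  apply: lerXn2r; rewrite ?nnegrE; [exact: normr_ge0|exact: mulr_ge0|exact: k].
move: K K0 k kW => K K0 _ _.
rewrite exprMn (_ : 20 * K ^+ 2 * M * (r ^+ 2 + `|q| ^+ 3 + p ^+ 6) =
  K ^+ 2 * (20 * M * (r ^+ 2 + `|q| ^+ 3 + p ^+ 6))); last by ring.
apply: (ler_wpM2l (sqr_ge0 K)); apply: (le_trans (sum4_sq _ _ _ _)).
have -> : r ^+ 2 = e ^+ 2 by rewrite real_normK ?num_real.
have -> : p ^+ 6 = a ^+ 6.
  by rewrite (exprM p 2 3) (exprM a 2 3) /a real_normK ?num_real.
have w1 : (a * b) ^+ 2 <= b ^+ 3 + a ^+ 6.
  rewrite exprMn mulrC (exprM a 2 3); apply: young_cube => //; exact: sqr_ge0.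
have w2 : (b ^+ 2) ^+ 2 <= 4 * M * b ^+ 3.
  by rewrite (_ : (b ^+ 2) ^+ 2 = b * b ^+ 3); [exact: (ler_wpM2r (exprn_ge0 3 b0))|ring].
have w3 : (a ^+ 3) ^+ 2 = a ^+ 6 by ring.
have w4 : 0 <= a ^+ 6 by exact: exprn_ge0.
have w5 : 0 <= b ^+ 3 by exact: exprn_ge0.
have w6 : b ^+ 3 <= M * b ^+ 3 by rewrite ler_peMl.
have w7 : e ^+ 2 <= M * e ^+ 2 by rewrite ler_peMl// sqr_ge0.
have w8 : a ^+ 6 <= M * a ^+ 6 by rewrite ler_peMl.
have w9 : 0 <= M * e ^+ 2 by rewrite mulr_ge0// sqr_ge0.
rewrite /b in w1 w2 w5 w6 *; lra.
Qed.

End chain_rule.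

(** * Moser estimate for third differences *)

Section moser.
Context {R : realType} {n : nat}.
Local Notation V := 'rV[R]_n.
Implicit Types (x y z : V) (u v w c : V -> R) (M B : R).
Local Notation II f := (\int[leb R n]_(x in cell) f x).

Definition bounded_torus_fun u := bounded_measurable u /\ torus_periodic u.

Lemma tfun_shift z u : bounded_torus_fun u -> bounded_torus_fun (fun x => u (x + z)).
Proof.
move=> [[mu [B hB]] pu]; split; last by move=> x i; rewrite addrAC pu.
split; last by exists B.
apply: (measurableT_comp mu); apply: measurable_rowvector => i.
under eq_fun do rewrite mxE.
by apply: measurable_funD => //; exact: measurable_coord.
Qed.

Lemma tfunD u v : bounded_torus_fun u -> bounded_torus_fun v -> bounded_torus_fun (fun x => u x + v x).
Proof.
move=> [bu pu] [bv pv]; split; first exact: bnddD.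
by move=> x i; rewrite pu pv.
Qed.

Lemma tfunM u v : bounded_torus_fun u -> bounded_torus_fun v -> bounded_torus_fun (fun x => u x * v x).
Proof.
move=> [bu pu] [bv pv]; split; first exact: bnddM.
by move=> x i; rewrite pu pv.
Qed.

Lemma tfun_cst B : bounded_torus_fun (fun _ : V => B).
Proof. by split => //; exact: bndd_cst. Qed.

Lemma tfunB u v : bounded_torus_fun u -> bounded_torus_fun v -> bounded_torus_fun (fun x => u x - v x).
Proof.
move=> tu tv; rewrite (_ : (fun _ => _) = fun x => u x + -1 * v x).
  by apply: tfunD => //; apply: tfunM => //; exact: tfun_cst.
by apply/funext => x; rewrite mulN1r.
Qed.

Lemma tfunX u m : bounded_torus_fun u -> bounded_torus_fun (fun x => u x ^+ m).
Proof.
move=> tu; elim: m => [|m IH]; first exact: tfun_cst.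
rewrite (_ : (fun _ => _) = fun x => u x * u x ^+ m); first exact: tfunM.
by apply/funext => x; rewrite exprS.
Qed.

Lemma tfun_norm u : bounded_torus_fun u -> bounded_torus_fun (fun x => `|u x|).
Proof.
move=> [[mu [B hB]] pu]; split; last by move=> x i; rewrite pu.
split; first exact: measurableT_comp.
by exists B => x; rewrite normr_id.
Qed.

Lemma tfun_dif z u : bounded_torus_fun u -> bounded_torus_fun (fdiff z u).
Proof. by move=> tu; apply: tfunB => //; exact: tfun_shift. Qed.

Lemma ic_tfun u : bounded_torus_fun u -> cell_integrable u.
Proof. by case=> bu _; exact: ic_bnd. Qed.

Lemma sqi_tfun u : bounded_torus_fun u -> square_integrable u.
Proof. by case=> bu _; exact: sqi_bnd. Qed.

Lemma II_shift z u : bounded_torus_fun u -> II (fun x => u (x + z)) = II u.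
Proof. by case=> [[mu _] pu]; exact: integral_torusD. Qed.

Lemma II_dif_parts z u v : bounded_torus_fun u -> bounded_torus_fun v ->
  II (fun x => fdiff z u x * v x) = - II (fun x => u (x + z) * fdiff z v x).
Proof.
move=> tu tv; have [tu' tv'] := (tfun_shift z tu, tfun_shift z tv).
have c1 := ic_tfun (tfunM tu' tv); have c2 := ic_tfun (tfunM tu tv).
have c3 := ic_tfun (tfunM tu' tv').
transitivity (II (fun x => u (x + z) * v x) - II (fun x => u x * v x)).
  by rewrite -IIB//; apply: eq_Rintegral => x _; rewrite mulrBl.
transitivity (- (II (fun x => u (x + z) * v (x + z)) - II (fun x => u (x + z) * v x))).
  by rewrite (II_shift z (tfunM tu tv)); ring.
by rewrite -IIB//; congr (- _); apply: eq_Rintegral => x _; rewrite /fdiff mulrBr.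
Qed.

Lemma II_le_tfun u v : bounded_torus_fun u -> bounded_torus_fun v -> (forall x, u x <= v x) -> II u <= II v.
Proof. by move=> tu tv h; apply: II_le; [exact: ic_tfun|exact: ic_tfun|move=> x _]. Qed.

(** Write p^6 = p^5 * (difference of c) and sum by parts: the difference falls on p^5, which
costs p^4 times the second difference, and c itself is bounded by M. Young's inequality
then absorbs the sixth powers. *)
Lemma gagliardo6 z c M : bounded_torus_fun c -> (forall x, `|c x| <= M) -> 0 <= M ->
  II (fun x => fdiff z c x ^+ 6) <=
  1000 * M ^+ 3 * II (fun x => `|fdiff z (fdiff z c) x| ^+ 3).
Proof.
move=> tc hM M0; set p := fdiff z c; set q := fdiff z p.
have tp : bounded_torus_fun p by exact: tfun_dif.
have tq : bounded_torus_fun q by exact: tfun_dif.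
have tp' := tfun_shift z tp.
have E : II (fun x => p x ^+ 6) = - II (fun x => c (x + z) * fdiff z (fun y => p y ^+ 5) x).
  by rewrite -II_dif_parts//; exact: tfunX.
have t6 := tfunX 6 tp; have t6' := tfunX 6 tp'.
have t3 := tfunX 3 (tfun_norm tq).
have L : II (fun x => p x ^+ 6) <=
    II (fun x => 4^-1 * (p (x + z) ^+ 6 + p x ^+ 6) + 500 * M ^+ 3 * `|q x| ^+ 3).
  rewrite E -mulN1r -IIZ; last first.
    by apply: ic_tfun; apply: tfunM; [exact: tfun_shift|apply: tfun_dif; exact: tfunX].
  apply: II_le_tfun.
  - apply: tfunM; first exact: tfun_cst.
    by apply: tfunM; [exact: tfun_shift|apply: tfun_dif; exact: tfunX].
  - by apply: tfunD; apply: tfunM; [exact: tfun_cst|exact: tfunD|exact: tfun_cst|].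
  move=> x; rewrite /fdiff mulN1r (le_trans (ler_norm _))// normrN normrM.
  apply: (@le_trans _ _ (M * (5 / 2 * (p (x + z) ^+ 4 + p x ^+ 4) * `|q x|))).
    by rewrite ler_pM//; exact: pow5_diff.
  have y a : a ^+ 4 * (5 / 2 * M * `|q x|) <= a ^+ 6 / 4 + 250 * M ^+ 3 * `|q x| ^+ 3.
    have := @young21 R (a ^+ 2) (5 / 2 * M * `|q x|) (sqr_ge0 _).
    rewrite !mulr_ge0// => /(_ isT); rewrite -!exprM.
    by rewrite !exprMn; lra.
  by have := y (p (x + z)); have := y (p x); lra.
move: L; rewrite IID; last 2 first.
- by apply: ic_tfun; apply: tfunM; [exact: tfun_cst|exact: tfunD].
- by apply: ic_tfun; apply: tfunM; [exact: tfun_cst|].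
rewrite !IIZ; last 2 first.
- by apply: ic_tfun; exact: tfunD.
- exact: ic_tfun.
rewrite IID; [|exact: ic_tfun|exact: ic_tfun].
rewrite (II_shift z (tfunX 6 tp)); lra.
Qed.

(** The same argument one order higher: |q|^3 is |q| q times the difference of p, and
summing by parts leaves p, q and the third difference, where [gagliardo6] bounds the
sixth powers of p. *)
Lemma gagliardo3 z c M : bounded_torus_fun c -> (forall x, `|c x| <= M) -> 0 <= M ->
  II (fun x => `|fdiff z (fdiff z c) x| ^+ 3) <=
  4 * (1 + 1000 * M ^+ 3) * sqnorm (fdiff3 z c).
Proof.
move=> tc hM M0; have g6 := gagliardo6 z tc hM M0.
move: g6; rewrite /fdiff3; set p := fdiff z c; set q := fdiff z p; set r := fdiff z q => g6.
have tp : bounded_torus_fun p by exact: tfun_dif.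
have tq : bounded_torus_fun q by exact: tfun_dif.
have tr : bounded_torus_fun r by exact: tfun_dif.
have tp' := tfun_shift z tp; have tq' := tfun_shift z tq.
have [L LE L1] : exists2 L, L = 1 + 1000 * M ^+ 3 & 1 <= L.
  by exists (1 + 1000 * M ^+ 3) => //; have := exprn_ge0 3 M0; lra.
rewrite -LE; have {}g6 : II (fun x => p x ^+ 6) <= (L - 1) * II (fun x => `|q x| ^+ 3).
  by rewrite LE addrC addKr.
move: L1 {LE} => L1.
pose phi x := `|q x| * q x.
have tphi : bounded_torus_fun phi by apply: tfunM => //; exact: tfun_norm.
have E : II (fun x => `|q x| ^+ 3) = - II (fun x => p (x + z) * fdiff z phi x).
  rewrite -II_dif_parts//; apply: eq_Rintegral => x _.
  by rewrite -/q /phi exprSr -normrX ger0_norm ?sqr_ge0// mulrC; case: (ger0P (q x)) => _; ring.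
have t6 := tfunX 6 tp; have t6' := tfunX 6 tp'.
have t3 := tfunX 3 (tfun_norm tq); have t3' := tfunX 3 (tfun_norm tq').
have t2 := tfunX 2 tr.
pose F x := 2 * L * r x ^+ 2 + (4 * L)^-1 * (`|q (x + z)| ^+ 3 + `|q x| ^+ 3) +
  (2 * L)^-1 * p (x + z) ^+ 6.
have tZ k u : bounded_torus_fun u -> bounded_torus_fun (fun x => k * u x).
  by move=> tu; apply: tfunM => //; exact: tfun_cst.
have H : II (fun x => `|q x| ^+ 3) <= II F.
  rewrite E -mulN1r -IIZ; last by apply/ic_tfun/tfunM => //; exact: tfun_dif.
  apply: II_le_tfun.
  - by apply: tZ; apply: tfunM => //; exact: tfun_dif.
  - by do 2 (apply: tfunD; last by apply: tZ => //; exact: tfunD); exact: tZ.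
  move=> x; rewrite /F mulN1r (le_trans (ler_norm _))// normrN normrM.
  set P := p (x + z); set Q' := q (x + z); set Q := q x; set S := r x.
  have h1 : `|fdiff z phi x| <= (`|Q'| + `|Q|) * `|S| by exact: absq_diff.
  apply: (le_trans (ler_wpM2l (normr_ge0 P) h1)).
  have y a : 0 <= a -> `|P| * (a * `|S|) <= L * S ^+ 2 + (4 * L)^-1 * (a ^+ 3 + P ^+ 6).
    move=> a0; have L4 : 0 < 4 * L by lra.
    rewrite -(ler_pM2l L4) [leRHS]mulrDr mulVKf ?lt0r_neq0//.
    have y1 := @young_cube R a (P ^+ 2) a0 (sqr_ge0 _).
    have y2 := sqr_ge0 (2 * L * `|S| - `|P| * a).
    have eS : `|S| ^+ 2 = S ^+ 2 by rewrite real_normK ?num_real.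
    have eP : `|P| ^+ 2 = P ^+ 2 by rewrite real_normK ?num_real.
    rewrite -exprM in y1.
    have -> : 4 * L * (`|P| * (a * `|S|)) =
      4 * L ^+ 2 * `|S| ^+ 2 + `|P| ^+ 2 * a ^+ 2 - (2 * L * `|S| - `|P| * a) ^+ 2 by ring.
    have -> : 4 * L * (L * S ^+ 2) = 4 * L ^+ 2 * S ^+ 2 by ring.
    rewrite eS eP; rewrite mulrC in y1; lra.
  have h2 := y _ (normr_ge0 Q'); have h3 := y _ (normr_ge0 Q).
  have -> : (2 * L)^-1 = 2 * (4 * L)^-1 :> R by field; rewrite gt_eqF//; lra.
  lra.
have HF : II F = 2 * L * II (fun x => r x ^+ 2) +
   (4 * L)^-1 * (2 * II (fun x => `|q x| ^+ 3)) + (2 * L)^-1 * II (fun x => p x ^+ 6).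
  rewrite /F IID; [|apply: ic_tfun|apply: ic_tfun; exact: tZ]; last first.
    by apply: tfunD; apply: tZ => //; exact: tfunD.
  rewrite IID; [|by apply: ic_tfun; exact: tZ|by apply: ic_tfun; apply: tZ; exact: tfunD].
  rewrite !IIZ; [|exact: ic_tfun|by apply: ic_tfun; exact: tfunD|exact: ic_tfun].
  rewrite IID; [|exact: ic_tfun|exact: ic_tfun].
  rewrite (II_shift z (tfunX 3 (tfun_norm tq))) (II_shift z (tfunX 6 tp)); ring.
move: H; rewrite HF /sqnorm.
set Q := II (fun x => `|q x| ^+ 3); set S := II (fun x => r x ^+ 2).
set P := II (fun x => p x ^+ 6) in g6 *.
have Q0 : 0 <= Q by apply: II_ge0 => x _; exact: exprn_ge0.
move: (g6 : P <= (L - 1) * Q) => hP hQ.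
have e1 : (4 * L)^-1 * (2 * Q) = (2 * L)^-1 * Q.
  by field; rewrite gt_eqF//; lra.
rewrite e1 in hQ.
have L2 : 0 < 2 * L by lra.
have hQ' : 2 * L * Q <= 2 * L * (2 * L * S) + Q + P.
  have := ler_wpM2l (ltW L2) hQ; rewrite !mulrDr !mulVKf ?lt0r_neq0//.
have : L * Q <= L * (4 * L * S) by lra.
by rewrite ler_pM2l//; lra.
Qed.

Lemma smoothR_is_derive (f : R -> R) m (t : R) : smoothR f ->
  is_derive t 1 (derive1n m f) (derive1n m.+1 f t).
Proof.
by move=> sf; apply: DeriveDef; [exact: sf|rewrite derive1nS derive1E].
Qed.

Lemma smoothR_continuous (f : R -> R) m : smoothR f -> continuous (derive1n m f).
Proof.
move=> sf t; apply: differentiable_continuous; apply/derivable1_diffP.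
exact: sf.
Qed.

Lemma tfun_comp (g : R -> R) u : continuous g -> bounded_torus_fun u -> bounded_torus_fun (g \o u).
Proof.
move=> cg [[mu [B hB]] pu]; split; last by move=> x i; rewrite /= pu.
split; first exact: (measurableT_comp (continuous_measurable_fun cg)).
have [G [_ hG]] := continuous_bounded_itv B cg.
by exists G => x; exact: hG.
Qed.

Lemma moser (f : R -> R) M : smoothR f -> 1 <= M ->
  exists2 C, 0 <= C & forall c z, bounded_torus_fun c -> (forall x, `|c x| <= M) ->
  sqnorm (fdiff3 z (derive1 f \o c)) <= C * sqnorm (fdiff3 z c).
Proof.
move=> sf M1; have M0 : 0 <= M by lra.
have cg m : continuous (derive1n m f) by exact: smoothR_continuous.
have [G1 [G10 h1]] := continuous_bounded_itv M (cg 2).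
have [G2 [G20 h2]] := continuous_bounded_itv M (cg 3).
have [G3 [G30 h3]] := continuous_bounded_itv M (cg 4).
pose G := G1 + G2 + G3.
have G0 : 0 <= G by rewrite /G; lra.
have k1 (x : R) : `|x| <= M -> `|derive1n 2 f x| <= G by move=> /h1; rewrite /G; lra.
have k2 (x : R) : `|x| <= M -> `|derive1n 3 f x| <= G by move=> /h2; rewrite /G; lra.
have k3 (x : R) : `|x| <= M -> `|derive1n 4 f x| <= G by move=> /h3; rewrite /G; lra.
have tay := taylor3 (fun x : R => @smoothR_is_derive f 1 x sf)
  (fun x : R => @smoothR_is_derive f 2 x sf) (fun x : R => @smoothR_is_derive f 3 x sf) k3 G0.
have chain := third_difference_chain M1 G0 k1 k2 tay.
move: chain; set K := 20 * _ * M => chain.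
have K0 : 0 <= K := mulr_ge0 (mulr_ge0 (ler0n R 20) (sqr_ge0 _)) M0.
move: K K0 chain => K K0 chain.
have [Q Q1 QE] : exists2 Q, 0 <= Q & Q = 1000 * M ^+ 3.
  exists (1000 * M ^+ 3); [exact: (mulr_ge0 (ler0n R 1000) (exprn_ge0 3 M0))|reflexivity].
exists (K * (1 + 4 * (1 + Q) + Q * (4 * (1 + Q)))).
  by rewrite mulr_ge0// !addr_ge0// ?mulr_ge0// addr_ge0.
move=> c z tc cM.
have g6 := gagliardo6 z tc cM M0; have g3 := gagliardo3 z tc cM M0.
rewrite -QE in g6 g3; move: Q Q1 {QE} g6 g3 => Q Q1 g6 g3.
have tp := tfun_dif z tc; have tq := tfun_dif z tp; have tr := tfun_dif z tq.
have tg := tfun_comp (cg 1) tc.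
have tg3 := tfun_dif z (tfun_dif z (tfun_dif z tg)).
pose W x := fdiff3 z c x ^+ 2 + `|fdiff z (fdiff z c) x| ^+ 3 + fdiff z c x ^+ 6.
have t2 : bounded_torus_fun (fun x => fdiff3 z c x ^+ 2) := tfunX 2 tr.
have t3 := tfunX 3 (tfun_norm tq); have t6 := tfunX 6 tp.
have tW : bounded_torus_fun W by apply: tfunD => //; exact: tfunD.
have : sqnorm (fdiff3 z (derive1 f \o c)) <= K * II W.
  rewrite -IIZ; last exact: ic_tfun.
  apply: II_le_tfun.
  - exact: tfunX.
  - by apply: tfunM => //; exact: tfun_cst.
  move=> x; rewrite /W /fdiff3 /fdiff /=.
  have := chain (c x) (c (x + z)) (c (x + z + z)) (c (x + z + z + z)) (cM _) (cM _) (cM _) (cM _).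
  by move=> /(_ _ _ _ erefl erefl erefl).
have -> : II W = sqnorm (fdiff3 z c) + II (fun x => `|fdiff z (fdiff z c) x| ^+ 3) + II (fun x => fdiff z c x ^+ 6).
  rewrite /W IID; [|by apply: ic_tfun; exact: tfunD|exact: ic_tfun].
  by rewrite IID; [|exact: ic_tfun|exact: ic_tfun].
move: g6 g3; move: (II (fun x => fdiff z c x ^+ 6)) (II (fun x => `|fdiff z (fdiff z c) x| ^+ 3)) (sqnorm (fdiff3 z c)) => P Q3 S g6 g3 h.
rewrite (le_trans h)// -mulrA ler_wpM2l//.
have : Q * Q3 <= Q * (4 * (1 + Q) * S) by rewrite ler_wpM2l.
lra.
Qed.

End moser.

(** * The nonlocal operator: Dirichlet form, symbol and coercivity *)

Section nonlocal.
Context {R : realType} {n : nat}.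
Local Notation V := 'rV[R]_n.
Local Notation lattice := {ffun 'I_n -> int}.
Implicit Types (k l : lattice) (x y z : V) (u v w phi J : V -> R).
Local Notation II f := (\int[leb R n]_(x in cell) f x).
Local Notation mu := (leb R n).
Local Notation D := (@cell R n).
Local Notation torus_volume := (@torus_volume R n).
Let mD : measurable D := measurable_cell.

Lemma ic_indic f : measurable_fun setT f -> cell_integrable f <->
  mu.-integrable setT (EFin \o (fun x => f x * \1_D x)).
Proof.
move=> mf; rewrite /cell_integrable (integrable_mkcond _ mD).
rewrite (_ : (EFin \o f) \_ D = EFin \o (fun x => f x * \1_D x))//.
apply/funext => x; rewrite patchE/= indicE; case: ifPn => h; first by rewrite mulr1.
by rewrite mulr0.
Qed.

Lemma II_indic f : II f = \int[mu]_x (f x * \1_D x).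
Proof.
rewrite Rintegral_mkcond; apply: eq_Rintegral => x _.
by rewrite patchE/= indicE; case: ifPn => h; [rewrite mulr1|rewrite mulr0].
Qed.

Lemma EII f : cell_integrable f -> (\int[mu]_(x in D) (f x)%:E = (II f)%:E)%E.
Proof. by move=> cf; rewrite /Rintegral fineK//; exact: integrable_fin_num. Qed.

Lemma EII_indic f c : measurable_fun setT f -> cell_integrable f ->
  (\int[mu]_x (f x * \1_D x * c)%:E = (II f * c)%:E)%E.
Proof.
move=> mf cf; rewrite II_indic.
under eq_integral do rewrite mulrC EFinM.
have i1 := (ic_indic mf).1 cf.
rewrite integralZl//= mulrC EFinM /Rintegral fineK//.
exact: integrable_fin_num.
Qed.

(** The bound by an integrable function of [z] alone suffices since the cell has finite
measure in the variable [x]. *)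
Lemma fubini_cell J (H : V -> V -> R) B : measurable_fun setT J -> cell_integrable J ->
  (forall z, 0 <= J z) ->
  measurable_fun setT (fun p : V * V => H p.1 p.2) ->
  (forall x z, `|H x z| <= B * J z) ->
  [/\ cell_integrable (fun x => II (H x)), cell_integrable (fun z => II (fun x => H x z)) &
      II (fun x => II (H x)) = II (fun z => II (fun x => H x z))].
Proof.
move=> mJ cJ J0 mH HB.
have m1D : measurable_fun setT (\1_D : V -> R) by exact: measurable_indic.
pose F (p : V * V) := H p.1 p.2 * \1_D p.2 * \1_D p.1.
have mF : measurable_fun setT F.
  apply: measurable_funM; last by apply: measurableT_comp => //; exact: measurable_fst.
  by apply: measurable_funM => //; apply: measurableT_comp => //; exact: measurable_snd.
have mEF : measurable_fun setT (EFin \o F) by exact/measurable_EFinP.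
have mHx x : measurable_fun setT (H x).
  by apply: (measurableT_comp mH (g := pair x)); exact: measurable_pair1.
have mHz z : measurable_fun setT (H ^~ z).
  by apply: (measurableT_comp mH (g := fun x => (x, z))); exact: measurable_pair2.
have cHx x : cell_integrable (H x) by apply: (ic_le (mHx x) (icZ B cJ)) => z _; exact: HB.
have cHz z : cell_integrable (H ^~ z).
  by apply: ic_bnd; split => //; exists (B * J z) => x; exact: HB.
have IF : (mu \x mu)%E.-integrable setT (EFin \o F).
  apply/integrable12ltyP => //.
  apply: (@le_lt_trans _ _ (\int[mu]_x (II (fun z => B * J z) * \1_D x)%:E)%E).
    apply: ge0_le_integral => //.
    - by move=> x _; exact: integral_ge0.
    - apply: (@measurable_fun_fubini_tonelli_F _ _ _ _ _ mu (fun p => `|(F p)%:E|)%E) => //.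
      exact: measurableT_comp.
    - by apply/measurable_EFinP; exact: measurable_funM.
    move=> x _; rewrite -EII_indic//; [|exact: measurable_funM|exact: icZ].
    apply: ge0_le_integral => //.
    - apply/measurable_EFinP/measurableT_comp => //.
      by apply: (measurableT_comp mF (g := pair x)); exact: measurable_pair1.
    - by apply/measurable_EFinP; do 2 apply: measurable_funM => //; exact: measurable_funM.
    - by move=> z _; rewrite lee_fin /F/= !normrM !(@ger0_norm _ (\1_D _)) ?indicE ?ler0n// !ler_wpM2r.
  have c1 : cell_integrable (fun _ : V => II (fun z => B * J z)) by exact: ic_bnd (bndd_cst _).
  under eq_integral do rewrite -[_ * \1_D _]mulr1.
  by rewrite (@EII_indic (fun=> _) 1)// ltry.
have eF x : (fubini_F mu (EFin \o F) x) = (II (H x) * \1_D x)%:E.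
  by rewrite /fubini_F -EII_indic//.
have eG z : (fubini_G mu (EFin \o F) z) = (II (H ^~ z) * \1_D z)%:E.
  rewrite /fubini_G -EII_indic//; apply: eq_integral => x _.
  by rewrite /F /= mulrAC.
have iF := integrable_fubini_F IF.
have E := Fubini IF.
split.
- rewrite /cell_integrable (integrable_mkcond _ mD).
  rewrite [X in _.-integrable _ X](_ : _ = fubini_F mu (EFin \o F)); first exact: iF.
  apply/funext => x; rewrite eF patchE/= indicE; case: ifPn => h; first by rewrite mulr1.
  by rewrite mulr0.
- apply: (le_integrable mD _ _ (icZ (B * torus_volume) cJ)).
    apply: (@eq_measurable_fun _ _ _ _ D (fubini_G mu (EFin \o F))).
      by move=> z zD; rewrite eG /= indicE zD mulr1.
    by apply: measurable_funTS; exact: measurable_fubini_G IF.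
  move=> z _ /=; rewrite lee_fin.
  apply: (@le_trans _ _ (II (fun x => `|H x z|))); first exact: le_normr_Rintegral (cHz z).
  apply: (@le_trans _ _ (II (fun _ : V => B * J z))).
    apply: II_le; last by move=> x _; exact: HB.
      by apply: ic_le (ic_bnd (bndd_cst (B * J z))) _; [exact: measurableT_comp|
        move=> x _; rewrite normr_id].
    exact: ic_bnd (bndd_cst _).
  rewrite II_cst mulrAC; exact: ler_norm.
rewrite !II_indic /Rintegral; congr fine.
transitivity (\int[mu]_x (fubini_F mu (EFin \o F) x))%E.
  by apply: eq_integral => x _; rewrite eF.
by rewrite /fubini_F E; apply: eq_integral => z _; rewrite -eG.
Qed.

Lemma measurable_subrv : measurable_fun setT (fun p : V * V => p.1 - p.2).
Proof.
apply: measurable_rowvector => i.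
under eq_fun do rewrite !mxE.
apply: measurable_funB.
  by apply: (measurableT_comp (@measurable_coord R n i)); exact: measurable_fst.
by apply: (measurableT_comp (@measurable_coord R n i)); exact: measurable_snd.
Qed.

Lemma tfunN_arg u (x : V) : bounded_torus_fun u -> bounded_torus_fun (fun z => u (x - z)).
Proof.
move=> [[mu [B hB]] pu]; split; last first.
  move=> z i; rewrite -[in LHS](pu _ i); congr u; apply/rowP => j; rewrite !mxE; ring.
split; last by exists B.
apply: (measurableT_comp mu).
by apply: (measurableT_comp measurable_subrv (g := pair x)); exact: measurable_pair1.
Qed.

Variables (rho : R -> R -> R).
Hypothesis hrho : kernel_family n rho.

Lemma kernel_ge0 eta z : 0 < eta -> 0 <= @kernel_J R n rho eta z.
Proof. by move=> e0; rewrite divr_ge0 ?sqr_ge0// (rho_ge0 hrho). Qed.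

Lemma measurable_kernel eta : 0 < eta -> measurable_fun setT (@kernel_J R n rho eta).
Proof.
by move=> e0; have [/measurable_int] := kernel_W11 hrho e0; move/measurable_EFinP.
Qed.

Lemma ic_kernel eta : 0 < eta -> cell_integrable (@kernel_J R n rho eta).
Proof.
move=> e0; have [h _] := kernel_W11 hrho e0.
by apply: integrableS h.
Qed.

Lemma ic_kernelM eta u : 0 < eta -> bounded_measurable u -> cell_integrable (fun z => kernel_J rho eta z * u z).
Proof.
move=> e0 [mu [B hB]]; apply: (ic_le _ (icZ B (ic_kernel e0))).
  by apply: measurable_funM => //; exact: measurable_kernel.
by move=> z _; rewrite normrM mulrC (ger0_norm (kernel_ge0 _ e0)) ler_wpM2r// kernel_ge0.
Qed.

Lemma cell_rep_shift (z : V) i : cell_rep (z + (2 * pi) *: delta_mx 0 i) = cell_rep z.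
Proof.
rewrite cell_repE; apply/rowP => j; rewrite !mxE.
case: (j == i); last by rewrite mulr0 addr0.
exact: (wrap_shift _ 1).
Qed.

(** Translation and reflection on the torus; in this form the operator is an average of
differences of [phi], which makes positivity and commutation with translations
evident. *)
Lemma nonlocal_opE eta phi x : 0 < eta -> bounded_torus_fun phi -> nonlocal_op rho eta phi x =
  II (fun z => kernel_J rho eta z * (phi x - phi (x - z))).
Proof.
move=> e0 tp.
pose F z := kernel_J rho eta (cell_rep z) * (phi x - phi (x - z)).
have tq := tfunN_arg x tp.
transitivity (II (fun y => F (x - y))).
  apply: eq_Rintegral => y _; rewrite /F /periodic_extension; congr (_ * (_ - phi _)).
  by rewrite opprB addrC subrK.
rewrite integral_torusB; last first.
- by move=> z i; rewrite /F cell_rep_shift (tq.2 z i).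
- apply: measurable_funM.
    by apply: (measurableT_comp (measurable_kernel e0)); exact: measurable_cell_rep.
  by apply: measurable_funB => //; case: tq.1.
by apply: eq_Rintegral => z; rewrite inE => zD; rewrite /F cell_rep_id.
Qed.

(** Fubini's theorem moves the kernel outside; for fixed [z] the inner product of [v] with
v - v(. - z) is half the squared norm of that difference, by translation
invariance. *)
Lemma dirichlet eta v : 0 < eta -> bounded_torus_fun v ->
  cell_integrable (fun x => v x * nonlocal_op rho eta v x) /\
  II (fun x => v x * nonlocal_op rho eta v x) =
  II (fun z => kernel_J rho eta z * (2^-1 * sqnorm (fdiff (- z) v))) /\
  cell_integrable (fun z => kernel_J rho eta z * (2^-1 * sqnorm (fdiff (- z) v))).
Proof.
move=> e0 tv; have [[mv [B hB]] pv] := tv.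
have mJ := measurable_kernel e0; have cJ := ic_kernel e0.
have J0 z : 0 <= @kernel_J R n rho eta z by exact: kernel_ge0.
have cJM u : bounded_measurable u -> cell_integrable (fun z => kernel_J rho eta z * u z) by exact: ic_kernelM.
have nlE x := nonlocal_opE x e0 tv.
set J := kernel_J rho eta in mJ cJ J0 cJM nlE *; clearbody J.
pose H x z := J z * (v x * (v x - v (x - z))).
have [||c1 c2 E] := @fubini_cell J H (B * (B + B)) mJ cJ J0.
- apply: measurable_funM.
    by apply: (measurableT_comp mJ); exact: measurable_snd.
  apply: measurable_funM.
    by apply: (measurableT_comp mv); exact: measurable_fst.
  apply: measurable_funB.
    by apply: (measurableT_comp mv); exact: measurable_fst.
  by apply: (measurableT_comp mv); exact: measurable_subrv.
- move=> x z; rewrite /H normrM ger0_norm// mulrC ler_wpM2r// normrM ler_pM//.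
  by rewrite (le_trans (ler_normB _ _))// lerD.
have E1 : (fun x => v x * nonlocal_op rho eta v x) = (fun x => II (H x)).
  apply/funext => x; rewrite nlE.
  transitivity (II (fun z => v x * (J z * (v x - v (x - z))))).
    symmetry; apply: IIZ; apply: cJM.
    exact: (tfunB (tfun_cst (v x)) (tfunN_arg x tv)).1.
  by apply: eq_Rintegral => z _; rewrite /H; ring.
have E2 : (fun z => J z * (2^-1 * sqnorm (fdiff (- z) v))) = (fun z => II (H ^~ z)).
  apply/funext => z; rewrite /H.
  have t1 := tfun_shift (- z) tv.
  have i1 := ic_tfun (tfunM tv tv); have i2 := ic_tfun (tfunM tv t1).
  have i3 := ic_tfun (tfunM t1 t1).
  have i4 : cell_integrable (fun x => v x * (v x - v (x - z))).
    apply: ic_tfun; apply: tfunM; [exact: tv|exact: (tfunB tv t1)].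
  transitivity (J z * II (fun x => v x * (v x - v (x - z)))); last first.
    by symmetry; exact: IIZ.
  congr (_ * _).
  have -> : sqnorm (fdiff (- z) v) = II (fun x => v (x - z) * v (x - z)) -
      2 * II (fun x => v x * v (x - z)) + II (fun x => v x * v x).
    rewrite -(IIZ 2 i2) -(IIB i3 (icZ 2 i2)) -(IID (icB i3 (icZ 2 i2)) i1).
    by apply: eq_Rintegral => x _; rewrite /fdiff; ring.
  rewrite (II_shift (- z) (tfunM tv tv)).
  transitivity (II (fun x => v x * v x) - II (fun x => v x * v (x - z))); first by field.
  by rewrite -(IIB i1 i2); apply: eq_Rintegral => x _; ring.
rewrite E1 E2; split; first exact: c1.
by split; [exact: E|exact: c2].
Qed.

(** The Fourier multiplier of the nonlocal operator at the frequency [xi]. *)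
Definition symbol eta (xi : V) := II (fun z => kernel_J rho eta z * (1 - cos (dot xi z))).
Definition lattice_vec k : V := \row_i (k i)%:~R.

Lemma dot_rvec k z : dot (lattice_vec k) z = lattice_dot k z.
Proof. by rewrite /dot /lattice_dot; apply: eq_bigr => i _; rewrite mxE. Qed.

Lemma measurable_dot (xi : V) : measurable_fun setT (dot xi).
Proof.
apply: measurable_sum => i; apply: measurable_funM => //; exact: measurable_coord.
Qed.

Lemma bndd_cosdot (xi : V) (t : R) : bounded_measurable (fun z => cos (dot xi z + t)).
Proof.
split; last by exists 1 => z; exact: cos_max.
apply: (@measurableT_comp _ _ _ _ _ _ cos).
  by apply: continuous_measurable_fun; exact: continuous_cos.
by apply: measurable_funD => //; exact: measurable_dot.
Qed.

Lemma bndd_1cosdot (xi : V) : bounded_measurable (fun z => 1 - cos (dot xi z)).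
Proof.
have := bnddD (bndd_cst 1) (bnddM (bndd_cst (-1)) (bndd_cosdot xi 0)).
by congr bounded_measurable; apply/funext => z; rewrite addr0 mulN1r.
Qed.

(** Bessel's inequality for each difference v(. - z) - v, integrated against the kernel. *)
Lemma dirichlet_ge_symb eta v N : 0 < eta -> bounded_torus_fun v ->
  torus_volume^-1 * \sum_(k <- cube N) symbol eta (lattice_vec k) * fourier_power k v <=
  II (fun x => v x * nonlocal_op rho eta v x).
Proof.
move=> e0 tv; have [_ [-> c2]] := dirichlet e0 tv.
have i1 (k : lattice) : cell_integrable (fun z => kernel_J rho eta z * (1 - cos (dot (lattice_vec k) z))).
  by apply: ic_kernelM => //; exact: bndd_1cosdot.
have i2 (k : lattice) : cell_integrable (fun z => (torus_volume^-1 * fourier_power k v) *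
    (kernel_J rho eta z * (1 - cos (dot (lattice_vec k) z)))) by exact: icZ.
have -> : torus_volume^-1 * \sum_(k <- cube N) symbol eta (lattice_vec k) * fourier_power k v =
  II (fun z => \sum_(k <- cube N) (torus_volume^-1 * fourier_power k v) *
    (kernel_J rho eta z * (1 - cos (dot (lattice_vec k) z)))).
  rewrite (II_sum _ i2) mulr_sumr; apply: eq_bigr => k _.
  by rewrite (IIZ (torus_volume^-1 * fourier_power k v) (i1 k)) /symbol; ring.
apply: (II_le (ic_sum _ i2) c2) => z _.
have -> : \sum_(k <- cube N) (torus_volume^-1 * fourier_power k v) *
    (kernel_J rho eta z * (1 - cos (dot (lattice_vec k) z))) =
  kernel_J rho eta z * (2^-1 * partial_power N (fdiff (- z) v)).
  rewrite /partial_power !mulr_sumr; apply: eq_bigr => k _.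
  rewrite pw_dif; [|by case: tv|exact: sqi_tfun].
  by rewrite ldotNr cosN -dot_rvec; field; rewrite gt_eqF// vol_gt0.
rewrite ler_wpM2l ?kernel_ge0// ler_wpM2l ?invr_ge0//.
by apply: bessel; apply: sqi_tfun; exact: tfun_dif.
Qed.

Lemma kernel_support eta z : 0 < eta <= 1 -> kernel_J rho eta z != 0 -> D z.
Proof.
move=> /andP[e0 e1]; rewrite /kernel_J (rho_scaling hrho _ e0) => h.
have h1 : rho 1 (enorm z / eta) != 0.
  by apply: contraNneq h => ->; rewrite mulr0 mul0r.
have /(rho_support hrho) : closure [set r | rho 1 r != 0] (enorm z / eta).
  exact: subset_closure.
rewrite /= in_itv/= => /andP[_]; rewrite ltr_pdivrMr// => h2.
have h3 : enorm z < pi by rewrite (lt_le_trans h2)// ler_piMr// pi_ge0.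
move=> i.
have : `|z 0 i| < pi.
  apply: le_lt_trans h3; rewrite /enorm -sqrtr_sqr ler_wsqrtr// (bigD1 i)//=.
  by rewrite lerDl sumr_ge0// => j _; exact: sqr_ge0.
by rewrite ltr_norml in_itv/= => /andP[h4 h5]; rewrite ltW.
Qed.

(** For eta <= 1 the kernel lives in the cell, so the integral is over the whole space
and dilations are available. *)
Lemma symb_scale eta xi : 0 < eta <= 1 -> symbol eta xi = eta ^- 2 * symbol 1 (eta *: xi).
Proof.
move=> e01; have /andP[e0 e1] := e01.
have g1 (e : R) (x : V) : 0 < e <= 1 -> symbol e x =
    fine (\int[mu]_z (kernel_J rho e z * (1 - cos (dot x z)))%:E).
  move=> e01'; rewrite /symbol II_indic /Rintegral; congr fine.
  apply: eq_integral => z _ /=; congr EFin.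
  have [->|h] := eqVneq (kernel_J rho e z) 0; first by rewrite !mul0r.
  by rewrite indicE mem_set ?mulr1//; exact: (kernel_support e01').
have g0 (x z : V) : 0 <= kernel_J rho 1 z * (1 - cos (dot x z)).
  by rewrite mulr_ge0 ?kernel_ge0// subr_ge0 (le_trans (ler_norm _))// cos_max.
have gm (x : V) : measurable_fun setT (fun z => kernel_J rho 1 z * (1 - cos (dot x z))).
  by apply: measurable_funM; [exact: measurable_kernel|case: (bndd_1cosdot x)].
rewrite !g1 ?ltr01 ?lexx//.
have -> : (\int[mu]_z (kernel_J rho eta z * (1 - cos (dot xi z)))%:E =
   \int[mu]_z (eta ^- (n + 2) * (kernel_J rho 1 (eta^-1 *: z) * (1 - cos (dot (eta *: xi) (eta^-1 *: z)))))%:E)%E.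
  apply: eq_integral => z _; congr EFin.
  have -> : dot (eta *: xi) (eta^-1 *: z) = dot xi z.
    by rewrite /dot; apply: eq_bigr => i _; rewrite !mxE; field; rewrite gt_eqF.
  rewrite mulrA; congr (_ * _).
  rewrite /kernel_J.
  have -> : enorm (eta^-1 *: z) = enorm z / eta.
    rewrite /enorm -[in RHS](ger0_norm (ltW e0)) -[in RHS]sqrtr_sqr -sqrtrV ?sqr_ge0//.
    rewrite -sqrtrM ?sumr_ge0//; last by move=> j _; exact: sqr_ge0.
    congr Num.sqrt; rewrite mulr_suml; apply: eq_bigr => j _; rewrite !mxE.
    by rewrite exprMn exprVn mulrC.
  rewrite (rho_scaling hrho _ e0) exprMn exprVn exprD.
  set a := rho 1 _; set b := enorm z ^+ 2.
  have [->|b0] := eqVneq b 0; first by rewrite !(mul0r, invr0, mulr0).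
  by field; rewrite b0 !expf_neq0// gt_eqF.
pose F z := (eta ^- (n + 2) * (kernel_J rho 1 z * (1 - cos (dot (eta *: xi) z))))%:E.
rewrite (@ge0_integral_scale R n eta^-1 F) ?invr_gt0//; last 2 first.
- by apply/measurable_EFinP; exact: measurable_funM.
- by move=> y; rewrite /F lee_fin mulr_ge0// invr_ge0 exprn_ge0// ltW.
rewrite /F; under eq_integral do rewrite EFinM.
rewrite ge0_integralZl//; last 3 first.
- exact/measurable_EFinP.
- by move=> z _; rewrite lee_fin.
- by rewrite lee_fin invr_ge0 exprn_ge0// ltW.
rewrite invrK muleA -EFinM exprD.
have -> : eta ^+ n * (eta ^+ n * eta ^+ 2)^-1 = eta ^- 2.
  by field; rewrite !expf_neq0// gt_eqF.
have : mu.-integrable setT (EFin \o (fun z => kernel_J rho 1 z * (1 - cos (dot (eta *: xi) z)))).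
  rewrite (_ : (fun z => _) = (fun z => kernel_J rho 1 z * (1 - cos (dot (eta *: xi) z)) * \1_D z)).
    by apply/ic_indic => //; apply: ic_kernelM => //; exact: bndd_1cosdot.
  apply/funext => z; have [->|h] := eqVneq (kernel_J rho 1 z) 0; first by rewrite !mul0r.
  by rewrite indicE mem_set ?mulr1//; apply: (kernel_support _ h); rewrite ltr01 lexx.
by move=> /integrable_fin_num-/(_ measurableT) hf; rewrite -(fineK hf) fineM.
Qed.

Lemma dotZl (c : R) (x z : V) : dot (c *: x) z = c * dot x z.
Proof. by rewrite /dot mulr_sumr; apply: eq_bigr => i _; rewrite mxE mulrA. Qed.

(** Pointwise, 1 - cos (2 a) <= 4 (1 - cos a). *)
Lemma symb_double xi : symbol 1 (2 *: xi) <= 4 * symbol 1 xi.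
Proof.
have c (x : V) : cell_integrable (fun z => kernel_J rho 1 z * (1 - cos (dot x z))).
  by apply: ic_kernelM => //; exact: bndd_1cosdot.
rewrite /symbol -(IIZ 4 (c xi)); apply: (II_le (c _) (icZ 4 (c xi))) => z _.
rewrite mulrCA ler_wpM2l ?kernel_ge0// dotZl.
have := cos_max (dot xi z); rewrite ler_norml => /andP[h1 h2].
by rewrite mulr_natl cos_mulr2n; nra.
Qed.

Lemma symb_pow2 xi p : symbol 1 (2 ^+ p *: xi) <= 4 ^+ p * symbol 1 xi.
Proof.
elim: p => [|p IH]; first by rewrite !expr0 scale1r mul1r.
by rewrite exprS -scalerA (le_trans (symb_double _))// exprS -mulrA ler_pM2l.
Qed.

(** Translating by s = pi / zeta_i in direction i changes the sign of the integrand, except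
on the slab of width s that leaves the cell. So twice the integral is bounded by the
measure of the slab. *)
Lemma II_cos_pos (zeta : V) (i : 'I_n) (t : R) : 1 < zeta 0 i ->
  `|II (fun z => cos (dot zeta z + t))| <= torus_volume / zeta 0 i.
Proof.
move=> z1; have z0 : 0 < zeta 0 i by rewrite (lt_trans _ z1).
set G := fun z => cos (dot zeta z + t).
have p0 : 0 < pi :> R := pi_gt0 R.
pose s := pi / zeta 0 i; have s0 : 0 < s by rewrite divr_gt0.
have s1 : s < pi by rewrite ltr_pdivrMr// ltr_pMr.
pose b : V := s *: delta_mx 0 i.
pose P z := G (cell_rep z).
have [mG [C hG]] := bndd_cosdot zeta t.
have tP : bounded_torus_fun P.
  split; last by move=> z j; rewrite /P cell_rep_shift.
  split; last by exists C => z; exact: hG.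
  by apply: (measurableT_comp mG); exact: measurable_cell_rep.
have iP := ic_tfun tP; have iPb := ic_tfun (tfun_shift b tP).
have E : II G = II P by apply: eq_Rintegral => z; rewrite inE => zD; rewrite /P cell_rep_id.
pose I (j : 'I_n) : set R := if j == i then `[pi - s, pi[%classic else cell1.
have mI j : measurable (I j) by rewrite /I; case: ifP => _; exact: measurable_itv.
pose W := boxset I.
have mW : measurable W by exact: measurable_boxset.
have lW : leb R n W = (torus_volume * s / (2 * pi))%:E.
  rewrite leb_boxset//.
  have -> : (\prod_(j < n) lebesgue_measure (I j) =
      (\prod_(j < n) (if j == i then s else 2 * pi))%:E)%E.
    rewrite -prodEFin; apply: eq_bigr => j _; rewrite /I /cell1; case: ifP => _;
      rewrite lebesgue_measure_itv/= lte_fin.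
    - by rewrite ltrBlDr ltrDl s0 -EFinB; congr EFin; ring.
    - by rewrite gtrN// -EFinB; congr EFin; ring.
  congr EFin; rewrite /torus_volume (bigD1 i)//= eqxx.
  rewrite (eq_bigr (fun=> 2 * pi)); last by move=> j /negbTE ->.
  rewrite prodr_const cardC1 card_ord.
  have n0 : (0 < n)%N by apply: leq_trans (ltn_ord i).
  rewrite -[in (2 * pi) ^+ n](prednK n0) exprS.
  have q0 : 2 * pi != 0 :> R by rewrite gt_eqF// mulr_gt0.
  by rewrite -[2 * pi * _ * s]mulrA (mulrC (2 * pi) (_ * s)) mulfK// mulrC.
have iW : cell_integrable (fun z => 2 * \1_W z).
  apply: icZ; apply: ic_bnd; exact: bndd_indic.
have L : `|II (fun z => P z + P (z + b))| <= II (fun z => 2 * \1_W z).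
  apply: le_trans (le_normr_Rintegral mD (icD iP iPb)) _.
  have [mP2 _] := (tfunD tP (tfun_shift b tP)).1.
  apply: II_le => //.
    apply: (ic_le (measurableT_comp _ mP2) (ic_bnd (bndd_cst 2))) => //.
    move=> z _; rewrite normr_id (le_trans (ler_normD _ _))//.
    by rewrite (_ : 2 = 1 + 1 :> R)// lerD// cos_max.
  move=> z zD; rewrite indicE; case: (boolP (z \in W)) => zW.
    rewrite mulr1 (le_trans (ler_normD _ _))//.
    by rewrite (_ : 2 = 1 + 1 :> R)// lerD// cos_max.
  rewrite mulr0 normr_le0.
  have zi : z 0 i < pi - s.
    rewrite ltNge; apply/negP => h; move/negP: zW; apply; rewrite inE => j.
    have := zD j; rewrite /I/cell1 /= !in_itv/= => /andP[h1 h2].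
    by case: eqP => [ji|_]/=; rewrite in_itv/= ?h1 ?h2// ?andbT ji.
  have zb : D (z + b).
    move=> j; have := zD j; rewrite !mxE/= !in_itv/=.
    case: eqP => [->|_]/=; last by rewrite mulr0 addr0.
    by rewrite mulr1 => /andP[h1 h2]; apply/andP; split; lra.
  rewrite /P !cell_rep_id// /G.
  have -> : dot zeta (z + b) + t = dot zeta z + t + pi.
    have -> : dot zeta (z + b) = dot zeta z + dot zeta b.
      by rewrite /dot -big_split; apply: eq_bigr => j _; rewrite !mxE mulrDr.
    have -> : dot zeta b = pi.
      rewrite /dot (bigD1 i)//= big1 ?addr0.
        by rewrite !mxE !eqxx mulr1 /s; field; rewrite gt_eqF.
      by move=> j /negbTE ji; rewrite !mxE ji mulr0 mulr0.
    by ring.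
  by rewrite cosDpi subrr.
move: L; rewrite (IID iP iPb) (II_shift b tP) -E -mulr2n normrMn.
rewrite (IIZ 2 (ic_bnd (bndd_indic mW))).
have -> : II (\1_W) = torus_volume * s / (2 * pi).
  rewrite /Rintegral integral_indic//.
  rewrite [W `&` _](_ : _ = W); first exact: (congr1 fine lW).
  apply/setIidl => z zW j; have := zW j; rewrite /I/cell1.
  by case: eqP => _ //=; rewrite !in_itv/= => /andP[h1 ->]; rewrite andbT; lra.
rewrite -[X in X <= _ -> _]mulr_natl ler_pM2l// => /le_trans; apply.
rewrite /s (_ : _ / (2 * pi) = torus_volume / (2 * zeta 0 i)); last first.
  have p1 : pi != 0 :> R by rewrite gt_eqF.
  have p2 : zeta 0 i != 0 by rewrite gt_eqF.
  by move: (pi : R) p1 => q q1; field; rewrite p2 q1.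
rewrite ler_pM2l ?vol_gt0// lef_pV2 ?posrE ?mulr_gt0//.
by rewrite ler_peMl ?ler1n// ltW.
Qed.

Lemma II_cos_small (zeta : V) (i : 'I_n) (t : R) : 1 < `|zeta 0 i| ->
  `|II (fun z => cos (dot zeta z + t))| <= torus_volume / `|zeta 0 i|.
Proof.
have [h|h] := leP 0 (zeta 0 i).
  by rewrite (ger0_norm h) => z1; exact: II_cos_pos.
rewrite (ltr0_norm h) => z1.
have := @II_cos_pos (- zeta) i (- t); rewrite !mxE => /(_ z1).
congr (_ <= _); congr (`| _ |); apply: eq_Rintegral => z _.
rewrite -scaleN1r dotZl -cosN; congr cos; ring.
Qed.

(** Trigonometric polynomials reduce to single phases, whose frequency is far from 0 when
zeta_i is large, whatever the other coordinates; a general [f] is approximated in the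
mean. *)
Lemma riemann_lebesgue f e : bounded_measurable f -> 0 < e -> exists A : R, forall (zeta : V) i,
  A <= `|zeta 0 i| -> `|II (fun z => f z * cos (dot zeta z))| <= e.
Proof.
move=> bf e0.
have bc zeta : bounded_measurable (fun z => cos (dot zeta z)).
  by have := bndd_cosdot zeta 0; congr bounded_measurable; apply/funext => z; rewrite addr0.
have RLt N p (d : R) : trigpoly N p -> 0 < d -> exists A : R, forall (zeta : V) i,
    A <= `|zeta 0 i| -> `|II (fun z => p z * cos (dot zeta z))| <= d.
  move=> tp; elim: tp d => [c k t _ d d0|q1 q2 t1 IH1 t2 IH2 d d0]; last first.
    have d2 : 0 < d / 2 by rewrite divr_gt0.
    have [A1 h1] := IH1 _ d2; have [A2 h2] := IH2 _ d2.
    exists (Num.max A1 A2) => zeta i; rewrite ge_max => /andP[a1 a2].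
    have i1 := ic_bnd (bnddM (bndd_tspan t1) (bc zeta)).
    have i2 := ic_bnd (bnddM (bndd_tspan t2) (bc zeta)).
    rewrite (_ : (fun z => _) = (fun z => q1 z * cos (dot zeta z) + q2 z * cos (dot zeta z))).
      rewrite (IID i1 i2) (le_trans (ler_normD _ _))// (le_trans (lerD (h1 _ _ a1) (h2 _ _ a2)))//.
      by rewrite -splitr.
    by apply/funext => z; rewrite mulrDl.
  (* Beyond this bound on zeta_i, k + zeta and k - zeta are both large in direction i. *)
  pose K : R := \sum_j `|(k j)%:~R|.
  exists (K + 2 + `|c| * torus_volume / d) => zeta i hz.
  have v0 : 0 < torus_volume by exact: vol_gt0.
  have k1 : `|(k i)%:~R : R| <= K.
    by rewrite /K (bigD1 i)//= lerDl sumr_ge0.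
  pose a : R := 2 + `|c| * torus_volume / d.
  have a0 : 0 <= `|c| * torus_volume / d by rewrite !mulr_ge0 ?invr_ge0// ltW.
  have a1 : a <= `|(lattice_vec k + zeta) 0 i|.
    have := lerB_normD (zeta 0 i) ((k i)%:~R); rewrite !mxE [_%:~R + _]addrC /a; lra.
  have a2 : a <= `|(lattice_vec k - zeta) 0 i|.
    have := lerB_dist (zeta 0 i) ((k i)%:~R); rewrite !mxE distrC /a; lra.
  have b1 : 1 < `|(lattice_vec k + zeta) 0 i| by rewrite (lt_le_trans _ a1)// /a; lra.
  have b2 : 1 < `|(lattice_vec k - zeta) 0 i| by rewrite (lt_le_trans _ a2)// /a; lra.
  have i1 := ic_bnd (bndd_cosdot (lattice_vec k + zeta) t).
  have i2 := ic_bnd (bndd_cosdot (lattice_vec k - zeta) t).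
  rewrite (_ : (fun z => _) = (fun z => (c / 2) *
     (cos (dot (lattice_vec k + zeta) z + t) + cos (dot (lattice_vec k - zeta) z + t)))); last first.
    apply/funext => z; rewrite /phase.
    have dD (x y : V) : dot (x + y) z = dot x z + dot y z.
      by rewrite /dot -big_split; apply: eq_bigr => j _; rewrite !mxE mulrDl.
    rewrite !dD -scaleN1r dotZl dot_rvec mulN1r.
    rewrite (_ : _ + _ + t = (lattice_dot k z + t) + dot zeta z); last by ring.
    rewrite (_ : _ - _ + t = (lattice_dot k z + t) - dot zeta z); last by ring.
    by move: (lattice_dot k z + t) => y; rewrite cosD cosB; field.
  rewrite (IIZ (c / 2) (icD i1 i2)) (IID i1 i2) normrM.
  have g (y : R) : a <= y -> torus_volume / y <= torus_volume / a.
    by move=> ay; rewrite ler_pM2l// lef_pV2// posrE; rewrite /a in ay *; lra.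
  apply: (@le_trans _ _ (`|c / 2| * (torus_volume / a + torus_volume / a))).
    rewrite ler_wpM2l// (le_trans (ler_normD _ _))// lerD//.
      by apply: le_trans (II_cos_small _ b1) (g _ a1).
    by apply: le_trans (II_cos_small _ b2) (g _ a2).
  rewrite normrM (@ger0_norm _ 2^-1) ?invr_ge0//.
  rewrite (_ : _ * _ = `|c| * torus_volume / a); last by field; rewrite gt_eqF// /a; lra.
  rewrite ler_pdivrMr; last by rewrite /a; lra.
  have -> : d * a = 2 * d + `|c| * torus_volume by rewrite /a; field; rewrite gt_eqF.
  by rewrite lerDr mulr_ge0// ltW.
have v0 : 0 < torus_volume by exact: vol_gt0.
pose e' := e / (4 * torus_volume); have e'0 : 0 < e' by rewrite divr_gt0// mulr_gt0.
have ee0 : 0 < e' * e by rewrite mulr_gt0.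
have [N [p [tp hp]]] := apx_sqi (sqi_bnd bf) ee0.
have e2 : 0 < e / 2 by rewrite divr_gt0.
have [A hA] := RLt N p _ tp e2.
exists A => zeta i az.
have bp := bndd_tspan tp.
have bfp : bounded_measurable (fun z => f z - p z).
  have := bnddD bf (bnddM (bndd_cst (-1)) bp).
  by congr bounded_measurable; apply/funext => z; rewrite mulN1r.
have i1 := ic_bnd (bnddM bp (bc zeta)); have i2 := ic_bnd (bnddM bfp (bc zeta)).
rewrite (_ : (fun z => _) = (fun z => p z * cos (dot zeta z) + (f z - p z) * cos (dot zeta z))); last first.
  by apply/funext => z; ring.
rewrite (IID i1 i2) (le_trans (ler_normD _ _))//.
suff h : `|II (fun z => (f z - p z) * cos (dot zeta z))| <= e / 2.
  by rewrite (le_trans (lerD (hA _ _ az) h))// -splitr.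
have i3 := (sqi_bnd bfp).2.
have i4 : cell_integrable (fun z => (4 * e')^-1 * (f z - p z) ^+ 2 + e').
  by apply: icD; [exact: icZ|exact: ic_bnd (bndd_cst _)].
have pt z : `|(f z - p z) * cos (dot zeta z)| <= (4 * e')^-1 * (f z - p z) ^+ 2 + e'.
  rewrite normrM (le_trans (ler_piMr _ (cos_max _)))//.
  rewrite -(real_normK (num_real (f z - p z))); set d := `| _ |.
  have -> : (4 * e')^-1 * d ^+ 2 + e' = d + (d - 2 * e') ^+ 2 / (4 * e').
    by field; rewrite gt_eqF.
  by rewrite lerDl divr_ge0 ?sqr_ge0// mulr_ge0// ltW.
apply: (@le_trans _ _ (II (fun z => (4 * e')^-1 * (f z - p z) ^+ 2 + e'))).
  apply: le_trans (le_normr_Rintegral mD i2) _.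
  apply: II_le => //.
  apply: (ic_le (measurableT_comp _ (bnddM bfp (bc zeta)).1) i4) => // z _.
  by rewrite normr_id.
rewrite (IID (icZ _ i3) (ic_bnd (bndd_cst _))) (IIZ _ i3) II_cst.
apply: (@le_trans _ _ ((4 * e')^-1 * (e' * e) + e' * torus_volume)).
  by rewrite lerD2r ler_wpM2l// invr_ge0 mulr_ge0// ltW.
rewrite le_eqVlt; apply/orP; left; apply/eqP.
by rewrite /e'; field; rewrite !gt_eqF.
Qed.

Hypothesis hpos : 0 < II (fun z => Num.min (kernel_J rho 1 z) 1).

(** The kernel is truncated at height 1, so that the Riemann-Lebesgue lemma for bounded
functions applies; the truncation still has positive integral. *)
Lemma symb_large : exists A0 c0 : R, [/\ 0 < A0, 0 < c0 &
  forall (xi : V) i, A0 <= `|xi 0 i| -> c0 <= symbol 1 xi].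
Proof.
pose j z := Num.min (@kernel_J R n rho 1 z) 1.
have jpos : 0 < II j by exact: hpos.
have J0 z : 0 <= @kernel_J R n rho 1 z by exact: kernel_ge0.
have mj : measurable_fun setT j.
  by apply: measurable_minr => //; exact: measurable_kernel.
have bj : bounded_measurable j.
  split => //; exists 1 => z; rewrite ger0_norm; first by rewrite ge_min lexx orbT.
  by rewrite le_min J0 ler01.
have e0 : 0 < II j / 2 by rewrite divr_gt0.
have [A hA] := riemann_lebesgue bj e0.
exists (Num.max A 1), (II j / 2); split => //; first by rewrite lt_max ltr01 orbT.
move=> xi i; rewrite ge_max => /andP[/hA h _].
have bc : bounded_measurable (fun z => cos (dot xi z)).
  by have := bndd_cosdot xi 0; congr bounded_measurable; apply/funext => z; rewrite addr0.
have i1 := ic_bnd bj; have i2 := ic_bnd (bnddM bj bc).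
apply: (@le_trans _ _ (II (fun z => j z - j z * cos (dot xi z)))).
  rewrite (IIB i1 i2); move: h; rewrite ler_norml => /andP[_ h]; lra.
apply: (II_le (icB i1 i2)).
  by apply: ic_kernelM => //; exact: bndd_1cosdot.
move=> z _; rewrite -{1}[j z]mulr1 -mulrBr ler_wpM2r//.
by rewrite ge_min lexx.
Qed.

Lemma symb_ge0 eta xi : 0 < eta -> 0 <= symbol eta xi.
Proof.
move=> e0; apply: II_ge0 => z _; by rewrite mulr_ge0 ?kernel_ge0// subr_ge0.
Qed.

(** A small frequency is doubled until its i-th coordinate reaches the region of
[symb_large]; the number p of doublings costs 4^p, comparable to the inverse square of
that coordinate. *)
Lemma symb_quadratic : exists A0 c0 : R, [/\ 0 < A0, 0 < c0 &
  forall (xi : V) i, c0 * Num.min 1 ((xi 0 i / A0) ^+ 2) <= symbol 1 xi].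
Proof.
have [A0 [c0 [A00 c00 H]]] := symb_large.
exists (2 * A0), c0; split => // [|xi i]; first by rewrite mulr_gt0.
have [h|h] := leP A0 `|xi 0 i|.
  by apply: le_trans (H xi i h); rewrite ler_piMr ?ge_min ?lexx// ltW.
have [->|x0] := eqVneq (xi 0 i) 0.
  by rewrite mul0r expr0n/= (_ : Num.min _ _ = 0) ?mulr0 ?symb_ge0//; apply/min_idPr.
set a := `|xi 0 i| in h; have a0 : 0 < a by rewrite normr_gt0.
have ex : exists p : nat, A0 <= 2 ^+ p * a.
  have := truncnS_gt (A0 / a); set m := Num.trunc _ => hm.
  exists m.+1; rewrite -ler_pdivrMr// (le_trans (ltW hm))//.
  by rewrite -natrX ler_nat ltnW// ltn_expl.
have p_ge := ex_minnP ex; move: p_ge => [p hp pmin].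
have p2 : 2 ^+ p * a <= 2 * A0.
  case: p hp pmin => [|p] hp pmin.
    by rewrite expr0 mul1r; lra.
  rewrite exprS -mulrA ler_pM2l// leNgt; apply/negP => /ltW /pmin; rewrite ltnn//.
have h1 : c0 <= 4 ^+ p * symbol 1 xi.
  apply: le_trans (symb_pow2 xi p); apply: (H _ i).
  by rewrite mxE normrM ger0_norm ?exprn_ge0.
have h2 : (xi 0 i / (2 * A0)) ^+ 2 * 4 ^+ p <= 1.
  rewrite (_ : 4 = 2 ^+ 2); last by ring.
  rewrite exprAC -exprMn -(@real_normK _ (_ * _)) ?num_real// expr_le1//.
  rewrite !normrM -/a normfV !ger0_norm ?exprn_ge0// ?mulr_ge0 ?(ltW A00)//.
  by rewrite mulrAC ler_pdivrMr ?mulr_gt0// mul1r mulrC.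
have h3 : 0 < (4 : R) ^+ p by rewrite exprn_gt0.
apply: (@le_trans _ _ (c0 / 4 ^+ p)); last by rewrite ler_pdivrMr// mulrC.
by rewrite ler_pM2l// ge_min; apply/orP; right; rewrite -[leRHS]mul1r ler_pdivlMr.
Qed.

Lemma symb_coercive B : 1 <= B -> exists A c : R, [/\ 0 < A, 0 < c &
  forall eps eta : R, 0 < eps < 1 -> 0 < eta <= c * eps ^+ 4 ->
  eta <= 1 /\ forall k i, A / eps < `|(k i)%:~R| -> B / eps ^+ 2 <= symbol eta (lattice_vec k)].
Proof.
move=> B1; have [A0 [c0 [A00 c00 H]]] := symb_quadratic.
have B0 : 0 < B by rewrite (lt_le_trans _ B1).
pose q := B / c0; have q0 : 0 < q by rewrite divr_gt0.
have cB : B = c0 * q by rewrite /q; field; rewrite gt_eqF.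
(* The symbol at eta k is at least c0 min (1, (eta k_i / A0)^2). Divided by eta^2, the
   first bound needs eta^2 q <= eps^2, the second |k_i| >= A0 (1 + q) / eps. *)
exists (A0 * (1 + q)), (Num.min 1 q^-1); split.
- by rewrite mulr_gt0// addr_gt0.
- by rewrite lt_min ltr01 invr_gt0.
move=> eps eta /andP[e0 e1] /andP[n0 n1].
have E2 : 0 < eps ^+ 2 by rewrite exprn_gt0.
have E3 : eps ^+ 4 <= eps ^+ 2 by rewrite ler_wiXn2l// ltW.
have E4 : eps ^+ 2 <= 1 by rewrite expr_le1// ltW.
have m0 : 0 < Num.min 1 q^-1 by rewrite lt_min ltr01 invr_gt0.
have m1 : Num.min 1 q^-1 <= 1 by rewrite ge_min lexx.
have m2 : Num.min 1 q^-1 * q <= 1.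
  by rewrite -ler_pdivlMr// mul1r ge_min lexx orbT.
set m := Num.min 1 q^-1 in m0 m1 m2 n1.
have n2 : eta <= m * eps ^+ 2 by rewrite (le_trans n1)// ler_pM2l.
have n3 : eta <= 1.
  by rewrite (le_trans n2)// mulr_ile1// ltW.
split => [|k i hk]; first exact: n3.
rewrite symb_scale ?n0// -ler_pdivrMl ?invr_gt0 ?exprn_gt0//.
rewrite invrK; apply: le_trans (H _ i); rewrite mxE mxE.
rewrite (_ : eta ^+ 2 * _ = c0 * (eta ^+ 2 * q / eps ^+ 2)); last first.
  by rewrite cB; ring.
rewrite (ler_pM2l c00).
have nn : eta ^+ 2 * q <= eps ^+ 2.
  have : eta ^+ 2 <= m * eps ^+ 2.
    by rewrite expr2 (le_trans _ n2)// ler_piMl// ltW.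
  move=> h; apply: (@le_trans _ _ (m * eps ^+ 2 * q)).
    by rewrite ler_pM2r.
  by rewrite mulrAC ler_piMl// ltW.
have hk2 : (1 + q) / eps * A0 < `|(k i)%:~R|.
  by move: hk; congr (_ < _); ring.
rewrite le_min; apply/andP; split.
  by rewrite ler_pdivrMr// mul1r.
rewrite (_ : eta ^+ 2 * q / _ = eta ^+ 2 * (q / eps ^+ 2)); last by ring.
rewrite (_ : (_ / A0) ^+ 2 = eta ^+ 2 * ((k i)%:~R / A0) ^+ 2); last by ring.
apply: ler_wpM2l; first by rewrite exprn_ge0// ltW.
rewrite exprMn.
rewrite -(real_normK (num_real ((k i)%:~R : R))).
apply: (@le_trans _ _ (((1 + q) / eps) ^+ 2)).
  rewrite exprMn exprVn ler_pM2r ?invr_gt0//; nra.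
rewrite exprVn ler_pdivlMr ?exprn_gt0// -exprMn.
by rewrite ler_pXn2r// ?nnegrE ?mulr_ge0 ?invr_ge0 ?addr_ge0// ltW.
Qed.

Lemma coercive B : 1 <= B -> exists A c : R, [/\ 0 < A, 0 < c &
  forall eps eta : R, 0 < eps < 1 -> 0 < eta <= c * eps ^+ 4 ->
  forall v L i, bounded_torus_fun v ->
  (forall N, torus_volume^-1 * (\sum_(k <- cube N | `|(k i)%:~R| <= A / eps) fourier_power k v) <= L) ->
  B / eps ^+ 2 * (sqnorm v - L) <= II (fun x => v x * nonlocal_op rho eta v x)].
Proof.
move=> B1; have [A [c [A0 c0 H]]] := symb_coercive B1.
exists A, c; split => // eps eta he hn v L i tv hL.
have [n1 Hk] := H _ _ he hn.
have [e0 _] := andP he; have [n0 _] := andP hn.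
have B0 : 0 < B by rewrite (lt_le_trans _ B1).
have b0 : 0 < B / eps ^+ 2 by rewrite divr_gt0// exprn_gt0.
have v0 : 0 < torus_volume by exact: vol_gt0.
set E := (X in _ <= X); apply/ler_addgt0Pr => e ep.
have e'p : 0 < e / (B / eps ^+ 2) by rewrite divr_gt0.
have [N /(_ N (leqnn N)) hN] := parseval (sqi_tfun tv) e'p.
have hE : torus_volume^-1 * \sum_(k <- cube N) symbol eta (lattice_vec k) * fourier_power k v <= E.
  exact: dirichlet_ge_symb.
have hh : B / eps ^+ 2 * (torus_volume^-1 * \sum_(k <- cube N | ~~ (`|(k i)%:~R| <= A / eps)) fourier_power k v) <= E.
  apply: le_trans hE; rewrite mulrCA ler_pM2l ?invr_gt0// mulr_sumr.
  rewrite [leRHS](bigID (fun k : lattice => `|(k i)%:~R : R| <= A / eps))/=.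
  rewrite -[leLHS]add0r lerD//.
    by rewrite sumr_ge0// => k _; rewrite mulr_ge0 ?pw_ge0 ?symb_ge0.
  by apply: ler_sum => k; rewrite -ltNge => /Hk h; rewrite ler_wpM2r ?pw_ge0.
apply: (@le_trans _ _ (B / eps ^+ 2 * (partial_power N v + e / (B / eps ^+ 2) - L))).
  by rewrite ler_pM2l// lerD2r.
rewrite (_ : B / eps ^+ 2 * _ = B / eps ^+ 2 * (partial_power N v - L) + e); last first.
  by field; rewrite !gt_eqF.
rewrite lerD2r (le_trans _ hh)// ler_pM2l// lerBlDr /partial_power.
rewrite (bigID (fun k : lattice => `|(k i)%:~R : R| <= A / eps))/= mulrDr addrC lerD2l.
exact: hL.
Qed.

(** This controls the modes on which [coercive] gives nothing. *)
Lemma low_modes (A eps h : R) (N : nat) (i : 'I_n) u : 0 < A -> 0 < eps -> bounded_torus_fun u ->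
  torus_volume^-1 * (\sum_(k <- cube N | `|(k i)%:~R| <= A / eps) fourier_power k (fdiff3 (h *: delta_mx 0 i) u)) <=
  (h * (A / eps)) ^+ 6 * sqnorm u.
Proof.
move=> A0 e0 tu; have su := sqi_tfun tu; have [_ pu] := tu.
have v0 : 0 < torus_volume by exact: vol_gt0.
have E (x : R) : x ^+ 6 = (x ^+ 2) ^+ 3 by rewrite -exprM.
apply: (@le_trans _ _ ((h * (A / eps)) ^+ 6 * partial_power N u)); last first.
  by rewrite ler_wpM2l ?bessel// E exprn_ge0// sqr_ge0.
rewrite /partial_power mulrCA ler_pM2l ?invr_gt0// mulr_sumr big_mkcond/=.
apply: ler_sum => k _; case: ifP => hk; last first.
  by rewrite mulr_ge0 ?pw_ge0// E exprn_ge0// sqr_ge0.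
apply: le_trans (pw_dif3_le k i h pu su) _.
rewrite ler_wpM2r ?pw_ge0// !E lerXn2r ?nnegrE ?sqr_ge0//.
rewrite !exprMn ler_wpM2l ?sqr_ge0// -exprMn -(real_normK (num_real ((k i)%:~R : R))).
by rewrite lerXn2r ?nnegrE// divr_ge0// ltW.
Qed.

End nonlocal.

(** * The kernel is not null *)

Section nondegenerate.
Context {R : realType}.
Local Notation lam := (@lebesgue_measure R).

(** A cover of [N] by open intervals is mapped into intervals that are not longer. *)
Lemma negligible_contraction (phi : R -> R) (N : set R) :
  (forall x y, `|phi x - phi y| <= `|x - y|) ->
  lam.-negligible N -> lam.-negligible (phi @` N).
Proof.
move=> lip /negligible_outer_measure N0; apply/negligible_outer_measure.
apply/eqP; rewrite eq_le outer_measure_ge0 andbT.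
rewrite -N0 !outer_measure_open_itv_cover; apply: ereal_inf_le_tmp => _ [F [Fo NF] <-].
pose ab k := sval (cid (Fo k)).
have FE k : F k = `](ab k).1, (ab k).2[%classic by rewrite /ab; case: cid.
pose c k := phi (((ab k).1 + (ab k).2) / 2).
pose h k := ((ab k).2 - (ab k).1) / 2.
exists (fun k => `]c k - h k, c k + h k[%classic).
  split; first by move=> k; exists (c k - h k, c k + h k).
  move=> _ [x /NF[k _]] + <-; rewrite FE/= in_itv/= => /andP[x1 x2].
  exists k => //=; rewrite in_itv/= -ltr_distl.
  apply: le_lt_trans (lip _ _) _; rewrite ltr_norml /h; apply/andP; split; lra.
apply: eq_eseriesr => k _; rewrite FE !wlength_itv/= !lte_fin /h.
have -> : (c k - ((ab k).2 - (ab k).1) / 2 < c k + ((ab k).2 - (ab k).1) / 2) =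
    ((ab k).1 < (ab k).2) by apply/idP/idP; lra.
by case: ifP => // _; rewrite -!EFinB; congr EFin; field.
Qed.

Lemma sqrtD_contraction (s x y : R) : 0 <= s ->
  `|Num.sqrt (x ^+ 2 + s) - Num.sqrt (y ^+ 2 + s)| <= `|x - y|.
Proof.
move=> s0.
have H (a b : R) : Num.sqrt (a ^+ 2 + s) <= Num.sqrt (b ^+ 2 + s) + `|a - b|.
  rewrite -[leRHS]ger0_norm ?addr_ge0// -sqrtr_sqr ler_wsqrtr// sqrrD.
  rewrite sqr_sqrtr ?addr_ge0 ?sqr_ge0// real_normK ?num_real//.
  have h : b * (a - b) <= Num.sqrt (b ^+ 2 + s) * `|a - b|.
    rewrite (le_trans (ler_norm _))// normrM ler_wpM2r// -sqrtr_sqr ler_wsqrtr//.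
    by rewrite lerDl.
  have -> : a ^+ 2 = b ^+ 2 + 2 * (b * (a - b)) + (a - b) ^+ 2 by ring.
  by rewrite -mulr_natl; lra.
have h1 := H x y; have h2 := H y x; rewrite distrC in h2.
by rewrite ler_norml; apply/andP; split; lra.
Qed.

Lemma enorm_vcons m (a : R) (y : 'rV[R]_m) :
  enorm (@vcons R m (a, y)) = Num.sqrt (a ^+ 2 + enorm y ^+ 2).
Proof.
rewrite /enorm big_ord_recl sqr_sqrtr ?sumr_ge0//; last by move=> i _; exact: sqr_ge0.
rewrite vcons0; congr (Num.sqrt (_ + _)); apply: eq_bigr => i _; by rewrite vconsS.
Qed.

Variables (m : nat) (rho : R -> R -> R).
Hypotheses (hrho : kernel_family m.+1 rho) (hS : 0 < sphere_constant m.+1 :> R)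
  (m0 : (0 < m)%N).

(** If the kernel were null, then on almost every line parallel to the first axis the
profile rho_1 would vanish at almost every distance to the origin. Such lines exist
arbitrarily close to the origin, and along a line the distance is a contraction of the
coordinate, so rho_1 vanishes almost everywhere, against the moment condition. *)
Lemma kernel_not_null :
  leb R m.+1 [set z | kernel_J rho 1 z != 0] != 0%E.
Proof.
set N := [set z | _]; apply/negP => /eqP N0.
have mN : measurable N.
  rewrite (_ : N = @kernel_J R m.+1 rho 1 @^-1` [set~ 0]).
    apply: (@measurable_preimage _ _ _ (measurableTypeR R) (@kernel_J R m.+1 rho 1)).
      exact: measurable_kernel.
    by apply: measurableC; exact: measurable_set1.
  by apply/seteqP; split => z /= /eqP.
pose A := @vcons R m @^-1` N.
have mA : measurable A.
  by apply: (measurable_preimage (f := @vcons R m)) => //; exact: measurable_vcons.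
have h0 : (\int[leb R m]_y lam (ysection A y) = 0)%E.
  rewrite -N0 leb_vcons.
  have h := indic_fubini_tonelli lam (leb R m) mA.
  transitivity (\int[lam]_x fubini_F (leb R m) (EFin \o \1_A) x)%E.
    rewrite h; apply: eq_integral => y _; symmetry.
    exact: (congr1 (fun g => g y) (indic_fubini_tonelli_GE lam mA)).
  rewrite /product_measure1; apply: eq_integral => x _.
  exact: (congr1 (fun g => g x) (indic_fubini_tonelli_FE (leb R m) mA)).
have [Y [mY Y0 hY]] : {ae leb R m, forall y, lam (ysection A y) = 0}.
  have mG : measurable_fun setT (fun y => lam (ysection A y)) by exact: measurable_fun_ysection.
  have : ae_eq (leb R m) setT (fun y => lam (ysection A y)) (cst 0).
    apply/ae_eq_integral_abs => //; rewrite -[RHS]h0.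
    by apply: eq_integral => y _; rewrite gee0_abs.
  by apply: filterS => y /(_ I).
have small d : 0 < d -> exists2 y, lam (ysection A y) = 0 & enorm y < d.
  move=> d0; (* The cube of half side e is contained in the ball of radius d. *)
 pose e := d / (m%:R + 1); have e0 : 0 < e by rewrite divr_gt0// ltr_wpDl.
  have de : d = (m%:R + 1) * e by rewrite /e; field; rewrite gt_eqF// ltr_wpDl.
  clearbody e.
  pose W : set 'rV[R]_m := boxset (fun _ => `]-e, e[%classic).
  have W0 : (0 < leb R m W)%E.
    rewrite leb_boxset// (eq_bigr (fun=> (e + e)%:E)); last first.
      by move=> i _; rewrite lebesgue_measure_itv/= lte_fin gtrN// -EFinB opprK.
    by rewrite prodEFin lte_fin prodr_gt0// => i _; rewrite addr_gt0.
  have mW : measurable W by exact: measurable_boxset.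
  have [y [Wy Yy]] : exists y, W y /\ ~ Y y.
    apply: contrapT => h.
    have : (leb R m W <= leb R m Y)%E.
      apply: le_measure; rewrite ?inE// => y Wy.
      by apply: contrapT => Yy; apply: h; exists y.
    by rewrite Y0 leNgt W0.
  exists y; first by apply: contrapT => h; apply: Yy; exact: hY.
  have y2 : \sum_i y 0 i ^+ 2 <= m%:R * e ^+ 2.
    apply: (@le_trans _ _ (\sum_(i < m) e ^+ 2)).
      apply: ler_sum => i _; have := Wy i; rewrite /= in_itv/= => /andP[h1 h2].
      by nra.
    by rewrite sumr_const card_ord mulr_natl.
  rewrite /enorm -(ltr_pXn2r (n := 2)) ?nnegrE ?sqrtr_ge0 ?ltW//.
  rewrite sqr_sqrtr; last by apply: sumr_ge0 => i _; exact: sqr_ge0.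
  apply: le_lt_trans y2 _.
  rewrite de.
  have p0 : 0 <= m%:R :> R by [].
  rewrite exprMn; apply: (@lt_le_trans _ _ ((m%:R + 1) * e ^+ 2)).
    by rewrite mulrDl mul1r ltrDl exprn_gt0.
  by apply: ler_wpM2r; [rewrite exprn_ge0// ltW|nra].
pose E := [set r : R | 0 < r /\ rho 1 r != 0].
have E0 : lam.-negligible E.
  pose F j := [set r : R | j.+1%:R^-1 < r /\ rho 1 r != 0].
  have -> : E = \bigcup_j F j.
    apply/seteqP; split => [r [r0 hr]|r [j _ [hj hr]]]; last first.
      by split => //; apply: lt_trans hj; rewrite invr_gt0.
    have := truncnS_gt (r^-1); set k := Num.trunc _ => hk.
    exists k => //; split => //.
    by rewrite invf_plt ?posrE// ltr0n.
  apply: negligible_bigcup => j.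
  have [|y y0 yj] := small (j.+1%:R^-1); first by rewrite invr_gt0.
  have yy : lam.-negligible (ysection A y).
    exists (ysection A y); split => //.
    exact: measurable_ysection.
  have := @negligible_contraction (fun a => Num.sqrt (a ^+ 2 + enorm y ^+ 2)) _ _ yy.
  move=> /(_ (fun a b => sqrtD_contraction a b (sqr_ge0 _))).
  apply: negligibleS => r [hj hr].
  have r0 : 0 < r by apply: lt_trans hj; rewrite invr_gt0.
  have ny : 0 <= enorm y by rewrite sqrtr_ge0.
  have ry : enorm y ^+ 2 <= r ^+ 2.
    by rewrite ler_sqr ?nnegrE// ?ltW// (lt_trans yj).
  pose a := Num.sqrt (r ^+ 2 - enorm y ^+ 2).
  have ar : Num.sqrt (a ^+ 2 + enorm y ^+ 2) = r.
    by rewrite /a sqr_sqrtr ?subr_ge0// subrK sqrtr_sqr ger0_norm// ltW.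
  exists a => //; rewrite /ysection /= inE /A /N /= /kernel_J enorm_vcons ar.
  by rewrite mulf_neq0// invr_eq0 expf_neq0// gt_eqF.
have := rho_moment hrho ltr01.
set D : set R := [set` `[0, +oo[]; have mD : measurable D by exact: measurable_itv.
pose g (r : R) := (rho 1 r * r ^+ m)%:E : \bar R.
have mg : measurable_fun D g.
  apply/measurable_EFinP; apply: measurable_funTS; apply: measurable_funM.
    by have /measurable_int/measurable_EFinP := rho_integrable hrho ltr01.
  exact: measurable_funX.
have D0 r : D r -> 0 <= r by rewrite /D/= in_itv/= andbT.
have : (\int[lam]_(r in D) `|g r| = 0)%E.
  apply/ae_eq_integral_abs => //.
  have [Z [mZ Z0 hZ]] := E0; exists Z; split => // r /= hr.
  apply: hZ; apply: contrapT => hE; apply: hr => /D0 r0.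
  rewrite /g; have [->|rn] := eqVneq r 0; first by rewrite expr0n gtn_eqF// mulr0.
  have [->|rh] := eqVneq (rho 1 r) 0; first by rewrite mul0r.
  by exfalso; apply: hE; split => //; rewrite lt_def rn.
have -> : (\int[lam]_(r in D) `|g r| = \int[lam]_(r in D) g r)%E.
  apply: eq_integral => r; rewrite inE => /D0 r0.
  by rewrite gee0_abs// lee_fin mulr_ge0 ?exprn_ge0// (rho_ge0 hrho).
move=> g0 M; have := etrans (esym g0) M => -[] /eqP.
by rewrite lt_eqF// divr_gt0.
Qed.

Lemma kernel_min_gt0 :
  0 < \int[leb R m.+1]_(z in cell) Num.min (kernel_J rho 1 z) 1.
Proof.
have J0 (z : 'rV[R]_m.+1) : 0 <= kernel_J rho 1 z by exact: kernel_ge0.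
pose j (z : 'rV[R]_m.+1) := Num.min (kernel_J rho 1 z) 1.
have j0 z : 0 <= j z by rewrite le_min J0 ler01.
have mj : measurable_fun setT j.
  by apply: measurable_minr => //; exact: measurable_kernel.
have bj : bounded_measurable j.
  by split => //; exists 1 => z; rewrite ger0_norm// ge_min lexx orbT.
have : 0 <= \int[leb R m.+1]_(z in cell) j z by exact: II_ge0.
rewrite le_eqVlt => /orP[/eqP h|//]; exfalso.
have := EII (ic_bnd bj); rewrite -h => h1.
have h2 : ae_eq (leb R m.+1) cell (EFin \o j) (cst 0%E).
  apply/ae_eq_integral_abs => //; first exact: measurable_cell.
    by apply/measurable_EFinP; exact: measurable_funTS.
  by rewrite -[RHS]h1; apply: eq_integral => z _; rewrite gee0_abs// lee_fin.
have [Y [mY Y0 hY]] := h2.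
move/negP: kernel_not_null; apply; rewrite -measure_le0 -Y0.
apply: le_measure; rewrite ?inE//.
  rewrite (_ : mkset _ = @kernel_J R m.+1 rho 1 @^-1` [set~ 0]).
    apply: (@measurable_preimage _ _ _ (measurableTypeR R) (@kernel_J R m.+1 rho 1)).
      exact: measurable_kernel.
    by apply: measurableC; exact: measurable_set1.
  by apply/seteqP; split => z /= /eqP.
move=> z /= hz; apply: hY => /= H.
have zD : cell z by apply: (kernel_support hrho _ hz); rewrite ltr01 lexx.
have := H zD; rewrite /j => -[]; apply/eqP; rewrite gt_eqF// lt_min ltr01 andbT.
by rewrite lt_def hz J0.
Qed.
End nondegenerate.

(** * Hausdorff measure as a metric outer measure *)

Lemma sume_even_odd (R : realType) (s : nat -> \bar R) N :
  (\sum_(0 <= k < N.*2) s k =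
   \sum_(0 <= j < N) s (j.*2 + 0)%N + \sum_(0 <= j < N) s (j.*2 + 1)%N)%E.
Proof.
elim: N => [|N IH]; first by rewrite !big_geq// adde0.
rewrite doubleS !big_nat_recr//= IH addn0 addn1.
by rewrite -!addeA; congr (_ + _)%E; rewrite addeCA.
Qed.

Section hausdorff_outer.
Context {R : realType} {n : nat}.
Variable m : nat.
Local Notation V := 'rV[R]_n.
Implicit Types (x y z : V) (A B X U : set V).

(** All sets are measurable here, so that the outer measure generated by a function on
all sets is an instance of the general construction from a semiring. *)
Definition discrete_space : Type := V.
HB.instance Definition _ := Pointed.on discrete_space.
HB.instance Definition _ := @isMeasurable.Build default_measure_display
  discrete_space discrete_measurable
  (@discrete_measurable0 _) (@discrete_measurableC _) (@discrete_measurableU _).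

Definition gauge_wt U : R := unit_ball_volume m.+1 * (fine (diameter U) / 2) ^+ m.+1.

(** The value +oo for sets of large diameter encodes the restriction to fine covers. *)
Definition gauge (d : R) U : \bar R :=
  if (diameter U <= d%:E)%E then (gauge_wt U)%:E else +oo%E.

Lemma enorm0 : enorm (0 : V) = 0.
Proof. by rewrite /enorm big1 ?sqrtr0// => i _; rewrite mxE expr0n. Qed.

Lemma coord_le_enorm x i : `|x 0 i| <= enorm x.
Proof.
rewrite /enorm -sqrtr_sqr ler_wsqrtr// (bigD1 i)//= lerDl.
by apply: sumr_ge0 => j _; exact: sqr_ge0.
Qed.

Lemma enorm_le_sum x : enorm x <= \sum_i `|x 0 i|.
Proof.
have H : (0 : R) <= \sum_i `|x 0 i| by apply: sumr_ge0.
rewrite -[leRHS]ger0_norm// -sqrtr_sqr ler_wsqrtr//.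
suff : forall s : seq 'I_n, \sum_(i <- s) x 0 i ^+ 2 <= (\sum_(i <- s) `|x 0 i|) ^+ 2 by exact.
elim=> [|i s IH]; first by rewrite !big_nil expr0n.
rewrite !big_cons sqrrD -(real_normK (num_real (x 0 i))) -addrA lerD2l.
by rewrite (le_trans IH)// lerDr mulrn_wge0// mulr_ge0// sumr_ge0.
Qed.

Lemma diameter0 : diameter (set0 : set V) = -oo%E.
Proof.
rewrite /diameter (_ : [set _ | _ in _ & _ in _] = set0) ?ereal_sup0//.
by apply/seteqP; split => // x [y [] ].
Qed.

Lemma fine_diameter_ge0 U : 0 <= fine (diameter U).
Proof.
have [->|/set0P[x Ux]] := eqVneq U set0.
  by rewrite diameter0.
apply: fine_ge0; apply: ereal_sup_ubound; exists x => //; exists x => //.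
by rewrite subrr enorm0.
Qed.

Lemma ball_volume_ge0 : 0 <= @unit_ball_volume R m.+1.
Proof. exact: fine_ge0. Qed.

Lemma gauge_wt_ge0 U : 0 <= gauge_wt U.
Proof.
by rewrite mulr_ge0 ?ball_volume_ge0// exprn_ge0// divr_ge0// fine_diameter_ge0.
Qed.

Lemma gauge_ge0 d U : (0 <= gauge d U)%E.
Proof. by rewrite /gauge; case: ifP => // _; rewrite lee_fin gauge_wt_ge0. Qed.

Lemma gauge0 d : gauge d set0 = 0%E.
Proof. by rewrite /gauge /gauge_wt diameter0 leNye/= mul0r expr0n/= mulr0. Qed.

(** The premeasure with covers of diameter at most [d]. *)
Definition hausdorff_pre d : set discrete_space -> \bar R :=
  mu_ext (gauge d : set discrete_space -> \bar R).

Lemma hpre_cover d A (U : (set V)^nat) : A `<=` \bigcup_k U k ->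
  (hausdorff_pre d A <= \sum_(0 <= k <oo) gauge d (U k))%E.
Proof. by move=> AU; apply: ereal_inf_lbound; exists U. Qed.

Lemma hpre_ge d A (c : \bar R) : (forall U : (set V)^nat, A `<=` \bigcup_k U k ->
  (c <= \sum_(0 <= k <oo) gauge d (U k))%E) -> (c <= hausdorff_pre d A)%E.
Proof. by move=> H; apply: le_ereal_inf_tmp => _ [U [_ AU] <-]; exact: H. Qed.

Lemma hausdorffE A : hausdorff m.+1 A = ereal_sup [set hausdorff_pre d A | d in [set d : R | 0 < d]].
Proof.
rewrite /hausdorff; congr ereal_sup; apply: eq_imagel => d _.
apply/eqP; rewrite eq_le; apply/andP; split.
  apply: hpre_ge => U AU.
  have [h|/existsNP[k /negP hk]] := pselect (forall k, (diameter (U k) <= d%:E)%E).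
    apply: ereal_inf_lbound; exists U => //.
    by apply: eq_eseriesr => k _; rewrite /gauge h.
  rewrite (@eseries_pinfty _ _ xpredT k) ?leey//.
    by move=> j _; rewrite -ltNye (lt_le_trans _ (gauge_ge0 _ _)).
  by rewrite /gauge (negbTE hk).
apply: le_ereal_inf_tmp => _ [U [AU h] <-].
apply: (le_trans (hpre_cover d AU)).
by rewrite le_eqVlt; apply/orP; left; apply/eqP/eq_eseriesr => k _; rewrite /gauge h.
Qed.

Lemma hpre_le d A : 0 < d -> (hausdorff_pre d A <= hausdorff m.+1 A)%E.
Proof. by move=> d0; rewrite hausdorffE; apply: ereal_sup_ubound; exists d. Qed.

Lemma hausdorff_le A (c : \bar R) : (forall d, 0 < d -> (hausdorff_pre d A <= c)%E) ->
  (hausdorff m.+1 A <= c)%E.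
Proof. by move=> H; rewrite hausdorffE; apply: ge_ereal_sup => _ [d d0 <-]; exact: H. Qed.

Lemma hpre_anti d e A : d <= e -> (hausdorff_pre e A <= hausdorff_pre d A)%E.
Proof.
move=> de; apply: hpre_ge => U AU; apply: (le_trans (hpre_cover e AU)).
apply: lee_nneseries => k _; first by rewrite gauge_ge0.
rewrite /gauge; have [h|h] := leP (diameter (U k)) d%:E; last by rewrite leey.
by rewrite (le_trans h)// lee_fin.
Qed.

Lemma hpre_ge0 d A : (0 <= hausdorff_pre d A)%E.
Proof. by apply: mu_ext_ge0 => X; exact: gauge_ge0. Qed.

Local Notation H := (@hausdorff R n m.+1).

Lemma hausdorff_ge0 A : (0 <= H A)%E.
Proof. exact: le_trans (hpre_ge0 1 A) (hpre_le _ ltr01). Qed.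

Lemma hausdorff0 : H set0 = 0%E.
Proof.
apply/eqP; rewrite eq_le hausdorff_ge0 andbT; apply: hausdorff_le => d _.
by rewrite /hausdorff_pre mu_ext0//; [exact: gauge0|move=> X; exact: gauge_ge0].
Qed.

Lemma le_hausdorff : {homo H : A B / A `<=` B >-> (A <= B)%E}.
Proof.
move=> A B AB; apply: hausdorff_le => d d0; apply: le_trans (hpre_le B d0).
exact: le_mu_ext.
Qed.

Lemma hausdorff_sigma_subadditive : sigma_subadditive H.
Proof.
move=> F; apply: hausdorff_le => d d0.
apply: (le_trans (mu_ext_sigma_subadditive _ _)).
  by move=> X; exact: gauge_ge0.
apply: lee_nneseries => [k _ _|k _]; first exact: (hpre_ge0 d (F k)).
exact: (hpre_le (F k) d0).
Qed.

HB.instance Definition _ := isOuterMeasure.Build R V H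
  hausdorff0 hausdorff_ge0 le_hausdorff hausdorff_sigma_subadditive.

Lemma hpre_metric d A B : (forall x y, A x -> B y -> d < enorm (x - y)) ->
  (hausdorff_pre d A + hausdorff_pre d B <= hausdorff_pre d (A `|` B))%E.
Proof.
move=> sep; apply: hpre_ge => U AU.
pose UA k := if `[< U k `&` A !=set0 >] then U k else set0.
pose UB k := if `[< U k `&` B !=set0 >] then U k else set0.
have hA : A `<=` \bigcup_k UA k.
  move=> x Ax; have [k _ Ukx] := AU x (or_introl Ax); exists k => //.
  by rewrite /UA; case: asboolP => // h; exfalso; apply: h; exists x.
have hB : B `<=` \bigcup_k UB k.
  move=> x Bx; have [k _ Ukx] := AU x (or_intror Bx); exists k => //.
  by rewrite /UB; case: asboolP => // h; exfalso; apply: h; exists x.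
apply: (le_trans (leeD (hpre_cover d hA) (hpre_cover d hB))).
rewrite -nneseriesD; [|by move=> *; exact: gauge_ge0|by move=> *; exact: gauge_ge0].
apply: lee_nneseries => k _; first by rewrite adde_ge0// gauge_ge0.
rewrite /UA /UB; case: asboolP => [hkA|_]; case: asboolP => [hkB|_]; rewrite ?gauge0 ?adde0 ?add0e ?gauge_ge0//.
have [x [Ux Ax]] := hkA; have [y [Uy By]] := hkB.
rewrite {3}/gauge ifF ?leey//; apply/negbTE; rewrite -ltNge.
apply: (@lt_le_trans _ _ (enorm (x - y))%:E); first by rewrite lte_fin sep.
by apply: ereal_sup_ubound; exists x => //; exists y.
Qed.

(** Once the covering sets are smaller than the distance of [A] and [B], none of them meets
both. *)
Lemma hausdorff_metric d A B : 0 < d -> (forall x y, A x -> B y -> d <= enorm (x - y)) ->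
  (H A + H B <= H (A `|` B))%E.
Proof.
move=> d0 sep; have [->|fin] := eqVneq (H (A `|` B)) +oo%E; first exact: leey.
have fU : (H (A `|` B) < +oo)%E by rewrite ltey.
have fin_sub C : C `<=` A `|` B -> H C \is a fin_num.
  move=> h; rewrite ge0_fin_numE ?hausdorff_ge0//.
  by apply: le_lt_trans fU; exact: le_hausdorff.
have fA := fin_sub A (@subsetUl _ A B); have fB := fin_sub B (@subsetUr _ A B).
have key d1 d2 : 0 < d1 -> 0 < d2 -> (hausdorff_pre d1 A + hausdorff_pre d2 B <= H (A `|` B))%E.
  move=> d10 d20; pose e := Num.min (Num.min d1 d2) (d / 2).
  have e0 : 0 < e by rewrite !lt_min d10 d20 divr_gt0.
  apply: le_trans (hpre_le _ e0).
  apply: le_trans (hpre_metric (d := e) _).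
    by apply: leeD; apply: hpre_anti; rewrite /e !ge_min lexx ?orbT.
  move=> x y Ax By; apply: lt_le_trans (sep _ _ Ax By).
  rewrite (@le_lt_trans _ _ (d / 2))//; first by rewrite ge_min lexx orbT.
  by lra.
rewrite -leeBrDr//; apply: hausdorff_le => d1 d10.
have f1 : hausdorff_pre d1 A \is a fin_num.
  rewrite ge0_fin_numE ?hpre_ge0//.
  by apply: le_lt_trans (hpre_le _ d10) _; rewrite -ge0_fin_numE ?hausdorff_ge0.
rewrite leeBrDr// addeC -leeBrDr//; apply: hausdorff_le => d2 d20.
by rewrite leeBrDr// addeC; exact: key.
Qed.

(** The standard argument for metric outer measures. The half-space is exhausted by
half-spaces at positive distance from its complement. The error is covered by the
rings between consecutive levels; the even rings are at positive distance from each
other, and so are the odd ones, hence the measures of the rings are summable. *)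
Lemma hausdorff_halfspace (i : 'I_n) (a : R) : H.-caratheodory [set x : V | x 0 i < a].
Proof.
pose A := [set x : V | x 0 i < a]; apply: le_caratheodory_measurable => X.
suff : (H (X `&` A) + H (X `&` ~` A) <= H X)%E by [].
have [->|fin] := eqVneq (H X) +oo%E; first exact: leey.
have fX : (H X < +oo)%E by rewrite ltey.
pose lev k : R := a - k.+1%:R^-1.
have lev_lt j k : (j < k)%N -> lev j < lev k.
  by move=> jk; rewrite /lev ltrD2l ltrN2 ltf_pV2 ?posrE ?ltr0n// ltr_nat.
have sep (b c : R) (P Q : set V) : b < c -> (forall x, P x -> x 0 i <= b) ->
    (forall x, Q x -> c <= x 0 i) -> (H P + H Q <= H (P `|` Q))%E.
  move=> bc hP hQ; apply: (@hausdorff_metric (c - b)); first by rewrite subr_gt0.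
  move=> x y /hP h1 /hQ h2; apply: le_trans (coord_le_enorm _ i).
  rewrite !mxE distrC ger0_norm; last by lra.
  lra.
pose Ak k := [set x : V | x 0 i <= lev k].
pose Rk k := [set x : V | lev k.+1 < x 0 i <= lev k.+2].
have leX Y : (H (X `&` Y) <= H X)%E by exact: le_hausdorff (@subIsetl _ X Y).
have ringsum p N : (\sum_(0 <= j < N) H (X `&` Rk (j.*2 + p)%N) <= H (X `&` Ak (N.*2 + p)%N))%E.
  elim: N => [|N IH]; first by rewrite big_geq// hausdorff_ge0.
  rewrite big_nat_recr//=; apply: (le_trans (leeD IH (lexx _))).
  apply: (@le_trans _ _ (H (X `&` Ak (N.*2 + p)%N `|` X `&` Rk (N.*2 + p)%N))).
    apply: (sep (lev (N.*2 + p)%N) (lev (N.*2 + p).+1)); first exact: lev_lt.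
      by move=> x [_ ].
    by move=> x [_ /andP[/ltW]].
  apply: le_hausdorff => x [[Xx]|[Xx]]; rewrite /Ak/Rk/= => h; split => //.
    by rewrite (le_trans h)// ltW// lev_lt// doubleS ltnW// !addSn.
  by case/andP: h => _; rewrite doubleS !addSn.
pose s k := H (X `&` Rk k).
have s0 k : (0 <= s k)%E by exact: hausdorff_ge0.
have ssum : (\sum_(0 <= k <oo) s k < +oo)%E.
  apply: (@le_lt_trans _ _ (H X + H X)%E); last by rewrite lte_add_pinfty.
  apply: lime_le; first by apply: is_cvg_nneseries => k *; exact: s0.
  apply: nearW => N.
  apply: (@le_trans _ _ (\sum_(0 <= k < N.*2) s k)%E).
    rewrite [leRHS](@big_cat_nat _ _ _ N 0 N.*2)//=; last by rewrite -addnn leq_addr.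
    by rewrite leeDl// sume_ge0.
  rewrite sume_even_odd.
  by apply: leeD; (apply: le_trans (ringsum _ _) _; exact: leX).
have tail : (\sum_(N <= k <oo) s k)%E @[N --> \oo] --> 0%E.
  exact: nneseries_tail_cvg.
apply/lee_addgt0Pr => e e0.
have [N hN] : exists N : nat, (\sum_(N <= k <oo) s k <= e%:E)%E.
  have nb : nbhs (0%E : \bar R) [set y : \bar R | (y < e%:E)%E].
    apply: open_nbhs_nbhs; split; first exact: open_ereal_lt_ereal.
    by rewrite /= lte_fin.
  have [N _ /(_ N (leqnn N)) h] := tail _ nb.
  by exists N; exact: ltW.
(* A point below the level a lies below level N + 1 or in the ring of the first level above it. *)
have sub : X `&` A `<=` (X `&` Ak N.+1) `|` \bigcup_(k in ~` `I_N) (X `&` Rk k).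
  move=> x [Xx]; rewrite /A/= => xa.
  have [h|h] := leP (x 0 i) (lev N.+1); first by left.
  right.
  have ex : exists k, x 0 i <= lev k.+2.
    have := truncnS_gt ((a - x 0 i)^-1); set k := Num.trunc _ => hk.
    exists k; rewrite /lev lerBrDr -lerBrDl.
    apply: (@le_trans _ _ (k.+1%:R^-1)).
      by rewrite lef_pV2 ?posrE ?ltr0n// ler_nat; lia.
    by rewrite invf_ple ?posrE ?subr_gt0 ?ltr0n// ltW.
  have := ex_minnP ex => -[k hk kmin].
  have kN : (N <= k)%N.
    rewrite leqNgt; apply/negP => kN; move: h; rewrite ltNge => /negP; apply.
    by rewrite (le_trans hk)//; case: (ltngtP k.+2 N.+1) => [/lev_lt/ltW//|//|[->]//]; lia.
  exists k; first by rewrite /=; apply/negP; rewrite -leqNgt.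
  split => //; rewrite /Rk/= hk andbT ltNge; apply/negP => hk1.
  case: k hk kmin kN hk1 => [|k] hk kmin kN hk1.
    by move: kN; rewrite leqn0 => /eqP N0; move: h; rewrite N0 ltNge hk1.
  by have := kmin _ hk1; rewrite ltnn.
have h1 : (H (X `&` A) <= H (X `&` Ak N.+1) + e%:E)%E.
  apply: (le_trans (le_hausdorff sub)); apply: (le_trans (outer_measureU2 _ _ _)).
  rewrite leeD2l//; apply: le_trans hN.
  exact: outer_measure_sigma_subadditive_tail.
apply: (@le_trans _ _ (H (X `&` Ak N.+1) + e%:E + H (X `&` ~` A))%E); first by rewrite leeD2r.
rewrite addeAC leeD2r//.
apply: (@le_trans _ _ (H (X `&` Ak N.+1 `|` X `&` ~` A))).
  apply: (sep (lev N.+1) a).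
  - by rewrite /lev ltrBlDr ltrDl invr_gt0 ltr0n.
  - by move=> x [].
  - by move=> x [_]; rewrite /A/= => /negP; rewrite -leNgt.
by apply: le_hausdorff => x [[]|[]].
Qed.

Lemma hausdorff_borel A : measurable A -> H.-caratheodory A.
Proof.
have c0 := caratheodory_measurable_set0 H.
have cC := @caratheodory_measurable_setC _ _ H.
have cU := @caratheodory_measurable_bigcup _ _ H.
suff S : @measurable _ V `<=` H.-caratheodory by exact: S.
apply: smallest_sub.
  split => //; first by move=> B hB; rewrite setTD; exact: cC.
move=> B; rewrite -bigcup_seq => -[i _ [C mC <-]]; rewrite setTI.
suff S : measurable `<=` [set C : set (measurableTypeR R) |
    H.-caratheodory ((fun v : V => v 0 i) @^-1` C)] by exact: S.
rewrite [X in X `<=` _](@RGenInftyO.measurableE R).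
apply: smallest_sub.
  split.
  - by rewrite /= preimage_set0; exact: c0.
  - by move=> D hD; rewrite /= setTD preimage_setC; exact: cC.
  - by move=> F hF; rewrite /= preimage_bigcup; exact: cU.
move=> D [x ->] /=.
by have := hausdorff_halfspace i x; congr (_.-caratheodory _).
Qed.

(** Finite additivity on Borel sets in the form needed for integrals of simple functions. *)
Lemma hausdorff_additive_seq (I : eqType) (s : seq I) (F : I -> set V) X : uniq s ->
  (forall i, i \in s -> measurable (F i)) ->
  (forall i j, i != j -> F i `&` F j = set0) ->
  (\sum_(i <- s) H (X `&` F i) <= H X)%E.
Proof.
elim: s X => [|i s IH] X; first by rewrite big_nil hausdorff_ge0.
rewrite big_cons => /=/andP[is_ us] mF tF.
have ci : H.-caratheodory (F i) by apply: hausdorff_borel; apply: mF; rewrite mem_head.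
rewrite (ci X); apply: leeD => //.
have := IH (X `&` ~` F i) us (fun j js => mF j (mem_behead (s := i :: s) js)) tF.
apply: le_trans; rewrite le_eqVlt; apply/orP; left; apply/eqP.
rewrite big_seq [RHS]big_seq; apply: eq_bigr => j js; congr (H _).
apply/seteqP; split => x [Xx Fx]; split => //; last by case: Xx.
split => // Fix; have ij : i != j by apply: contraNneq is_ => ->.
by have : (F i `&` F j) x by []; rewrite tF.
Qed.
End hausdorff_outer.

(** * The constant of the sphere is positive and finite *)

Section sphere.
Context {R : realType}.
Variable m : nat.
Local Notation n := m.+2.
Local Notation V := 'rV[R]_n.
Local Notation W := 'rV[R]_m.+1.
Local Notation H := (@hausdorff R n m.+1).
Local Notation S := (@unit_sphere R n).
Local Notation omega := (@unit_ball_volume R m.+1).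
Implicit Types (s x y : V).

(* Half the side of a cube on which |y|^2 <= 1 / 2. *)
Let c : R := m.+2%:R^-1.

Let c0 : 0 < c. Proof. by rewrite invr_gt0 ltr0n. Qed.

Let c_small : m.+1%:R * c ^+ 2 <= 2^-1.
Proof.
rewrite /c exprVn ler_pdivrMr ?exprn_gt0 ?ltr0n//.
have -> : n%:R = m%:R + 2 :> R by rewrite -[n]addn2 natrD.
have -> : m.+1%:R = m%:R + 1 :> R by rewrite natr1.
have : 0 <= m%:R :> R by [].
nra.
Qed.

Lemma box_sum_sq (p : nat) (a : R) (y : 'rV[R]_p) : (forall i, - a <= y 0 i <= a) ->
  \sum_i y 0 i ^+ 2 <= p%:R * a ^+ 2.
Proof.
move=> h; apply: (@le_trans _ _ (\sum_(i < p) a ^+ 2)).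
  by apply: ler_sum => i _; have /andP[h1 h2] := h i; nra.
by rewrite sumr_const card_ord mulr_natl.
Qed.

Lemma leb_cube (p : nat) (a : R) : 0 <= a ->
  leb R p (boxset (fun _ => `[- a, a]%classic)) = ((2 * a) ^+ p)%:E.
Proof.
move=> a0; rewrite leb_boxset// (eq_bigr (fun=> (2 * a)%:E)).
  by rewrite prodEFin prodr_const card_ord.
move=> i _; rewrite lebesgue_measure_itv/= lte_fin.
case: ltP => h; first by rewrite -EFinB opprK; congr EFin; ring.
by congr EFin; lra.
Qed.

Lemma measurable_sqr_norm (p : nat) :
  measurable_fun setT (fun y : 'rV[R]_p => \sum_i y 0 i ^+ 2).
Proof.
apply: measurable_sum => i; apply: measurable_funX; exact: measurable_coord.
Qed.

(** The unit ball lies between two cubes. *)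
Lemma ball_volume_gt0 : 0 < omega.
Proof.
set B := [set x : W | enorm x <= 1].
have BE : B = (fun y : W => \sum_i y 0 i ^+ 2) @^-1` `]-oo, 1]%classic.
  apply/seteqP; split => y; rewrite /B/preimage/= in_itv/= /enorm => h.
    have s0 : 0 <= \sum_i y 0 i ^+ 2 by apply: sumr_ge0 => i _; exact: sqr_ge0.
    rewrite -(sqr_sqrtr s0) expr_le1//; exact: sqrtr_ge0.
  by rewrite -sqrtr1 ler_wsqrtr.
have mB : measurable B.
  rewrite BE; apply: (@measurable_preimage _ _ _ (measurableTypeR R)) => //.
  exact: measurable_sqr_norm.
have mC (a : R) : measurable (boxset (fun _ : 'I_m.+1 => `[- a, a]%classic)).
  by apply: measurable_boxset => i; exact: measurable_itv.
have lo : (0 < leb R m.+1 B)%E.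
  apply: (@lt_le_trans _ _ (leb R m.+1 (boxset (fun _ => `[- c, c]%classic)))).
    by rewrite leb_cube ?ltW// lte_fin exprn_gt0// mulr_gt0.
  apply: le_measure; rewrite ?inE// => y hy; rewrite BE /preimage/= in_itv/=.
  have hy' i : - c <= y 0 i <= c by have := hy i; rewrite /= in_itv.
  apply: (le_trans (box_sum_sq hy')); apply: (le_trans c_small); lra.
have hi : (leb R m.+1 B < +oo)%E.
  apply: (@le_lt_trans _ _ (leb R m.+1 (boxset (fun _ => `[- 1, 1]%classic)))).
    apply: le_measure; rewrite ?inE// => y hy i; rewrite /= in_itv/= -ler_norml.
    exact: le_trans (coord_le_enorm _ _) hy.
  by rewrite leb_cube// ltry.
by apply: fine_gt0; rewrite lo.
Qed.

(** On this cap the integrand of the sphere constant is at least 1 / 2. *)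
Definition front_cap : set V := [set s | S s /\ 2^-1 <= s 0 ord0 ^+ 2].

Lemma unit_sphereP s : S s <-> \sum_i s 0 i ^+ 2 = 1.
Proof.
have s0 : 0 <= \sum_i s 0 i ^+ 2 by apply: sumr_ge0 => i _; exact: sqr_ge0.
rewrite /unit_sphere/= /enorm; split => h.
  by rewrite -(sqr_sqrtr s0) h expr1n.
by rewrite h sqrtr1.
Qed.

(** Forgetting the first coordinate maps the cap onto a set containing a cube, and maps a
set of diameter d into a cube of side 2 d. So a cover of the cap yields a cover of the
cube by boxes of comparable total volume. *)
Lemma hausdorff_front_cap_gt0 : (0 < H front_cap)%E.
Proof.
have o0 := ball_volume_gt0.
(* The ratio between the volume (2 d)^(m + 1) of a box and the weight omega (d / 2)^(m + 1). *)
pose q : R := 4 ^+ m.+1 / omega.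
have q0 : 0 < q by rewrite divr_gt0// exprn_gt0.
pose Q : set W := boxset (fun _ => `[- c, c]%classic).
suff h : (((2 * c) ^+ m.+1 / q)%:E <= hausdorff_pre m 1 front_cap)%E.
  apply: lt_le_trans (le_trans h (hpre_le _ _ ltr01)).
  by rewrite lte_fin divr_gt0// exprn_gt0// mulr_gt0.
apply: hpre_ge => U hU.
have [hd'|/existsNP[k /negP hk]] := pselect (forall k, (diameter (U k) <= 1%:E)%E); last first.
  rewrite (@eseries_pinfty _ _ xpredT k) ?leey//.
    by move=> j _; rewrite -ltNye (lt_le_trans _ (gauge_ge0 _ _ _)).
  by rewrite /gauge (negbTE hk).
pose d k := fine (diameter (U k)).
have d0 k : 0 <= d k by exact: fine_diameter_ge0.
pose y k := xget 0 (U k).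
pose box k : set W := boxset (fun j => `[y k 0 (lift ord0 j) - d k, y k 0 (lift ord0 j) + d k]%classic).
have mbox k : measurable (box k) by apply: measurable_boxset => j; exact: measurable_itv.
have lbox k : leb R m.+1 (box k) = (q%:E * gauge m 1 (U k))%E.
  rewrite leb_boxset; last by move=> j; exact: measurable_itv.
  rewrite (eq_bigr (fun=> (2 * d k)%:E)); last first.
    move=> j _; rewrite lebesgue_measure_itv/= lte_fin.
    case: ltP => h; first by rewrite -EFinB; congr EFin; ring.
    by congr EFin; have := d0 k; lra.
  rewrite prodEFin prodr_const card_ord /gauge hd' -EFinM; congr EFin.
  rewrite /gauge_wt -/(d k) /q.
  rewrite (_ : d k / 2 = (2 * d k) / 4); last by field.
  rewrite [(_ / 4) ^+ _]exprMn exprVn.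
  by field; rewrite !gt_eqF// exprn_gt0.
have sub : Q `<=` \bigcup_k box k.
  move=> z hz.
  have hz' i : - c <= z 0 i <= c by have := hz i; rewrite /= in_itv.
  have z2 := le_trans (box_sum_sq hz') c_small.
  have z0 : 0 <= \sum_i z 0 i ^+ 2 by apply: sumr_ge0 => i _; exact: sqr_ge0.
  pose a := Num.sqrt (1 - \sum_i z 0 i ^+ 2).
  have a2 : a ^+ 2 = 1 - \sum_i z 0 i ^+ 2 by rewrite sqr_sqrtr//; lra.
  pose s := @vcons R m.+1 (a, z).
  have Ss : front_cap s.
    split; last by rewrite vcons0/= a2; lra.
    apply/unit_sphereP; rewrite big_ord_recl vcons0/= a2.
    rewrite [X in _ + X](_ : _ = \sum_i z 0 i ^+ 2); first by rewrite subrK.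
    by apply: eq_bigr => j _; rewrite vconsS.
  have [k _ Uks] := hU s Ss; exists k => // j; rewrite /= in_itv/=.
  have Uy : U k (y k) by apply: (@xgetPex _ 0 (U k)); exists s.
  have h1 : ((enorm (s - y k))%:E <= diameter (U k))%E.
    by apply: ereal_sup_ubound; exists s => //; exists (y k).
  have fin : diameter (U k) \is a fin_num.
    rewrite fin_numE; apply/andP; split.
      by rewrite -ltNye (lt_le_trans _ h1)// ltNyr.
    by rewrite -ltey (le_lt_trans (hd' k))// ltry.
  have h2 : enorm (s - y k) <= d k by rewrite -lee_fin fineK.
  have := le_trans (coord_le_enorm (s - y k) (lift ord0 j)) h2.
  have -> : (s - y k) 0 (lift ord0 j) = z 0 j - y k 0 (lift ord0 j).
    by rewrite mxE; congr (_ + _); [exact: vconsS|rewrite mxE].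
  by rewrite ler_distl.
have mQ : measurable Q by apply: measurable_boxset => i; exact: measurable_itv.
have h : (leb R m.+1 Q <= \sum_(0 <= k <oo) leb R m.+1 (box k))%E.
  exact: (measure_sigma_subadditive (leb R m.+1) mbox mQ sub).
have lQ : leb R m.+1 Q = ((2 * c) ^+ m.+1)%:E := leb_cube _ (ltW c0).
move: h; rewrite lQ (eq_eseriesr (fun k _ => lbox k)).
rewrite nneseriesZl; last by move=> k _; exact: gauge_ge0.
move=> h; rewrite -(@lee_pmul2l _ q%:E)//.
by apply: le_trans h; rewrite -EFinM lee_fin mulrC divfK// gt_eqF.
Qed.

Let theta : R := n%:R^-1.

Let theta0 : 0 < theta. Proof. by rewrite invr_gt0 ltr0n. Qed.

Definition cap (i : 'I_n) (b : bool) : set V := [set s | S s /\ theta <= (-1) ^+ b * s 0 i].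

(** Some coordinate has square at least 1 / n. *)
Lemma sphere_caps s : S s -> exists i b, cap i b s.
Proof.
move=> Ss; have /unit_sphereP s1 := Ss.
have [i hi] : exists i, theta ^+ 2 <= s 0 i ^+ 2.
  apply: contrapT => /forallNP h.
  have : \sum_(i < n) s 0 i ^+ 2 < \sum_(i < n) theta ^+ 2.
    rewrite !(big_ord_recl m.+1) ltr_leD//.
      by rewrite ltNge; apply/negP; exact: h.
    by apply: ler_sum => i _; rewrite ltW// ltNge; apply/negP; exact: h.
  rewrite s1 ltNge => /negP; apply.
  rewrite sumr_const card_ord -mulr_natl /theta expr2 mulrA mulfV ?mul1r ?pnatr_eq0//.
  by rewrite invf_le1 ?ltr0n// ler1n.
have ha : theta <= `|s 0 i|.
  by rewrite -ler_sqr ?nnegrE ?(ltW theta0)// real_normK ?num_real.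
exists i, (s 0 i < 0); split => //; move: ha.
case: (ltP (s 0 i) 0) => h; first by rewrite ltr0_norm// expr1 mulN1r.
by rewrite ger0_norm// expr0 mul1r.
Qed.

Let Lc : R := (n%:R + 1) * m.+1%:R.

(** On a cap the sphere is a graph over the other coordinates: the squares of the
coordinates sum up to 1 and s_i + s'_i is bounded away from 0. *)
Lemma cap_lipschitz i b s s' h : cap i b s -> cap i b s' ->
  (forall j, `|s 0 (lift i j) - s' 0 (lift i j)| <= h) -> enorm (s - s') <= Lc * h.
Proof.
move=> [Ss hs] [Ss' hs'] hh.
apply: le_trans (enorm_le_sum _) _.
have split_i (F : 'I_n -> R) : \sum_j F j = F i + \sum_j F (lift i j).
  by rewrite (bigD1_ord i).
rewrite split_i.
have sumh : \sum_j `|(s - s') 0 (lift i j)| <= m.+1%:R * h.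
  apply: (@le_trans _ _ (\sum_(j < m.+1) h)).
    by apply: ler_sum => j _; rewrite !mxE; exact: hh.
  by rewrite sumr_const card_ord mulr_natl.
have bd (t : V) : S t -> forall j, `|t 0 j| <= 1.
  by move=> St j; have <- : enorm t = 1 := St; exact: coord_le_enorm.
have E : s 0 i ^+ 2 - s' 0 i ^+ 2 =
    \sum_j (s' 0 (lift i j) ^+ 2 - s 0 (lift i j) ^+ 2).
  have /unit_sphereP := Ss; have /unit_sphereP := Ss'.
  rewrite sumrB !(split_i (fun j => _ ^+ 2)); lra.
have H1 : `|s 0 i ^+ 2 - s' 0 i ^+ 2| <= 2 * (m.+1%:R * h).
  rewrite E (le_trans (ler_norm_sum _ _ _))//.
  apply: (@le_trans _ _ (\sum_(j < m.+1) 2 * h)).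
    apply: ler_sum => j _; rewrite subr_sqr normrM mulrC.
    apply: ler_pM => //; last by rewrite distrC.
    by rewrite (le_trans (ler_normD _ _))// (_ : 2 = 1 + 1 :> R)// lerD// bd.
  by rewrite sumr_const card_ord -mulr_natl; lra.
have H2 : `|s 0 i - s' 0 i| <= n%:R * (m.+1%:R * h).
  have : `|s 0 i - s' 0 i| * (2 * theta) <= 2 * (m.+1%:R * h).
    apply: le_trans H1; rewrite subr_sqr normrM ler_wpM2l//.
    have -> : `|s 0 i + s' 0 i| = `|(-1) ^+ b * s 0 i + (-1) ^+ b * s' 0 i|.
      by rewrite -mulrDr normrM normrX normrN1 expr1n mul1r.
    by rewrite (le_trans _ (ler_norm _))//; lra.
  rewrite mulrCA ler_pM2l// /theta => h3.
  by rewrite ler_pdivrMr ?ltr0n// mulrC in h3.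
rewrite /Lc mulrDl mulrDl mul1r; apply: lerD sumh.
by rewrite !mxE -mulrA.
Qed.

Lemma grid_index (N : nat) (t : R) : (0 < N)%N -> 0 <= t <= N%:R ->
  exists k : 'I_N, (k : nat)%:R <= t <= (k : nat)%:R + 1.
Proof.
elim: N t => // N IH t _ /andP[t0 tN].
have [h|h] := leP t N%:R; last first.
  by exists ord_max; rewrite /= ltW//= natr1.
have [N0|N0] := posnP N.
  by exists ord_max; rewrite /= N0 t0/= add0r; move: h; rewrite N0; lra.
have [|k hk] := IH t N0; first by rewrite t0 h.
by exists (widen_ord (leqnSn N) k).
Qed.

(** The part of a cap above one cell of a grid with N cells in each direction. *)
Definition patch (N : nat) (p : 'I_n * bool * {ffun 'I_m.+1 -> 'I_N}) : set V :=
  [set s | cap p.1.1 p.1.2 s /\ forall j,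
    - 1 + (p.2 j : nat)%:R * (2 / N%:R) <= s 0 (lift p.1.1 j) <=
    - 1 + ((p.2 j : nat)%:R + 1) * (2 / N%:R)].

Lemma patch_cover N : (0 < N)%N -> S `<=` \bigcup_(p in setT) patch (N := N) p.
Proof.
move=> N0 s Ss; have [i [b hc]] := sphere_caps Ss.
have N0' : 0 < N%:R :> R by rewrite ltr0n.
have h j : exists k : 'I_N, - 1 + (k : nat)%:R * (2 / N%:R) <= s 0 (lift i j) <=
    - 1 + ((k : nat)%:R + 1) * (2 / N%:R).
  have sj : `|s 0 (lift i j)| <= 1.
    by have <- : enorm s = 1 := Ss; exact: coord_le_enorm.
  move: sj; rewrite ler_norml => /andP[h1 h2].
  pose t := (s 0 (lift i j) + 1) / (2 / N%:R).
  have tE : s 0 (lift i j) = - 1 + t * (2 / N%:R) by rewrite /t; field; rewrite gt_eqF.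
  have w0 : 0 < 2 / N%:R :> R by rewrite divr_gt0.
  have [|k /andP[k1 k2]] := @grid_index N t N0.
    apply/andP; split; first by apply: divr_ge0; [lra|exact: ltW].
    by rewrite /t ler_pdivrMr// mulrCA mulfV ?gt_eqF//; lra.
  by exists k; rewrite tE !lerD2l !ler_wpM2r ?(ltW w0).
have [g hg] := choice h.
by exists (i, b, [ffun j => g j]) => //; split => // j; rewrite ffunE; exact: hg.
Qed.

Lemma patch_diameter N p : (0 < N)%N -> (diameter (patch (N := N) p) <= (Lc * (2 / N%:R))%:E)%E.
Proof.
move=> N0; apply: ge_ereal_sup => _ [s [hs h1]] [s' [hs' h2]] <-.
rewrite lee_fin; apply: (cap_lipschitz hs hs') => j.
have /andP[a1 a2] := h1 j; have /andP[b1 b2] := h2 j.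
by rewrite ler_norml; apply/andP; split; lra.
Qed.

(** There are of the order of N^(n - 1) patches of diameter of the order of 1 / N. *)
Lemma hausdorff_sphere_fin : (H S < +oo)%E.
Proof.
have L0 : 0 <= Lc by rewrite mulr_ge0// addr_ge0.
have o0 := ball_volume_gt0.
pose K : R := (n * 2)%:R * omega * Lc ^+ m.+1.
apply: (@le_lt_trans _ _ K%:E); last by rewrite ltry.
apply: hausdorff_le => d d0.
pose N := (Num.trunc (Lc * 2 / d)).+1.
have N0 : 0 < N%:R :> R by rewrite ltr0n.
have hN : Lc * (2 / N%:R) <= d.
  have := truncnS_gt (Lc * 2 / d); rewrite -/N => /ltW.
  by rewrite ler_pdivrMr// => h; rewrite mulrA ler_pdivrMr// [d * _]mulrC.
have Np : (0 < N)%N by [].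
clearbody N.
pose F := {: 'I_n * bool * {ffun 'I_m.+1 -> 'I_N}}.
pose U k := nth set0 (map (@patch N) (enum F)) k.
have cov : S `<=` \bigcup_k U k.
  move=> s Ss; have [p _ hp] := patch_cover Np Ss.
  exists (index p (enum F)) => //; rewrite /U (nth_map p).
    by rewrite nth_index// mem_enum.
  by rewrite index_mem mem_enum.
apply: (le_trans (hpre_cover m d cov)).
pose w : R := omega * (Lc / N%:R) ^+ m.+1.
have sz : size (map (@patch N) (enum F)) = (n * 2 * N ^ m.+1)%N.
  rewrite size_map -cardE !card_prod card_ord card_bool card_ffun !card_ord//.
rewrite (nneseries_split _ (n * 2 * N ^ m.+1)%N); last by move=> k _; exact: gauge_ge0.
rewrite [X in (_ + X)%E]eseries0 ?adde0; last first.
  by move=> k hk _; rewrite /U nth_default ?gauge0// sz.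
apply: (@le_trans _ _ (\sum_(0 <= k < n * 2 * N ^ m.+1) w%:E)%E).
  rewrite big_nat [leRHS]big_nat; apply: lee_sum => k /andP[_ hk].
  have hp : exists p, U k = @patch N p.
    have hk' : (k < size (enum F))%N by rewrite -(size_map (@patch N)) sz.
    case E : (enum F) hk' => [//|p0 e] hk'.
    by exists (nth p0 (enum F) k); rewrite /U (nth_map p0) ?E.
  have [p ->] := hp; have D := patch_diameter p Np.
  rewrite /gauge (le_trans D) ?lee_fin// /gauge_wt /w ler_pM2l//.
  apply: lerXn2r; rewrite ?nnegrE ?divr_ge0 ?fine_diameter_ge0// ler_pdivrMr//.
  have -> : Lc / N%:R * 2 = Lc * (2 / N%:R) by ring.
  case: (diameter (patch p)) D => [r| |]//=.
  by rewrite mulr_ge0// divr_ge0.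
rewrite sumEFin lee_fin sumr_const_nat subn0 -mulr_natl /w /K.
rewrite !natrM natrX exprMn exprVn le_eqVlt; apply/orP; left; apply/eqP.
by field; rewrite expf_neq0// gt_eqF.
Qed.

Lemma measurable_sphere : measurable S.
Proof.
rewrite (_ : S = (fun y : V => \sum_i y 0 i ^+ 2) @^-1` [set 1]).
  apply: (@measurable_preimage _ _ _ (measurableTypeR R)); first exact: measurable_sqr_norm.
  exact: measurable_set1.
by apply/seteqP; split => s; [move/unit_sphereP|move=> h; apply/unit_sphereP].
Qed.

Import HBNNSimple.

Lemma sphere_constant_gt0 : 0 < sphere_constant n :> R.
Proof.
pose F : V -> \bar R := fun s => ((`|dot (@first_unit R n) s| ^+ 2)%R)%:E.
have FE s : F s = (s 0 ord0 ^+ 2)%:E.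
  rewrite /F real_normK ?num_real// /dot (bigD1 ord0)//= big1 ?addr0.
    by rewrite mxE/= mul1r.
  move=> i; rewrite mxE; case: i => -[|i] ?//= _; by rewrite mul0r.
pose G := F \_ S.
have G0 s : (0 <= G s)%E by rewrite /G patchE; case: ifP => // _; rewrite lee_fin sqr_ge0.
have Gp : (G^\+)%E = G.
  by apply/funext => s; rewrite funeposE; apply/max_idPl.
have Gn : (G^\-)%E = cst 0%E.
  by apply/funext => s; rewrite funenegE/=; apply/max_idPr; rewrite oppe_le0.
pose NN (g : V -> \bar R) := ereal_sup [set sintegral H h |
  h in [set h : {nnsfun V >-> R} | forall x, ((h x)%:E <= g x)%E]].
have IE : (\int[H]_(s in S) F s = NN G - NN (cst 0%E))%E.
  transitivity (NN (G^\+) - NN (G^\-))%E; first by [].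
  by rewrite Gn Gp.
have sE (h : {nnsfun V >-> R}) :
    sintegral H h = (\sum_(x \in range h) x%:E * H (h @^-1` [set x]))%E.
  rewrite /sintegral (fsbig_widen (range h) setT)//= => x [_ Nfx] /=.
  by rewrite preimage10// hausdorff0 mule0.
have s_ge0 (h : {nnsfun V >-> R}) : (0 <= sintegral H h)%E.
  rewrite sE; apply: fsume_ge0 => x [y _ <-].
  by rewrite mule_ge0 ?lee_fin ?fun_ge0// hausdorff_ge0.
have N0 : NN (cst 0%E) = 0%E.
  apply/eqP; rewrite eq_le; apply/andP; split.
    apply: ge_ereal_sup => _ [h hh <-]; rewrite sE fsbig1// => x [y _ <-].
    have -> : h y = 0.
      by apply/eqP; rewrite eq_le fun_ge0 andbT -lee_fin; exact: hh.
    by rewrite mul0e.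
  pose z : {nnsfun V >-> R} := indic_nnsfun R (@measurable0 _ V).
  apply: le_trans (s_ge0 z) _; apply: ereal_sup_ubound; exists z => //= x.
  by rewrite mindicE in_set0.
have up : (NN G <= H S)%E.
  apply: ge_ereal_sup => _ [h hh <-]; rewrite sE fsbig_finite; last exact: fimfunP.
  suff : (\sum_(x <- finmap.enum_fset (fset_set (range h))) x%:E * H (h @^-1` [set x]) <= H S)%E by [].
  apply: (@le_trans _ _ (\sum_(x <- finmap.enum_fset (fset_set (range h))) H (S `&` h @^-1` [set x]))%E).
    rewrite big_seq [leRHS]big_seq; apply: lee_sum => x.
    rewrite in_fset_set; last exact: fimfunP.
    rewrite inE => -[y _ <-]; have [->|hy] := eqVneq (h y) 0.
      by rewrite mul0e hausdorff_ge0.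
    have Sy : h @^-1` [set h y] `<=` S.
      move=> w /= hw; apply: contrapT => Sw; move: (hh w).
      rewrite /G patchE memNset// hw lee_fin => h0; move/negP: hy; apply.
      by rewrite eq_le h0 fun_ge0.
    have hy1 : h y <= 1.
      have Syy : S y by exact: Sy.
      rewrite -lee_fin (le_trans (hh y))// /G patchE mem_set// FE lee_fin.
      have := coord_le_enorm y ord0; rewrite (_ : enorm y = 1)// => h1.
      by rewrite -(real_normK (num_real (y 0 ord0))) expr_le1.
    rewrite setIC (setIidl Sy) -[leRHS]mul1e lee_wpmul2r// hausdorff_ge0//.
  apply: hausdorff_additive_seq => // i j ij.
  by apply/seteqP; split => // w [/= -> /eqP]; rewrite (negbTE ij).
have mB : measurable front_cap.
  have -> : front_cap = S `&` (fun y : V => y 0 ord0 ^+ 2) @^-1` `[2^-1, +oo[%classic.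
    by apply/seteqP; split => s [Ss]; rewrite /preimage/= in_itv/= andbT.
  apply: measurableI; first exact: measurable_sphere.
  apply: (@measurable_preimage _ _ _ (measurableTypeR R)) => //.
  by apply: measurable_funX; exact: measurable_coord.
have half : 0 <= 2^-1 :> R by rewrite invr_ge0.
have [h0 h0E] : exists h0 : {nnsfun V >-> R}, forall s, h0 s = 2^-1 * \1_front_cap s.
  by exists (scale_nnsfun (indic_nnsfun R mB) half).
have lo : ((2^-1)%:E * H front_cap <= NN G)%E.
  apply: (@le_trans _ _ (sintegral H h0)).
    rewrite /sintegral -(fsbig_widen [set 2^-1] setT)//; last first.
      move=> x [_ /= hx]; have [->|x0] := eqVneq x 0; first by rewrite mul0e.
      rewrite (_ : _ @^-1` _ = set0) ?hausdorff0 ?mule0//.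
      apply/seteqP; split => // s /=; rewrite h0E indicE.
      case: (s \in _); rewrite ?mulr1 ?mulr0 => h.
        by apply: hx; rewrite h.
      by rewrite h eqxx in x0.
    rewrite fsbig_set1 lee_wpmul2l ?lee_fin//; apply: le_hausdorff => s hs /=.
    by rewrite h0E indicE mem_set// mulr1.
  apply: ereal_sup_ubound; exists h0 => //= s.
  rewrite h0E indicE; case: (boolP (s \in front_cap)) => hs; last by rewrite mulr0.
  move: hs; rewrite inE => -[Ss hs]; rewrite mulr1 /G patchE mem_set// FE lee_fin//.
rewrite /sphere_constant -/F IE N0 sube0; apply: fine_gt0; apply/andP; split.
  apply: lt_le_trans lo; rewrite mule_gt0 ?lte_fin ?invr_gt0//.
  exact: hausdorff_front_cap_gt0.
exact: le_lt_trans up hausdorff_sphere_fin.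
Qed.
End sphere.

(** * Barriers and the maximum principle *)

Section barrier.
Context {R : realType}.
Implicit Types (y : R -> R) (d e t s T : R).

(** At a maximum point of [y] on [0, t1] with value above [M] there is no earlier larger
value. Asking only for an earlier larger value, instead of a negative derivative,
covers the maximum over space of a solution, which need not be differentiable. *)
Lemma barrier y M t1 : 0 <= t1 -> {within `[0, t1], continuous y} -> y 0 <= M ->
  (forall t, 0 < t <= t1 -> M < y t -> exists2 s, 0 <= s < t & y t < y s) ->
  y t1 <= M.
Proof.
move=> t10 cy y0 H; rewrite leNgt; apply/negP => My.
have [t + tmax] := EVT_max t10 cy; rewrite in_itv/= => /andP[t0 tt1].
have Mt : M < y t by rewrite (lt_le_trans My)// tmax// in_itv/= t10 lexx.
have tp : 0 < t.
  by rewrite lt_def t0 andbT; apply: contraTneq Mt => ->; rewrite -leNgt.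
have [|s /andP[s0 st] ys] := H t _ Mt; first by rewrite tp.
have := tmax s; rewrite in_itv/= s0 (ltW (lt_le_trans st tt1)) => /(_ isT).
by rewrite leNgt ys.
Qed.

(** One-sided at the end points of [0, T], unlike the derivative. *)
Definition difquot T y t d := forall e, 0 < e -> exists2 dl, 0 < dl &
  forall s, 0 <= s <= T -> s != t -> `|s - t| < dl ->
    `|(y s - y t) / (s - t) - d| <= e.

Lemma difquot_neg T y t d : 0 < t <= T -> d < 0 -> difquot T y t d ->
  exists2 s, 0 <= s < t & y t < y s.
Proof.
move=> /andP[t0 tT] d0 H; have [|dl dl0 hd] := H (- d / 2); first by lra.
(* At t - h the quotient is at most d / 2 < 0. *)
pose h := Num.min dl t / 2.
have h0 : 0 < h by rewrite divr_gt0// lt_min dl0.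
have h1 : h < dl by have := ge_min dl dl t; rewrite lexx/= /h; lra.
have h2 : h < t by have := ge_min t dl t; rewrite lexx orbT/= /h; lra.
exists (t - h); first by apply/andP; split; lra.
have := hd (t - h); rewrite (_ : t - h - t = - h); last by ring.
rewrite normrN gtr0_norm// => /(_ _ _ h1) h3.
have : `|(y (t - h) - y t) / - h - d| <= - d / 2.
  by apply: h3; [apply/andP; split; lra|rewrite lt_eqF//; lra].
rewrite ler_norml => /andP[_]; rewrite invrN mulrN => h4.
have h5 : 0 < (y (t - h) - y t) / h by lra.
by rewrite -subr_gt0; move: h5; rewrite pmulr_lgt0// invr_gt0.
Qed.

Lemma difquot_derive1 T y t d : 0 < t < T -> difquot T y t d -> derive1 y t = d.
Proof.
move=> /andP[t0 tT] H; rewrite /derive1; apply: cvg_lim => //.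
apply/cvgrPdist_le => e e0; have [dl dl0 hd] := H e e0.
pose r := Num.min dl (Num.min t (T - t)).
have r0 : 0 < r by rewrite !lt_min dl0 t0 subr_gt0.
apply/nbhs_ballP; exists r => //= h; rewrite /ball/= sub0r normrN => hr hn.
move: hr; rewrite !lt_min !ltr_norml => /and3P[/andP[a1 a2] /andP[a3 a4] /andP[a5 a6]].
have := hd (h + t); rewrite addrK ltr_norml a1 a2 => hs.
rewrite distrC /GRing.scale/= mulrC; apply: hs => //; first by apply/andP; split; lra.
by rewrite -subr_eq0 addrK.
Qed.

End barrier.

Section evolution.
Context {R : realType} {n : nat}.
Local Notation V := 'rV[R]_n.
Implicit Types (w : V -> R) (u g : R -> V -> R) (x : V) (t s e T : R).
Local Notation II f := (\int[leb R n]_(x in cell) f x).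

Lemma max_periodic w : torus_periodic w -> continuous w -> exists x, forall y, w y <= w x.
Proof.
move=> pw cw; pose K : set V := [set v | forall i, `[- pi, pi]%classic (v ord0 i)].
have cK : compact K.
  apply: (@rV_compact R n (fun _ => `[- pi, pi]%classic)) => i.
  exact: segment_compact.
have p0 := pi_ge0 R.
have K0 : K !=set0 by exists 0 => i; rewrite /= mxE in_itv/=; apply/andP; split; lra.
have [|x _ hx] := @EVT_max_rV R n w K K0 cK.
  exact: continuous_subspaceT.
exists x => y; rewrite -(periodic_cell_rep pw y); apply: hx; rewrite inE => i.
have := cell_rep_cell y i; rewrite /= !in_itv/= => /andP[-> /ltW ->//].
Qed.

Lemma continuous_normr w : continuous w -> continuous (fun x => `|w x|).
Proof.
move=> cw x; apply: (@continuous_comp V R R w (fun r => `|r|)); first exact: cw.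
exact: (@norm_continuous R R).
Qed.

Lemma tfun_continuous w : torus_periodic w -> continuous w -> bounded_torus_fun w.
Proof.
move=> pw cw; split => //; split; first exact: measurable_continuous.
have [||x hx] := @max_periodic (fun x => `|w x|).
- by move=> x i; rewrite pw.
- exact: continuous_normr.
by exists `|w x|.
Qed.

Lemma Cnorm_fin w : (Cnorm w < +oo)%E ->
  [/\ torus_periodic w, continuous w & forall e x, (Cnorm w < e%:E)%E -> `|w x| <= e].
Proof.
rewrite /Cnorm; case: asboolP => [[pw cw] _|_]; last by rewrite ltxx.
split => // e x /ltW h; rewrite -lee_fin; apply: le_trans h.
by apply: ereal_sup_ubound; exists x.
Qed.

Lemma C0_in_periodic T u t : C0_in Cnorm T u -> 0 <= t <= T ->
  torus_periodic (u t) /\ continuous (u t).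
Proof.
move=> H ht; have [|/Cnorm_fin[? ? _] _] := H t; first by rewrite in_itv.
by split.
Qed.

(** Turns convergence in the extended norm into uniform estimates. *)
Lemma Cnorm_cvg0 (F : set_system R) (w : R -> V -> R) e : 0 < e -> Filter F ->
  (fun s => Cnorm (w s)) @ F --> 0%E -> F [set s | forall x, `|w s x| <= e].
Proof.
move=> e0 FF H.
have nb : nbhs (0%E : \bar R) [set y : \bar R | (y < e%:E)%E].
  apply: open_nbhs_nbhs; split; first exact: open_ereal_lt_ereal.
  by rewrite /= lte_fin.
have h : F [set s | (Cnorm (w s) < e%:E)%E] := H _ nb.
apply: (@filterS _ F FF _ _ _ h) => s hs x.
have fs : (Cnorm (w s) < +oo)%E by exact: lt_trans hs (ltry _).
by have [_ _ hw] := Cnorm_fin fs; exact: hw.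
Qed.

Lemma C0_in_dist T u t e : C0_in Cnorm T u -> 0 <= t <= T -> 0 < e ->
  exists2 dl, 0 < dl & forall s, 0 <= s <= T -> `|s - t| < dl ->
    forall x, `|u s x - u t x| <= e.
Proof.
move=> H ht e0; have [|_ h] := H t; first by rewrite in_itv.
have := @Cnorm_cvg0 (within `[0, T] (nbhs t)) (fun s x => u s x - u t x) e e0 _ h.
move=> /(_ _)/nbhs_ballP[dl dl0 hd].
exists dl => // s sT st x; apply: (hd s); last by rewrite /= in_itv.
by rewrite /ball/= distrC.
Qed.

Lemma C1_in_difquot T u : C1_in Cnorm T u -> C0_in Cnorm T u /\
  exists2 g, C0_in Cnorm T g & forall t e, 0 <= t <= T -> 0 < e ->
  exists2 dl, 0 < dl & forall s, 0 <= s <= T -> s != t -> `|s - t| < dl ->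
    forall x, `|(u s x - u t x) / (s - t) - g t x| <= e.
Proof.
move=> [H [g Hg Hd]]; split => //; exists g => // t e ht e0.
have := Hd t; rewrite in_itv/= ht => /(_ isT) h.
have := @Cnorm_cvg0 (within `[0, T] t^') (fun s x => (u s x - u t x) / (s - t) - g t x) e e0 _ h.
move=> /(_ _)/nbhs_ballP[dl dl0 hd].
exists dl => // s sT sn st x.
have b : ball t dl s by rewrite /ball/= distrC.
have i : `[0, T]%classic s by rewrite /= in_itv.
exact: hd.
Qed.

Variables (rho : R -> R -> R).
Hypothesis hrho : kernel_family n rho.

Lemma nonlocal_max eta w x : 0 < eta -> bounded_torus_fun w -> (forall y, w y <= w x) ->
  0 <= nonlocal_op rho eta w x.
Proof.
move=> e0 tw hx; rewrite (nonlocal_opE hrho x e0 tw); apply: II_ge0 => z _.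
by rewrite mulr_ge0 ?subr_ge0// (kernel_ge0 hrho).
Qed.

Lemma nonlocal_opN eta w x : 0 < eta -> bounded_torus_fun w ->
  nonlocal_op rho eta (fun y => - w y) x = - nonlocal_op rho eta w x.
Proof.
move=> e0 tw; have tw' : bounded_torus_fun (fun y => - w y).
  have := tfunM (tfun_cst (-1)) tw; congr bounded_torus_fun; apply/funext => y; rewrite mulN1r//.
rewrite (nonlocal_opE hrho x e0 tw) (nonlocal_opE hrho x e0 tw').
have i1 : cell_integrable (fun z => kernel_J rho eta z * (w x - w (x - z))).
  by apply: (ic_kernelM hrho e0); exact: (tfunB (tfun_cst (w x)) (tfunN_arg x tw)).1.
transitivity (-1 * II (fun z => kernel_J rho eta z * (w x - w (x - z)))).
  by rewrite -(IIZ (-1) i1); apply: eq_Rintegral => z _; ring.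
by rewrite mulN1r.
Qed.

(** Stated for a general nonlinearity [h], so that it also applies to - u. *)
Lemma max_principle eta eps T M (h : R -> R) u g : 0 < eta -> 0 < eps ->
  C0_in Cnorm T u ->
  (forall t, 0 < t < T -> forall x, difquot T (fun s => u s x) t (g t x)) ->
  (forall t x, 0 < t < T -> g t x + nonlocal_op rho eta (u t) x + h (u t x) / eps ^+ 2 = 0) ->
  (forall r, M < r -> 0 < h r) -> (forall x, u 0 x <= M) ->
  forall t x, 0 <= t < T -> u t x <= M.
Proof.
move=> eta0 eps0 Cu Du Eq hM u0 t1 x1 /andP[t10 t1T].
have rng t : 0 <= t <= t1 -> 0 <= t <= T.
  by move=> /andP[-> h1]; rewrite (le_trans h1)// ltW.
have hm t : exists x, 0 <= t <= T -> forall y, u t y <= u t x.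
  have [ht|ht] := boolP (0 <= t <= T); last by exists 0.
  have [p c] := C0_in_periodic Cu ht.
  by have [x hx] := max_periodic p c; exists x.
have [xm hxm] := choice hm.
pose y t := u t (xm t).
suff : y t1 <= M.
  by apply: le_trans; apply: hxm; apply: rng; rewrite t10 lexx.
apply: barrier => //; first last.
- move=> t /andP[t0 tt1] yt.
  have tT : 0 < t < T by rewrite t0 (le_lt_trans tt1).
  have tT' : 0 <= t <= T by rewrite ltW//= (le_trans tt1)// ltW.
  have [p c] := C0_in_periodic Cu tT'.
  have L0 : 0 <= nonlocal_op rho eta (u t) (xm t).
    by apply: nonlocal_max => //; [exact: tfun_continuous|exact: hxm].
  have g0 : g t (xm t) < 0.
    have h0 : 0 < h (u t (xm t)) / eps ^+ 2.
      by rewrite divr_gt0 ?exprn_gt0//; exact: hM.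
    by have := Eq t (xm t) tT; lra.
  have tT2 : 0 < t <= T by rewrite t0/=; case/andP: tT'.
  have [s s0 hs] := difquot_neg tT2 g0 (Du t tT (xm t)).
  exists s => //; apply: (lt_le_trans hs); apply: hxm.
  by case/andP: s0 => -> /ltW st; case/andP: tT' => _; exact: le_trans.
- exact: u0.
apply/subspace_continuousP => t /=; rewrite in_itv/= => /rng ht.
apply/cvgrPdist_le => e e0; have [dl dl0 hd] := C0_in_dist Cu ht e0.
apply/nbhs_ballP; exists dl => //= s; rewrite /ball/= distrC => st.
rewrite in_itv/= => /rng hs; have hd' := hd s hs st.
have h1 := hxm t ht (xm s); have h2 := hxm s hs (xm t).
suff : `|y t - y s| <= e by [].
have := hd' (xm s); have := hd' (xm t); rewrite /y !ler_norml => /andP[a1 a2] /andP[b1 b2].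
by apply/andP; split; lra.
Qed.

(** A nonempty open set contains a box and thus has positive measure. *)
Lemma ae_le_continuous w M : continuous w -> {ae leb R n, forall x, `|w x| <= M} ->
  forall x, `|w x| <= M.
Proof.
move=> cw [N [mN N0 hN]] x; rewrite leNgt; apply/negP => hx.
have nb : nbhs (`|w x| : R) [set r : R | M < r] by exact: lt_nbhsr.
have := (continuous_normr cw : forall y, _) x _ nb.
move=> /nbhs_ballP[d /= d0 hd].
pose W : set V := boxset (fun i => `]x 0 i - d, x 0 i + d[%classic).
have mW : measurable W by apply: measurable_boxset => i; exact: measurable_itv.
have W0 : (0 < leb R n W)%E.
  rewrite leb_boxset; last by move=> i; exact: measurable_itv.
  rewrite (eq_bigr (fun=> (2 * d)%:E)); last first.
    move=> i _; rewrite lebesgue_measure_itv/= lte_fin ltrBlDr -addrA ltrDl addr_gt0//.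
    by rewrite -EFinB; congr EFin; ring.
  by rewrite prodEFin lte_fin prodr_gt0// => i _; rewrite mulr_gt0.
have : (leb R n W <= leb R n N)%E.
  apply: le_measure; rewrite ?inE// => y hy; apply: hN => /=; apply/negP.
  rewrite -ltNge; apply: hd; split => // i j; rewrite (ord1 i) /ball/=.
  have := hy j; rewrite /= in_itv/= => /andP[h1 h2].
  by rewrite distrC ltr_norml; apply/andP; split; lra.
by rewrite N0 leNgt W0.
Qed.

End evolution.

(** * Energy inequality for third differences *)

Section energy.
Context {R : realType} {n : nat}.
Local Notation V := 'rV[R]_n.
Implicit Types (w v : V -> R) (u g : R -> V -> R) (x z : V) (t s e T : R).
Local Notation II f := (\int[leb R n]_(x in cell) f x).
Local Notation torus_volume := (@torus_volume R n).

Lemma dif3E z w x : fdiff3 z w x =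
  w (x + z + z + z) - 3 * w (x + z + z) + 3 * w (x + z) - w x.
Proof. by rewrite /fdiff3 /fdiff; ring. Qed.

Lemma dif3_bound z w e : (forall x, `|w x| <= e) -> forall x, `|fdiff3 z w x| <= 8 * e.
Proof.
move=> h x; rewrite dif3E.
have := h (x + z + z + z); have := h (x + z + z); have := h (x + z); have := h x.
rewrite !ler_norml => /andP[? ?] /andP[? ?] /andP[? ?] /andP[? ?].
by apply/andP; split; lra.
Qed.

Lemma tfun_dif3 z w : bounded_torus_fun w -> bounded_torus_fun (fdiff3 z w).
Proof. by move=> tw; do 3 apply: tfun_dif. Qed.

Lemma II_norm_le w c : bounded_torus_fun w -> (forall x, `|w x| <= c) -> `|II w| <= c * torus_volume.
Proof.
move=> tw h; have [[mw _] _] := tw.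
apply: le_trans (le_normr_Rintegral measurable_cell (ic_tfun tw)) _.
rewrite -II_cst; apply: II_le.
- by apply: ic_tfun; exact: tfun_norm.
- by apply: ic_tfun; exact: tfun_cst.
- by move=> x _; exact: h.
Qed.

Lemma difquot_continuous (y : R -> R) T t1 : t1 <= T ->
  (forall t, 0 <= t <= t1 -> exists d, difquot T y t d) ->
  {within `[0, t1], continuous y}.
Proof.
move=> t1T H; apply/subspace_continuousP => t /=; rewrite in_itv/= => ht.
have [d hd] := H t ht; have [dl dl0 hdl] := hd 1 ltr01.
apply/cvgrPdist_le => e e0.
have q0 : 0 < `|d| + 1 by rewrite ltr_wpDl.
(* The difference quotients at t are bounded by |d| + 1. *)
pose r := Num.min dl (e / (`|d| + 1)).
have r0 : 0 < r by rewrite lt_min dl0 divr_gt0.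
apply/nbhs_ballP; exists r => //= s; rewrite /ball/= lt_min => /andP[s1 s2].
rewrite in_itv/= => /andP[s0 st1].
suff : `|y t - y s| <= e by [].
have [->|st] := eqVneq s t; first by rewrite subrr normr0 ltW.
have := hdl s; rewrite s0 (le_trans st1 t1T) distrC => /(_ isT st s1) h.
have st' : s - t != 0 by rewrite subr_eq0.
have -> : y t - y s = - ((y s - y t) / (s - t) * (s - t)) by rewrite divfK// opprB.
rewrite normrN normrM.
have h2 : `|(y s - y t) / (s - t)| <= `|d| + 1.
  rewrite -[X in `|X|](subrK d) (le_trans (ler_normD _ _))// addrC.
  by rewrite lerD2l; move: h; rewrite distrC.
apply: (@le_trans _ _ ((`|d| + 1) * `|s - t|)); first by rewrite ler_wpM2r.
by rewrite distrC mulrC -ler_pdivlMr// ltW.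
Qed.

(** X is differentiated as a^2 - p^2 = (a - p)(a + p), with uniform convergence of the
difference quotients of the third differences. *)
Lemma energy_difquot z T t u g : 0 <= t <= T ->
  (forall s, 0 <= s <= T -> bounded_torus_fun (u s)) -> bounded_torus_fun (g t) ->
  C0_in Cnorm T u ->
  (forall e, 0 < e -> exists2 dl, 0 < dl & forall s, 0 <= s <= T -> s != t -> `|s - t| < dl ->
    forall x, `|(u s x - u t x) / (s - t) - g t x| <= e) ->
  difquot T (fun s => sqnorm (fdiff3 z (u s))) t
    (2 * II (fun x => fdiff3 z (u t) x * fdiff3 z (g t) x)).
Proof.
move=> ht tu tg Cu hg e e0.
have v0 : 0 < torus_volume by exact: vol_gt0.
have tp := tfun_dif3 z (tu t ht); have tr := tfun_dif3 z tg.
set p := fdiff3 z (u t) in tp *; set r := fdiff3 z (g t) in tr *.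
have [[_ [P hP]] _] := tp; have [[_ [Q hQ]] _] := tr.
have P0 : 0 <= P := le_trans (normr_ge0 _) (hP 0).
have Q0 : 0 <= Q := le_trans (normr_ge0 _) (hQ 0).
(* 8 is the sum of the coefficients 1, 3, 3, 1 of a third difference. *)
pose K := 8 * (2 * P + 8) + 8 * Q.
have K0 : 0 < K by rewrite /K; lra.
pose e1 := Num.min 1 (e / (K * torus_volume)).
have e10 : 0 < e1 by rewrite lt_min ltr01 divr_gt0// mulr_gt0.
have e11 : e1 <= 1 by rewrite ge_min lexx.
have e1K : K * e1 * torus_volume <= e.
  have : e1 <= e / (K * torus_volume) by rewrite ge_min lexx orbT.
  by rewrite ler_pdivlMr ?mulr_gt0// mulrCA mulrA.
have [d1 d10 h1] := hg e1 e10; have [d2 d20 h2] := C0_in_dist Cu ht e10.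
exists (Num.min d1 d2); first by rewrite lt_min d10.
move=> s sT st; rewrite lt_min => /andP[sd1 sd2].
have {}h1 := h1 s sT st sd1; have {}h2 := h2 s sT sd2.
have st' : s - t != 0 by rewrite subr_eq0.
have ta := tfun_dif3 z (tu s sT); set a := fdiff3 z (u s) in ta *.
have hq x : `|(a x - p x) / (s - t) - r x| <= 8 * e1.
  have -> : (a x - p x) / (s - t) - r x =
      fdiff3 z (fun x => (u s x - u t x) / (s - t) - g t x) x.
    by rewrite /a /p /r !dif3E; field.
  by apply: dif3_bound.
have hap x : `|a x - p x| <= 8 * e1.
  have -> : a x - p x = fdiff3 z (fun x => u s x - u t x) x.
    by rewrite /a /p !dif3E; ring.
  by apply: dif3_bound.
pose F x := (s - t)^-1 * (a x ^+ 2 - p x ^+ 2) - 2 * (p x * r x).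
have tF : bounded_torus_fun F.
  apply: tfunB; apply: tfunM; try exact: tfun_cst.
    by apply: tfunB; exact: tfunX.
  exact: tfunM.
have ia := ic_tfun (tfunX 2 ta); have ip := ic_tfun (tfunX 2 tp).
have ipr := ic_tfun (tfunM tp tr).
have -> : (sqnorm a - sqnorm p) / (s - t) - 2 * II (fun x => p x * r x) = II F.
  rewrite /F (IIB (icZ _ (icB ia ip)) (icZ 2 ipr)) (IIZ _ (icB ia ip)) (IIZ 2 ipr) (IIB ia ip).
  by rewrite mulrC.
apply: le_trans e1K; apply: II_norm_le => // x.
have -> : F x = ((a x - p x) / (s - t) - r x) * (a x + p x) + r x * (a x - p x).
  by rewrite /F; field.
have hs : `|a x + p x| <= 2 * P + 8.
  have -> : a x + p x = (a x - p x) + 2 * p x by ring.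
  rewrite (le_trans (ler_normD _ _))// normrM (@ger0_norm _ 2)//.
  by have := hP x; have := hap x; lra.
apply: (le_trans (ler_normD _ _)); rewrite !normrM.
apply: (@le_trans _ _ (8 * e1 * (2 * P + 8) + Q * (8 * e1))).
  by apply: lerD; apply: ler_pM.
by rewrite /K le_eqVlt; apply/orP; left; apply/eqP; ring.
Qed.

Variables (rho : R -> R -> R).
Hypothesis hrho : kernel_family n rho.
Hypothesis hpos : 0 < II (fun z => Num.min (@kernel_J R n rho 1 z) 1).

Lemma nonlocal_dif eta z w : 0 < eta -> bounded_torus_fun w ->
  nonlocal_op rho eta (fdiff z w) = fdiff z (nonlocal_op rho eta w).
Proof.
move=> e0 tw; apply/funext => x; rewrite {2}/fdiff.
rewrite (nonlocal_opE hrho x e0 (tfun_dif z tw)) (nonlocal_opE hrho x e0 tw).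
rewrite (nonlocal_opE hrho (x + z) e0 tw).
have i1 y : cell_integrable (fun y' => kernel_J rho eta y' * (w y - w (y - y'))).
  by apply: (ic_kernelM hrho e0); exact: (tfunB (tfun_cst (w y)) (tfunN_arg y tw)).1.
rewrite -(IIB (i1 (x + z)) (i1 x)); apply: eq_Rintegral => y _.
by rewrite /fdiff (addrAC x z); ring.
Qed.

Lemma nonlocal_dif3 eta z w : 0 < eta -> bounded_torus_fun w ->
  nonlocal_op rho eta (fdiff3 z w) = fdiff3 z (nonlocal_op rho eta w).
Proof.
move=> e0 tw; rewrite /fdiff3 nonlocal_dif//; last by do 2 apply: tfun_dif.
by rewrite nonlocal_dif//; [rewrite nonlocal_dif//|exact: tfun_dif].
Qed.

(** Expand the square of v + w. *)
Lemma cross_term_bound C v w : bounded_torus_fun v -> bounded_torus_fun w -> sqnorm w <= C * sqnorm v ->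
  - ((1 + C) / 2 * sqnorm v) <= II (fun x => v x * w x).
Proof.
move=> tv tw h.
have i1 := ic_tfun (tfunX 2 tv); have i2 := ic_tfun (tfunX 2 tw).
have i3 := ic_tfun (tfunM tv tw).
have : 0 <= II (fun x => (v x ^+ 2 + w x ^+ 2) + 2 * (v x * w x)).
  apply: II_ge0 => x _.
  have -> : v x ^+ 2 + w x ^+ 2 + 2 * (v x * w x) = (v x + w x) ^+ 2 by ring.
  exact: sqr_ge0.
rewrite (IID (icD i1 i2) (icZ 2 i3)) (IID i1 i2) (IIZ 2 i3) -/(sqnorm v) -/(sqnorm w).
by lra.
Qed.

(** If X(t) > X(0) + 2 L with L the low mode contribution, coercivity with the constant
1 + C beats the reaction term and X'(t) < 0, so that [barrier] applies. *)
Lemma energy_bound (f : R -> R) M : smoothR f -> 1 <= M ->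
  exists A c : R, [/\ 0 < A, 0 < c &
  forall eps eta T, 0 < eps < 1 -> 0 < eta <= c * eps ^+ 4 ->
  forall u g, C0_in Cnorm T u -> C0_in Cnorm T g ->
  (forall t e, 0 <= t <= T -> 0 < e -> exists2 dl, 0 < dl &
    forall s, 0 <= s <= T -> s != t -> `|s - t| < dl ->
    forall x, `|(u s x - u t x) / (s - t) - g t x| <= e) ->
  (forall t x, 0 < t < T ->
    g t x + nonlocal_op rho eta (u t) x + derive1 f (u t x) / eps ^+ 2 = 0) ->
  (forall t x, 0 <= t < T -> `|u t x| <= M) ->
  forall t i h, 0 <= t < T ->
  sqnorm (fdiff3 (h *: delta_mx 0 i) (u t)) <= sqnorm (fdiff3 (h *: delta_mx 0 i) (u 0)) +
    2 * ((h * (A / eps)) ^+ 6 * (M ^+ 2 * torus_volume))].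
Proof.
move=> sf M1; have [C C0 HC] := moser (n := n) sf M1.
have B1 : 1 <= 1 + C by rewrite lerDl.
have [A [c [A0 c0 Hco]]] := coercive hrho hpos B1.
exists A, c; split => // eps eta T he hn u g Cu Cg hg Eq uM t1 i h /andP[t10 t1T].
have /andP[eps0 _] := he; have /andP[eta0 _] := hn.
have eps2 : 0 < eps ^+ 2 by rewrite exprn_gt0.
have v0 : 0 < torus_volume by exact: vol_gt0.
have M0 : 0 <= M by rewrite (le_trans ler01).
have tu s : 0 <= s <= T -> bounded_torus_fun (u s).
  by move=> /(C0_in_periodic Cu)[p q]; exact: tfun_continuous.
have tg s : 0 <= s <= T -> bounded_torus_fun (g s).
  by move=> /(C0_in_periodic Cg)[p q]; exact: tfun_continuous.
set z := h *: delta_mx 0 i.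
pose X s := sqnorm (fdiff3 z (u s)).
pose L := (h * (A / eps)) ^+ 6 * (M ^+ 2 * torus_volume).
have p6 (a : R) : 0 <= a ^+ 6 by rewrite (_ : a ^+ 6 = (a ^+ 3) ^+ 2) ?sqr_ge0// -exprM.
have L0 : 0 <= L.
  by rewrite /L mulr_ge0// mulr_ge0 ?sqr_ge0// ltW.
have dX s : 0 <= s <= T ->
    difquot T X s (2 * II (fun x => fdiff3 z (u s) x * fdiff3 z (g s) x)).
  by move=> sT; apply: energy_difquot => //; [exact: tg|move=> e e0; exact: hg].
suff : X t1 <= X 0 + 2 * L by [].
apply: barrier => //.
- apply: (difquot_continuous (ltW t1T)) => s /andP[s0 st].
  exists (2 * II (fun x => fdiff3 z (u s) x * fdiff3 z (g s) x)).
  by apply: dX; rewrite s0 (le_trans st (ltW t1T)).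
- by rewrite lerDl mulr_ge0.
move=> t /andP[t0 tt1] Xt.
have tT : t < T by rewrite (le_lt_trans tt1).
have tT' : 0 <= t <= T by rewrite !ltW.
have tv := tfun_dif3 z (tu t tT').
set v := fdiff3 z (u t) in tv.
have tw : bounded_torus_fun (fdiff3 z (derive1 f \o u t)).
  have cf : continuous (derive1 f) := @smoothR_continuous R f 1 sf.
  by apply: tfun_dif3; apply: tfun_comp (tu t tT').
set w := fdiff3 z (derive1 f \o u t) in tw.
have uMt x : `|u t x| <= M by apply: uM; rewrite (ltW t0).
have hw : sqnorm w <= C * sqnorm v by apply: HC => //; exact: tu.
have low N : torus_volume^-1 * (\sum_(k <- cube N | `|(k i)%:~R| <= A / eps) fourier_power k v) <= L.
  apply: le_trans (low_modes h N i A0 eps0 (tu t tT')) _.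
  rewrite /L ler_wpM2l// -II_cst; apply: II_le_tfun; [exact: tfunX (tu t tT')|exact: tfun_cst|].
  by move=> x; rewrite -(real_normK (num_real (u t x))) lerXn2r// nnegrE.
have co := Hco eps eta he hn v L i tv low.
have cr := cross_term_bound tv tw hw.
have [ivL _] := dirichlet hrho eta0 tv.
have ivw := ic_tfun (tfunM tv tw).
have ed : II (fun x => v x * fdiff3 z (g t) x) =
    - (II (fun x => v x * nonlocal_op rho eta v x) + (eps ^+ 2)^-1 * II (fun x => v x * w x)).
  rewrite -(IIZ (eps ^+ 2)^-1 ivw) -(IID ivL (icZ _ ivw)) -mulN1r.
  rewrite -(IIZ (-1) (icD ivL (icZ _ ivw))); apply: eq_Rintegral => x _.
  have eqx y : g t y = - (nonlocal_op rho eta (u t) y + (eps ^+ 2)^-1 * derive1 f (u t y)).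
    by have := Eq t y; rewrite t0 tT => /(_ isT); lra.
  rewrite /v /w (nonlocal_dif3 z eta0 (tu t tT')) !dif3E !eqx /=; ring.
apply: (difquot_neg (T := T) (d := 2 * II (fun x => v x * fdiff3 z (g t) x))).
- by rewrite t0 ltW.
- rewrite pmulr_rlt0// ed oppr_lt0.
  have q0 : 0 < (eps ^+ 2)^-1 by rewrite invr_gt0.
  have X0 : 0 <= X 0 by exact: nrm2_ge0.
  have cr' : (eps ^+ 2)^-1 * - ((1 + C) / 2 * sqnorm v) <= (eps ^+ 2)^-1 * II (fun x => v x * w x).
    by rewrite ler_pM2l.
  have pos : 0 < (1 + C) * (eps ^+ 2)^-1 * (sqnorm v / 2 - L).
    apply: mulr_gt0; first by rewrite mulr_gt0//; lra.
    by have Xv : X 0 + 2 * L < sqnorm v := Xt; lra.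
  by lra.
- exact: dX.
Qed.

Lemma mderiv_foldr (a : 'I_n -> nat) w : exists s : seq 'I_n, mderiv a w = foldr pderiv w s.
Proof.
rewrite /mderiv; elim: (enum 'I_n) => [|i l [s IH]]; first by exists [::].
exists (nseq (a i) i ++ s); rewrite /= IH; elim: (a i) => [//|m IHm].
by rewrite iterS IHm.
Qed.

Lemma measurable_mderiv (a : 'I_n -> nat) w : smooth w -> measurable_fun setT (mderiv a w).
Proof.
move=> sw; have [s ->] := mderiv_foldr a w; apply: measurable_continuous.
by have [] := sw s.
Qed.

(** The initial value is attained almost everywhere only, whereas the energy starts from
the continuous representative. *)
Lemma L2_derivative_ae (a : 'I_n -> nat) w w' v : L2 w -> L2 w' ->
  {ae leb R n, forall x, w' x = w x} -> L2_derivative a w v -> L2_derivative a w' v.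
Proof.
move=> Lw Lw' ww' [Lv wd]; split => // phi tphi; rewrite -(wd phi tphi).
have mphi := measurable_mderiv a tphi.1.
have [mw mw'] := (sqi_measurable (L2_sqi Lw), sqi_measurable (L2_sqi Lw')).
rewrite /Rintegral; congr fine; apply: ae_eq_integral.
- exact: measurable_cell.
- by apply/measurable_EFinP; apply: measurable_funTS; exact: measurable_funM.
- by apply/measurable_EFinP; apply: measurable_funTS; exact: measurable_funM.
- by apply: filterS ww' => x -> _.
Qed.

Lemma tfun_L2 w : bounded_torus_fun w -> L2 w.
Proof.
move=> tw; have [[mw _] pw] := tw; split => //.
exact: (ic_tfun (tfunX 2 tw)).
Qed.

Lemma CnormN w : Cnorm (fun x => - w x) = Cnorm w.
Proof.
have H v : torus_periodic v /\ continuous v -> torus_periodic (fun x => - v x) /\ continuous (fun x => - v x).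
  move=> [pv cv]; split; first by move=> x i; rewrite pv.
  by move=> x; apply: (@cvgN _ _ V (nbhs (x : V))); exact: cv.
rewrite /Cnorm; case: asboolP => h1; case: asboolP => h2 //.
- by congr ereal_sup; apply: eq_imagel => x _; rewrite normrN.
- exfalso; apply: h2; have := H _ h1.
  by rewrite (_ : (fun x => - - w x) = w)//; apply/funext => x; rewrite opprK.
- by exfalso; apply: h1; exact: H.
Qed.

Lemma C0_inN T u : C0_in Cnorm T u -> C0_in Cnorm T (fun t x => - u t x).
Proof.
move=> H t ht; have [h1 h2] := H t ht; split; first by rewrite CnormN.
rewrite [X in X @ _ --> _](_ : _ = (fun s => Cnorm (fun x => u s x - u t x))); first exact: h2.
apply/funext => s; rewrite -CnormN; congr Cnorm; apply/funext => x; ring.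
Qed.
End energy.

(** * The uniform bound *)

Section conclusion.
Context {R : realType} {m : nat}.
Local Notation n := m.+2.
Local Notation V := 'rV[R]_n.
Local Notation torus_volume := (@torus_volume R n).

Lemma time_measure_itv (T : R) : {ae time_measure T, forall t, 0 < t < T}.
Proof.
exists (~` `]0, T[%classic); split.
- by apply: measurableC; exact: measurable_itv.
- have -> : time_measure T (~` `]0, T[%classic) =
      (@lebesgue_measure R) (~` `]0, T[%classic `&` `]0, T[%classic) by [].
  by rewrite setICl measure0.
- by move=> t /= ht; rewrite in_itv/=; exact: ht.
Qed.

Variables (rho : R -> R -> R).
Hypothesis hrho : kernel_family n rho.

(** The upper bound and, for - u with the nonlinearity r -> - f'(- r), the lower one. *)
Lemma solution_bounded f R0 T eta eps (u0 : V -> R) u g : potential f R0 -> 0 < eta -> 0 < eps ->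
  0 < T ->
  C0_in Cnorm T u -> C0_in Cnorm T g ->
  (forall t x, 0 < t < T -> difquot T (fun s => u s x) t (g t x)) ->
  (forall t x, 0 < t < T ->
    g t x + nonlocal_op rho eta (u t) x + derive1 f (u t x) / eps ^+ 2 = 0) ->
  {ae leb R n, forall x, u 0 x = u0 x} -> {ae leb R n, forall x, `|u0 x| <= R0} ->
  forall t x, 0 <= t < T -> `|u t x| <= R0.
Proof.
move=> hf eta0 eps0 T0 Cu Cg Du Eq ui u0R.
have T00 : (0 : R) <= 0 <= T by apply/andP; split => //; exact: ltW.
have uR0 : forall x, `|u 0 x| <= R0.
  apply: ae_le_continuous; first exact: (C0_in_periodic Cu T00).2.
  by apply: filterS2 ui u0R => x ->.
move=> t x ht; rewrite ler_norml; apply/andP; split.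
  rewrite lerNl.
  apply: (@max_principle R n rho hrho eta eps T R0 (fun r => - derive1 f (- r))
    (fun t x => - u t x) (fun t x => - g t x) eta0 eps0) => //.
  - exact: C0_inN.
  - move=> s hs y e e0; have [dl dl0 hd] := Du s y hs e e0; exists dl => // r rT rs rd.
    have := hd r rT rs rd; congr (_ <= _).
    by rewrite -normrN; congr (`|_|); ring.
  - move=> s y hs; rewrite opprK nonlocal_opN//; last first.
      have [p q] : torus_periodic (u s) /\ continuous (u s).
        by apply: (C0_in_periodic Cu); case/andP: hs => /ltW -> /ltW.
      exact: tfun_continuous.
    by rewrite mulNr -!opprD Eq// oppr0.
  - move=> r hr; rewrite oppr_gt0; apply: (f'_left hf); rewrite ltrN2//.
  - by move=> y; have := uR0 y; rewrite ler_norml lerNl => /andP[].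
apply: (@max_principle R n rho hrho eta eps T R0 (derive1 f) u g eta0 eps0) => //.
- by move=> s hs y; exact: Du.
- exact: f'_right hf.
- by move=> y; have := uR0 y; rewrite ler_norml => /andP[].
Qed.

Lemma initial_energy (u0 w : V -> R) K i h : 0 <= K -> Sobolev 3 u0 -> bounded_torus_fun w ->
  {ae leb R n, forall x, w x = u0 x} -> (Hnorm 3 u0 <= K%:E)%E ->
  sqnorm (fdiff3 (h *: delta_mx 0 i) w) <= h ^+ 6 * K ^+ 2.
Proof.
move=> K0 S0 tw wu0 hK.
pose a : {ffun 'I_n -> 'I_4} := [ffun j => if j == i then ord_max else ord0].
have aE : (fun j => a j : nat) = (fun j => if j == i then 3%N else 0%N).
  by apply/funext => j; rewrite ffunE; case: eqP.
have a3 : (\sum_j a j <= 3)%N.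
  rewrite (bigD1 i)//= big1 ?addn0 ?ffunE ?eqxx// => j /negbTE ji.
  by rewrite ffunE ji.
have dv := wderivP S0 a3; have hv := Hnorm_component K0 S0 a3 hK.
rewrite aE in dv hv.
have p6 : 0 <= h ^+ 6 by rewrite (_ : h ^+ 6 = (h ^+ 3) ^+ 2) ?sqr_ge0// -exprM.
apply: (@le_trans _ _ (h ^+ 6 * sqnorm (wderiv (fun j => if j == i then 3%N else 0%N) u0))).
  apply: dif3_le_weak; first exact: tfun_L2.
  exact: (L2_derivative_ae S0.1 (tfun_L2 tw) wu0 dv).
by rewrite ler_wpM2l.
Qed.

(** With eps <= 1 the low mode term, of the order of eps^-6, is dominated by the initial
energy, of the order of eps^-32; the square root gives eps^-16. *)
Lemma uniform_H3_bound (T K : R) (f : R -> R) (R0 : R) : 0 < T -> 0 < K -> potential f R0 ->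
  exists eps0 c C : R,
    [/\ 0 < eps0 < 1, 0 < c, 0 < C &
    forall eps eta : R, 0 < eps < eps0 -> 0 < eta <= c * eps ^+ 4 ->
    forall (u0 : V -> R) (u : R -> V -> R),
      Sobolev 3 u0 ->
      {ae leb R n, forall x, `|u0 x| <= R0} ->
      (Hnorm 3 u0 <= (K / eps ^+ 16)%:E)%E ->
      solution rho f T eta eps u0 u ->
      (Linf_norm (Hnorm 3) T u <= (C / eps ^+ 16)%:E)%E].
Proof.
move=> T0 K0 hf.
have hpos := kernel_min_gt0 hrho (sphere_constant_gt0 m) (ltn0Sn m).
have [A [c [A0 c0 HE]]] := energy_bound hrho hpos (f_smooth hf) (R0_ge1 hf).
have v0 : 0 < torus_volume by exact: vol_gt0.
have p6 (a : R) : 0 <= a ^+ 6 by rewrite (_ : a ^+ 6 = (a ^+ 3) ^+ 2) ?sqr_ge0// -exprM.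
pose M := R0 ^+ 2 * torus_volume.
have M0 : 0 <= M by rewrite mulr_ge0 ?sqr_ge0// ltW.
pose D := K ^+ 2 + 2 * (A ^+ 6 * M).
have D0 : 0 <= D by rewrite addr_ge0 ?sqr_ge0// mulr_ge0// mulr_ge0.
pose E := 4 ^+ n * (M + 8 * n%:R * D).
have E0 : 0 <= E.
  by rewrite mulr_ge0 ?exprn_ge0// addr_ge0// mulr_ge0// mulr_ge0.
exists 2^-1, c, (Num.sqrt E + 1); split => //.
  by apply/andP; split; lra.
move=> eps eta /andP[eps0 eps1] heta u0 u S0 u0R H3 sol.
have he : 0 < eps < 1 by rewrite eps0/=; lra.
have eta0 : 0 < eta by case/andP: heta.
have [Cu [g Cg hg]] := C1_in_difquot (sol_C1_C0 sol).
have Du t x : 0 < t < T -> difquot T (fun s => u s x) t (g t x).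
  move=> ht e e0; have tT : 0 <= t <= T by case/andP: ht => /ltW -> /ltW.
  by have [dl dl0 hd] := hg t e tT e0; exists dl => // s sT st sd; exact: hd.
have Eq t x : 0 < t < T ->
    g t x + nonlocal_op rho eta (u t) x + derive1 f (u t x) / eps ^+ 2 = 0.
  by move=> ht; rewrite -(difquot_derive1 ht (Du t x ht)); exact: (sol_equation sol).
have uR := solution_bounded hf eta0 eps0 T0 Cu Cg Du Eq (sol_initial sol) u0R.
have T00 : (0 : R) <= 0 <= T by apply/andP; split => //; exact: ltW.
have tu t : 0 <= t <= T -> bounded_torus_fun (u t).
  by move=> /(C0_in_periodic Cu)[p q]; exact: tfun_continuous.
pose q := eps ^+ 16.
have q0 : 0 < q by rewrite exprn_gt0.
have q1 : q <= 1 by rewrite exprn_ile1// ?ltW//; case/andP: he.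
have Kq : 0 <= K / q by rewrite divr_ge0// ltW.
have X0 i h := initial_energy i h Kq S0 (tu 0 T00) (sol_initial sol) H3.
have finite : (Linf_norm (Hnorm 3) T u < +oo)%E := (sol_Linf_H3 sol).2.
have ae1 : \forall t \ae time_measure T, (Hnorm 3 (u t) <= Linf_norm (Hnorm 3) T u)%E.
  exact: ess_sup_ge.
have ae2 := time_measure_itv T.
have FF : Filter (almost_everywhere (time_measure T)) by exact: ae_filter_ringOfSetsType.
apply/ess_supP; apply: (@filterS2 _ _ FF _ _ _ _ ae1 ae2) => t ht /andP[t0 tT].
have St := Hnorm_Sobolev (le_lt_trans ht finite).
have tt : 0 <= t < T by rewrite ltW.
have tt' : 0 <= t <= T by rewrite !ltW.
have nu : sqnorm (u t) <= M.
  rewrite /M -II_cst; apply: II_le_tfun; [exact: tfunX (tu t tt')|exact: tfun_cst|].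
  have R00 : 0 <= R0 by rewrite (le_trans ler01)//; exact: R0_ge1 hf.
  move=> x; rewrite -(real_normK (num_real (u t x))) lerXn2r ?nnegrE//.
  exact: uR.
have eq6 : (eps ^+ 6)^-1 <= (q ^+ 2)^-1.
  rewrite lef_pV2 ?posrE ?exprn_gt0// /q -exprM ler_wiXn2l// ?ltW//.
  by case/andP: he.
have hX i h : 0 < h -> sqnorm (fdiff3 (h *: delta_mx 0 i) (u t)) <= h ^+ 6 * (D / q ^+ 2).
  move=> h0; apply: (le_trans (HE eps eta T he heta u g Cu Cg hg Eq uR t i h tt)).
  apply: (le_trans (lerD (X0 i h) (lexx _))).
  have -> : h ^+ 6 * (K / q) ^+ 2 + 2 * ((h * (A / eps)) ^+ 6 * (R0 ^+ 2 * torus_volume)) =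
      h ^+ 6 * (K ^+ 2 / q ^+ 2 + 2 * (A ^+ 6 * M) / eps ^+ 6).
    have qn : q != 0 by rewrite gt_eqF.
    have en : eps != 0 by rewrite gt_eqF.
    by rewrite -/M; move: (M) (q) qn => M' q' qn; field; rewrite qn en.
  have -> : D / q ^+ 2 = K ^+ 2 / q ^+ 2 + 2 * (A ^+ 6 * M) / q ^+ 2 by exact: mulrDl.
  apply: ler_wpM2l; first exact: p6.
  apply: lerD; first exact: lexx.
  by apply: ler_wpM2l eq6; apply: mulr_ge0 => //; exact: mulr_ge0 (p6 A) M0.
have Dq : 0 <= D / q ^+ 2 by rewrite divr_ge0// sqr_ge0.
apply: (le_trans (Hnorm3_le St Dq nu hX)).
rewrite lee_fin; apply: (@le_trans _ _ (Num.sqrt (E / q ^+ 2))).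
  rewrite ler_wsqrtr//.
  have -> : E / q ^+ 2 = 4 ^+ n * (M / q ^+ 2 + 8 * n%:R * (D / q ^+ 2)).
    by rewrite /E -mulrA mulrDl -(mulrA (8 * n%:R)).
  apply: ler_wpM2l; first by rewrite exprn_ge0.
  apply: lerD; last exact: lexx.
  by rewrite ler_peMr// invf_ge1 ?exprn_gt0// exprn_ile1// ltW.
rewrite sqrtrM// sqrtrV ?sqr_ge0// sqrtr_sqr (gtr0_norm q0).
by rewrite ler_wpM2r ?invr_ge0 ?(ltW q0)// lerDl.
Qed.
End conclusion.

Theorem theorem3p3 (R : realType) (n : nat) (hn : n = 2%N \/ n = 3%N)
    (T K : R) (hT : 0 < T) (hK : 0 < K)
    (rho : R -> R -> R) (hrho : kernel_family n rho)
    (f : R -> R) (R0 : R) (hf : potential f R0) :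
  exists eps0 c C : R,
    [/\ 0 < eps0 < 1, 0 < c, 0 < C &
    forall eps eta : R, 0 < eps < eps0 -> 0 < eta <= c * eps ^+ 4 ->
    forall (u0 : 'rV[R]_n -> R) (u : R -> 'rV[R]_n -> R),
      Sobolev 3 u0 ->
      {ae leb R n, forall x, `|u0 x| <= R0} ->
      (Hnorm 1 u0 <= (K / eps ^+ 2)%:E)%E ->
      (Hnorm 2 u0 <= (K / eps ^+ 6)%:E)%E ->
      (Hnorm 3 u0 <= (K / eps ^+ 16)%:E)%E ->
      solution rho f T eta eps u0 u ->
      (Linf_norm (Hnorm 3) T u <= (C / eps ^+ 16)%:E)%E].
Proof.
have [m nE] : exists m, n = m.+2 by case: hn => ->; [exists 0%N|exists 1%N].
subst n; have [eps0 [c [C [h1 h2 h3 H]]]] := uniform_H3_bound hrho hT hK hf.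
exists eps0, c, C; split => // eps eta he heta u0 u S0 u0R _ _ H3.
exact: H.
Qed.
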